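(* Let $n\ge1$ and $0<r<R<1$. Let $\delta>0$ be such that for each $z\in\partial B^n_r$ and $p=\frac{R}{r}z$ we have $B^n(z,\delta)\subset B^n$ and $\tanh c_{B^n}(p,w)<R$ for all $w\in B^n(z,\delta)$. Let $z_1,\dots,z_m\in\partial B^n_r$ be such that $\partial B^n_r\subset\bigcup_{i=1}^m B^n(z_i,\delta)$, and set $p_i=\frac{R}{r}z_i$. Write $z_i=(z_{i1},\dots,z_{in})$, $p_i=(p_{i1},\dots,p_{in})$, and $$H_i=\Big\{w\in\mathbb{C}^n:\ \sum_{j=1}^n\overline{(z_{ij}-p_{ij})}\,(w_j-p_{ij})=0\Big\},\quad 1\le i\le m,$$ $H=\bigcup_{i=1}^mH_i$ and $D=B^n\setminus H$. Then neither of the functions $s_D$ and $\tilde e_D$ is plurisubharmonic on $D$.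
   Context: $B^n$ is the open Euclidean unit ball in $\mathbb{C}^n$, $B^n(p,\delta)$ the open Euclidean ball with centre $p$ and radius $\delta$, $B^n_r=B^n(0,r)$, $\mathbb{D}$ the unit disk in $\mathbb{C}$; $O(X,Y)$ is the set of holomorphic maps from $X$ into $Y$. Carathéodory pseudodistance on a domain $D$: $c_D(z,w)=\sup\{\tanh^{-1}|\lambda| : f\in O(D,\mathbb{D}),\ f(z)=0,\ f(w)=\lambda\}$, with balls $B^c_D(z,r)=\{w\in D: c_D(z,w)<r\}$. For a bounded domain $D\subset\mathbb{C}^n$ and $z\in D$: squeezing function $s_D(z)=\sup\{r>0:\ rB^n\subset f(D)$ for some injective $f\in O(D,B^n)$ with $f(z)=0\}$; Fridman invariant $\tilde e_D(z)=\sup\{\tanh(r):\ B^c_D(z,r)\subset f(B^n)$ for some injective $f\in O(B^n,D)\}$. *)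

(* Defs.v *)
From HB Require Import structures.
From mathcomp Require Import all_boot all_order all_algebra.
From mathcomp Require Import all_classical all_reals all_analysis.
From mathcomp Require Import complex.

Set Implicit Arguments.
Unset Strict Implicit.
Unset Printing Implicit Defensive.

Import Order.TTheory GRing.Theory Num.Theory.
Import numFieldNormedType.Exports.

Local Open Scope classical_set_scope.
Local Open Scope ring_scope.
Local Open Scope complex_scope.

(* The complex numbers are K[i] for K : realType. As a normed space over      *)
(* themselves they are written K[i]^o, and C^n is 'rV[K[i]]_n. The library    *)
(* norm of the latter is the sup norm, so the Euclidean norm is defined here; *)
(* topology and complex (Frechet) differentiability are the same for both.    *)

Section euclidean.
Context {K : realType} {n : nat}.
Implicit Types p z : 'rV[K[i]]_n.

Definition enorm z : K := Num.sqrt (\sum_(j < n) Normc.normc (z ord0 j) ^+ 2).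

Definition eball p (d : K) : set 'rV[K[i]]_n := [set z | enorm (z - p) < d].

Definition esphere (r : K) : set 'rV[K[i]]_n := [set z | enorm z = r].

(* The complex affine hyperplane through p orthogonal to z - p. *)
Definition normal_hyperplane z p : set 'rV[K[i]]_n :=
  [set w | \sum_(j < n) conjc (z ord0 j - p ord0 j) * (w ord0 j - p ord0 j) = 0].

End euclidean.

(* f is in O(X, Y); values of f outside the open set X are irrelevant. *)
Definition holomorphic_map {K : realType} {V W : normedModType K[i]}
    (X : set V) (Y : set W) (f : V -> W) : Prop :=
  (forall z, X z -> differentiable f z) /\ (forall z, X z -> Y (f z)).

Section hyperbolic.
Context {K : realType}.
Implicit Types x : K.

Definition tanh x : K := (expR x - expR (- x)) / (expR x + expR (- x)).

(* The inverse of tanh on ]-1, 1[. *)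
Definition artanh x : K := ln ((1 + x) / (1 - x)) / 2.

Definition etanh (x : \bar K) : K :=
  match x with EFin r => tanh r | +oo%E => 1 | -oo%E => -1 end.

End hyperbolic.

Section invariants.
Context {K : realType} {n : nat}.
Implicit Types (D : set 'rV[K[i]]_n) (z w : 'rV[K[i]]_n).

Definition unit_disk : set K[i]^o := [set l | Normc.normc l < 1].

Definition caratheodory D z w : \bar K :=
  ereal_sup [set (artanh (Normc.normc (f w)))%:E
            | f in [set f : 'rV[K[i]]_n -> K[i]^o |
                    holomorphic_map D unit_disk f /\ f z = 0]].

Definition caratheodory_ball D z (r : K) : set 'rV[K[i]]_n :=
  [set w | D w /\ (caratheodory D z w < r%:E)%E].

Definition squeezing D z : \bar K :=
  ereal_sup [set r%:E
            | r in [set r : K | 0 < r /\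
                    exists f : 'rV[K[i]]_n -> 'rV[K[i]]_n,
                      [/\ holomorphic_map D (eball 0 1) f, set_inj D f,
                          f z = 0 & eball 0 r `<=` f @` D]]].

Definition fridman D z : \bar K :=
  ereal_sup [set (tanh r)%:E
            | r in [set r : K | 0 < r /\
                    exists f : 'rV[K[i]]_n -> 'rV[K[i]]_n,
                      [/\ holomorphic_map (eball 0 1) D f,
                          set_inj (eball 0 1) f &
                          caratheodory_ball D z r `<=` f @` eball 0 1]]].

End invariants.

Section plurisubharmonic.
Context {K : realType}.

Definition usc_on {V : normedModType K[i]} (U : set V) (v : V -> \bar K) : Prop :=
  forall z, U z -> forall a : K, (v z < a%:E)%E ->
    \forall w \near within U (nbhs z), (v w < a%:E)%E.

Definition circle_mean (v : K[i]^o -> \bar K) (a : K[i]^o) (rho : K) : \bar K :=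
  (((2 * pi)^-1)%:E *
   \int[lebesgue_measure]_(t in `[0%R, (2 * pi)%R])
     v ((a : K[i]) + rho%:C * (cos t +i* sin t))%R)%E.

(* The constant -oo is allowed as a (pluri)subharmonic function. *)
Definition subharmonic (U : set K[i]^o) (v : K[i]^o -> \bar K) : Prop :=
  [/\ forall l, U l -> (v l < +oo)%E,
      usc_on U v &
      forall (a : K[i]^o) (rho : K), 0 < rho ->
        [set l : K[i]^o | Normc.normc ((l : K[i]) - a) <= rho] `<=` U ->
        (v a <= circle_mean v a rho)%E].

Definition plurisubharmonic {n : nat} (D : set 'rV[K[i]]_n)
    (u : 'rV[K[i]]_n -> \bar K) : Prop :=
  [/\ forall z, D z -> (u z < +oo)%E,
      usc_on D u &
      forall a b : 'rV[K[i]]_n,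
        subharmonic [set l : K[i]^o | D (a + (l : K[i]) *: b)]
                    (fun l : K[i]^o => u (a + (l : K[i]) *: b))].

End plurisubharmonic.

(* Main.v *)
(* Let L be the product of the affine functions defining the hyperplanes, so that
   D = {|x| < 1, L x <> 0}, and let |w| = r. The hypothesis on delta provides a
   p = p_i with L p = 0 and T := tanh c_B(p, w) < R. Bounded holomorphic functions
   do not see the zeros of L, hence every f in O(D, disc) with f(w) = 0 satisfies
   |f(q)| <= T' for q in D near p, as soon as T' > T.
   - Let f in O(D, B) be injective with f(w) = 0 and r'B contained in f(D), where
     r' > T'. For q_k -> p the points f(q_k) cluster at some f(d) with d in D, and
     since f is open and injective this forces q_k to cluster at d <> p.
   - Let f in O(B, D) be injective with an image containing the c_D-ball of radius
     artanh T'' > artanh T' around w. Then f^-1 is holomorphic on D near p, and by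
     the maximum principle on a complex line through p its values stay in a
     smaller ball, so they cluster at some x with f(x) = p, which is not in D.
   Hence both functions are at most T < R at w. At 0 they are at least R, by the
   identity and by x |-> R x, because {|x| < R} lies in D; so the sub-mean value
   property fails on a circle of radius r centred at 0.

   No power series are used. The main tool is the maximum principle for bounded
   functions off the zeros of L: it applies to L q^N for all N, so it applies to q.
   It yields Lipschitz bounds and, with L the Jacobian of an injective holomorphic
   map carried to the target space, the openness of such maps. *)

Require Import Defs.
From mathcomp Require Import all_boot all_order all_algebra.
From mathcomp Require Import all_classical all_reals all_analysis.
From mathcomp Require Import complex.
From mathcomp Require Import ring lra.

Set Implicit Arguments.
Unset Strict Implicit.
Unset Printing Implicit Defensive.

Import Order.TTheory GRing.Theory Num.Theory.
Import numFieldNormedType.Exports.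
Import Normc.

Local Open Scope classical_set_scope.
Local Open Scope ring_scope.
Local Open Scope complex_scope.

(** The obstacle is that differentiability is given pointwise, with no regularity of the derivative,
    so a Jacobian determinant cannot be assumed holomorphic. It is reached as a locally uniform
    limit of holomorphic functions, and such limits still obey the maximum principle, which is all
    that is asked of the factor [L]. The maximum principle itself grows out of a Cauchy estimate at
    the centre of a square with too large a constant, corrected by passing to powers. The bound for
    the squeezing function rests on openness of injective maps. The bound for the Fridman invariant
    needs more, the holomorphy of the inverse, hence a Jacobian without zeros. The hyperplane
    through [p_i] is orthogonal to the radius, so [p_i] is its point nearest to the origin, at
    distance [R]; this is why the ball of radius [R] survives in [D]. The bounds [T < R] vary with
    the point of the sphere, and nothing makes them uniform by itself: upper semicontinuity and
    compactness of a circle provide one bound below [R]. *)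

Local Notation Re := complex.Re.
Local Notation Im := complex.Im.

(** * The modulus and the topology of the complex plane *)

Section complex_norm.
Context {K : realType}.
Local Notation C := K[i].
Implicit Types (x y z : C).

Lemma complex_normE z : `|z| = (normc z)%:C.
Proof. by []. Qed.

Lemma normc_ge0 z : 0 <= normc z.
Proof. by case: z => a b; apply: sqrtr_ge0. Qed.

Lemma normc_eq0 z : (normc z == 0) = (z == 0).
Proof. by apply/eqP/eqP => [/eq0_normc|->]; last exact: normc0. Qed.

Lemma normc_gt0 z : (0 < normc z) = (z != 0).
Proof. by rewrite lt_def normc_ge0 andbT normc_eq0. Qed.

Lemma normcB z y : normc (z - y) = normc (y - z).
Proof. by rewrite -normcN opprB. Qed.

Lemma le_normcB z y : normc (z - y) <= normc z + normc y.
Proof. by rewrite -(normcN y); apply: le_normcD. Qed.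

Lemma normc_sub_le z y : normc z - normc y <= normc (z - y).
Proof. by rewrite lerBlDr; rewrite -{1}(subrK y z); apply: le_normcD. Qed.

Lemma normc_real (a : K) : normc a%:C = `|a|.
Proof. by rewrite /normc /= expr0n addr0 sqrtr_sqr. Qed.

Lemma normcX z n : normc (z ^+ n) = normc z ^+ n.
Proof. by elim: n => [|n IH]; rewrite ?expr0 ?normc1 // !exprS normcM IH. Qed.

Lemma normcf z y : normc (z / y) = normc z / normc y.
Proof. by rewrite normcM normcV. Qed.

Lemma normc_conjc z : normc (conjc z) = normc z.
Proof. by case: z => a b; rewrite /normc /= sqrrN. Qed.

Lemma sqr_normcE z : normc z ^+ 2 = Re z ^+ 2 + Im z ^+ 2.
Proof. by case: z => a b /=; rewrite sqr_sqrtr // addr_ge0 // sqr_ge0. Qed.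

Lemma mulcJ z : z * conjc z = (normc z ^+ 2)%:C.
Proof. by rewrite sqr_normcE; case: z => a b /=; simpc; congr (_ +i* _); ring. Qed.

Lemma Re_le_normc z : `|Re z| <= normc z.
Proof.
rewrite -(@ler_pXn2r _ 2) ?nnegrE ?normc_ge0 // sqr_normcE real_normK ?num_real //.
by rewrite lerDl sqr_ge0.
Qed.

Lemma Im_le_normc z : `|Im z| <= normc z.
Proof.
rewrite -(@ler_pXn2r _ 2) ?nnegrE ?normc_ge0 // sqr_normcE real_normK ?num_real //.
by rewrite lerDr sqr_ge0.
Qed.

Lemma normc_le_ReIm z : normc z <= `|Re z| + `|Im z|.
Proof.
rewrite -(@ler_pXn2r _ 2) ?nnegrE ?normc_ge0 ?addr_ge0 // sqr_normcE.
rewrite sqrrD !real_normK ?num_real //.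
have : 0 <= `|Re z| * `|Im z| by rewrite mulr_ge0.
by lra.
Qed.

Lemma posC_real (e : C) : 0 < e -> e = (Re e)%:C /\ 0 < Re e.
Proof. by case: e => a b; rewrite ltcE /= => /andP[/eqP -> ->]. Qed.

End complex_norm.

Section complex_topology.
Context {K : realType}.
Local Notation C := K[i].

(** The norm of [C^o] has values in [C], so its radii are complex numbers that happen to be real.
    From here on radii and moduli live in [K]. *)
Lemma nbhsCP (z : C^o) (P : set C^o) :
  nbhs z P <-> exists2 e : K, 0 < e & forall w : C, normc (w - (z : C)) < e -> P w.
Proof.
split.
  move=> /(@nbhs_normP C C^o)[e /= /posC_real [-> e0] H]; exists (Re e) => // w Hw.
  by apply: H; rewrite /= distrC complex_normE ltcR.
case=> e e0 H; apply/(@nbhs_normP C C^o); exists (e%:C); first by rewrite /= ltcR.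
by move=> w /=; rewrite distrC complex_normE ltcR => /H.
Qed.

Lemma continuous_CP (T : topologicalType) (f : T -> C^o) x :
  {for x, continuous f} <->
  forall e : K, 0 < e -> \forall y \near x, normc ((f y : C) - f x) < e.
Proof.
split.
  move=> cf e e0; apply: (cf [set w : C^o | normc ((w : C) - f x) < e]).
  by apply/nbhsCP; exists e.
move=> H A /nbhsCP[e e0 HA]; have := H _ e0.
by apply: filterS => y /HA.
Qed.

Lemma continuous_normc (T : topologicalType) (f : T -> C^o) x :
  {for x, continuous f} -> {for x, continuous (fun y => normc (f y) : K)}.
Proof.
move=> /continuous_CP H; apply/cvgrPdist_lt => e e0.
have := H _ e0; apply: filterS => y; apply: le_lt_trans.
rewrite real_ler_norml ?num_real //; apply/andP; split.
  by rewrite lerBrDr -lerBrDl opprK addrC; have := normc_sub_le (f y) (f x); lra.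
by rewrite normcB; exact: normc_sub_le.
Qed.

Lemma continuous_Re (T : topologicalType) (f : T -> C^o) x :
  {for x, continuous f} -> {for x, continuous (fun y => Re (f y) : K)}.
Proof.
move=> /continuous_CP H; apply/cvgrPdist_lt => e e0.
have := H _ e0; apply: filterS => y; apply: le_lt_trans.
by rewrite normcB -[_ - _](raddfB (@Re K : Rcomplex K -> K)); exact: Re_le_normc.
Qed.

Lemma continuous_Im (T : topologicalType) (f : T -> C^o) x :
  {for x, continuous f} -> {for x, continuous (fun y => Im (f y) : K)}.
Proof.
move=> /continuous_CP H; apply/cvgrPdist_lt => e e0.
have := H _ e0; apply: filterS => y; apply: le_lt_trans.
by rewrite normcB -[_ - _](raddfB (@Im K : Rcomplex K -> K)); exact: Im_le_normc.
Qed.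

Lemma continuous_Complex (T : topologicalType) (f g : T -> K) x :
  {for x, continuous f} -> {for x, continuous g} ->
  {for x, continuous (fun y => (f y +i* g y : C^o))}.
Proof.
move=> cf cg; apply/continuous_CP => e e0.
have e20 : 0 < e / 2 by rewrite divr_gt0.
have /cvgrPdist_lt/(_ _ e20) Hf := cf.
have /cvgrPdist_lt/(_ _ e20) Hg := cg.
near=> y.
apply: le_lt_trans (normc_le_ReIm _) _ => /=.
rewrite (splitr e) ltrD // distrC; near: y; assumption.
Unshelve. all: by end_near. Qed.

End complex_topology.

(** * Integration along rectangles and Goursat's theorem *)

Section real_integral.
Context {K : realType}.
Implicit Types (a b c : K) (f g : K -> K).

Definition rint a b f : K := \int[@lebesgue_measure K]_(x in `[a, b]) f x.

Lemma continuous_integrable_itv a b f :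
  (forall x, a <= x <= b -> {for x, continuous f}) ->
  (@lebesgue_measure K).-integrable `[a, b] (EFin \o f).
Proof.
move=> cf; apply: continuous_compact_integrable; first exact: segment_compact.
apply: continuous_in_subspaceT => x; rewrite inE /= in_itv /=; exact: cf.
Qed.

Lemma rint_cst a b c : a <= b -> rint a b (fun=> c) = c * (b - a).
Proof.
move=> ab; rewrite /rint Rintegral_cst //= lebesgue_measure_itv /= lte_fin.
case: ltP => [_|ba]; first by rewrite -EFinD.
have -> : b = a by apply/eqP; rewrite eq_le ab ba.
by rewrite subrr.
Qed.

Lemma rintD a b f g :
  (forall x, a <= x <= b -> {for x, continuous f}) ->
  (forall x, a <= x <= b -> {for x, continuous g}) ->
  rint a b (fun x => f x + g x) = rint a b f + rint a b g.
Proof.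
by move=> cf cg; rewrite /rint RintegralD //; exact: continuous_integrable_itv.
Qed.

Lemma rintZ a b c f : (forall x, a <= x <= b -> {for x, continuous f}) ->
  rint a b (fun x => c * f x) = c * rint a b f.
Proof.
by move=> cf; rewrite /rint RintegralZl //; exact: continuous_integrable_itv.
Qed.

Lemma rint_id a b : a <= b -> rint a b id = (b ^+ 2 - a ^+ 2) / 2.
Proof.
rewrite le_eqVlt => /orP[/eqP ->|ab].
  by rewrite /rint set_itv1 Rintegral_set1 subrr mul0r.
have d (x : K) : is_derive x 1 (fun y : K => 2^-1 * y ^+ 2) x.
  apply: is_derive_eq; rewrite /GRing.scale /= mulr1; by field.
rewrite /rint /Rintegral (@continuous_FTC2 _ _ (fun y : K => 2^-1 * y ^+ 2)) //.
- by rewrite /=; field.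
- by apply: continuous_in_subspaceT => x _; exact: cvg_id.
- have cq : continuous (fun y : K => 2^-1 * y ^+ 2).
    move=> x; apply: differentiable_continuous; apply/derivable1_diffP.
    by have := d x => ?; apply: ex_derive.
  split.
  + by move=> x _; have := d x => ?; apply: ex_derive.
  + exact/cvg_at_right_filter/cq.
  + exact/cvg_at_left_filter/cq.
- by move=> x _; rewrite derive1E; apply: derive_val; exact: d.
Qed.

Lemma rint_bound a b f M : a <= b ->
  (forall x, a <= x <= b -> {for x, continuous f}) ->
  (forall x, a <= x <= b -> `|f x| <= M) ->
  `|rint a b f| <= M * (b - a).
Proof.
move=> ab cf bf.
have cf' : forall x, a <= x <= b -> {for x, continuous (fun y => `|f y|)}.
  by move=> x /cf h; apply: cvg_norm; exact: h.
apply: le_trans (le_normr_Rintegral _ (continuous_integrable_itv cf)) _ => //.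
rewrite -(@rint_cst a b M ab); apply: le_Rintegral => //.
- exact: continuous_integrable_itv.
- by apply: continuous_integrable_itv => x _; exact: cvg_cst.
Qed.

Lemma rint_split a c b f : a <= c <= b ->
  (forall x, a <= x <= b -> {for x, continuous f}) ->
  rint a b f = rint a c f + rint c b f.
Proof.
move=> /andP[ac cb] cf; have intf := continuous_integrable_itv cf.
rewrite /rint -(@Rintegral_itv_obnd_cbnd _ c); last first.
  apply: integrableS intf => //; apply: subset_itvr; by rewrite bnd_simp.
by rewrite -(Rintegral_itvB intf) ?bnd_simp // addrC subrK.
Qed.

Lemma le_rint a b f g : 
  (forall x, a <= x <= b -> {for x, continuous f}) ->
  (forall x, a <= x <= b -> {for x, continuous g}) ->
  (forall x, a <= x <= b -> f x <= g x) -> rint a b f <= rint a b g.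
Proof. by move=> *; apply: le_Rintegral => //; exact: continuous_integrable_itv. Qed.

End real_integral.

Section complex_integral.
Context {K : realType}.
Local Notation C := K[i].
Implicit Types (a b c : K) (f g : K -> C^o).

Definition cint a b f : C :=
  rint a b (fun x => Re (f x)) +i* rint a b (fun x => Im (f x)).

Lemma cintD a b f g :
  (forall x, a <= x <= b -> {for x, continuous f}) ->
  (forall x, a <= x <= b -> {for x, continuous g}) ->
  cint a b (fun x => f x + g x) = cint a b f + cint a b g.
Proof.
move=> cf cg; rewrite /cint.
rewrite [X in X +i* _](_ : _ = rint a b (fun x => Re (f x)) + rint a b (fun x => Re (g x))).
  rewrite [X in _ +i* X](_ : _ = rint a b (fun x => Im (f x)) + rint a b (fun x => Im (g x))) //.
  rewrite -rintD; last by move=> x /cg; exact: continuous_Im.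
    by congr rint; apply/funext => x; case: (f x) (g x) => [? ?] [].
  by move=> x /cf; exact: continuous_Im.
rewrite -rintD; last by move=> x /cg; exact: continuous_Re.
  by congr rint; apply/funext => x; case: (f x) (g x) => [? ?] [].
by move=> x /cf; exact: continuous_Re.
Qed.

(** Bounding real and imaginary parts separately costs the factor 2, which is absorbed later when
    the estimates are applied to powers. *)
Lemma cint_bound a b f M : a <= b ->
  (forall x, a <= x <= b -> {for x, continuous f}) ->
  (forall x, a <= x <= b -> normc (f x) <= M) ->
  normc (cint a b f) <= 2 * (M * (b - a)).
Proof.
move=> ab cf bf; apply: le_trans (normc_le_ReIm _) _.
rewrite mulr_natl mulr2n; apply: lerD => /=; apply: rint_bound => // x xab.
- exact/continuous_Re/cf.
- exact: le_trans (Re_le_normc _) (bf _ xab).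
- exact/continuous_Im/cf.
- exact: le_trans (Im_le_normc _) (bf _ xab).
Qed.

Lemma cint_split a c b f : a <= c <= b ->
  (forall x, a <= x <= b -> {for x, continuous f}) ->
  cint a b f = cint a c f + cint c b f.
Proof.
move=> acb cf; rewrite /cint (rint_split acb); last by move=> x /cf; exact: continuous_Re.
by rewrite [rint a b _](rint_split acb) //; move=> x /cf; exact: continuous_Im.
Qed.

Lemma cint_affine a b (u v : C) : a <= b ->
  cint a b (fun x => u + x%:C * v) =
  (b - a)%:C * u + ((b ^+ 2 - a ^+ 2) / 2)%:C * v.
Proof.
have E (p q : K) : a <= b -> 
    rint a b (fun x => p + q * x) = p * (b - a) + q * ((b ^+ 2 - a ^+ 2) / 2).
  move=> ab; rewrite rintD ?rint_cst ?rintZ ?rint_id //.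
  - by move=> x _; exact: cvg_id.
  - by move=> x _; exact: cvg_cst.
  - by move=> x _; apply: cvgM; [exact: cvg_cst|exact: cvg_id].
move=> ab; rewrite /cint; case: u v => [u1 u2] [v1 v2].
have -> : (fun x : K => Re ((u1 +i* u2) + x%:C * (v1 +i* v2))) = (fun x => u1 + v1 * x).
  by apply/funext => x /=; ring.
have -> : (fun x : K => Im ((u1 +i* u2) + x%:C * (v1 +i* v2))) = (fun x => u2 + v2 * x).
  by apply/funext => x /=; ring.
by rewrite !E //; simpc; congr (_ +i* _); ring.
Qed.

End complex_integral.

Section differential_expansion.
Context {K : realType}.
Local Notation C := K[i].

Lemma differentiable_expansion (V W : normedModType C) (f : V -> W) x :
  differentiable f x -> forall e : C, 0 < e ->
  \forall h \near (0 : V), `|f (x + h) - f x - 'd f x h| <= e * `|h|.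
Proof.
move=> /diff_locally /eqaddoP H e e0; move: (H e e0).
apply: filterS => h; rewrite /= !fctE /= [h + x]addrC.
by rewrite opprD addrA.
Qed.

Lemma differentiableC_expansion (f : C^o -> C^o) (z : C^o) :
  differentiable f z -> exists d : C, forall e : K, 0 < e -> exists2 dl : K, 0 < dl &
  forall w : C, normc (w - (z : C)) < dl -> normc ((f w : C) - f z - d * (w - (z : C))) <= e * normc (w - (z : C)).
Proof.
move=> df; exists ('d f z 1) => e e0.
have /(@differentiable_expansion _ _ _ _ df) : 0 < e%:C by rewrite ltcR.
move=> /nbhsCP[dl dl0 H]; exists dl => // w wz.
have := H (w - z); rewrite subr0 => /(_ wz).
rewrite [z + _]addrC subrK !complex_normE -rmorphM lecR; apply: le_trans.
have -> : 'd f z (w - z) = (w - z) * 'd f z 1 :> C.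
  by rewrite -[w - z in LHS]mulr1 -[LHS]/('d f z ((w - z) *: (1 : C^o))) linearZ.
by rewrite [_ * 'd f z 1]mulrC.
Qed.

End differential_expansion.

Section rectangle_integral.
Context {K : realType}.
Local Notation C := K[i].
Implicit Types (f g : C^o -> C^o) (x y : K).

Definition rectangle x0 x1 y0 y1 : set C^o :=
  [set z : C^o | x0 <= Re z <= x1 /\ y0 <= Im z <= y1].

Definition frame x0 x1 y0 y1 : set C^o :=
  [set z : C^o | rectangle x0 x1 y0 y1 z /\
    (Re z == x0) || (Re z == x1) || (Im z == y0) || (Im z == y1)].

Definition rectint f x0 x1 y0 y1 : C :=
  (cint x0 x1 (fun x => f (x +i* y0)) - cint x0 x1 (fun x => f (x +i* y1))) +
  'i%C * (cint y0 y1 (fun y => f (x1 +i* y)) - cint y0 y1 (fun y => f (x0 +i* y))).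

Lemma continuous_hseg f (x y : K) : {for (x +i* y : C^o), continuous f} ->
  {for x, continuous (fun t : K => f (t +i* y))}.
Proof.
move=> cf; refine (@continuous_comp _ _ _ (fun t : K => (t +i* y : C^o)) f _ _ cf).
by apply: continuous_Complex; [exact: cvg_id|exact: cvg_cst].
Qed.

Lemma continuous_vseg f (x y : K) : {for (x +i* y : C^o), continuous f} ->
  {for y, continuous (fun t : K => f (x +i* t))}.
Proof.
move=> cf; refine (@continuous_comp _ _ _ (fun t : K => (x +i* t : C^o)) f _ _ cf).
by apply: continuous_Complex; [exact: cvg_cst|exact: cvg_id].
Qed.

Lemma rectintD f g x0 x1 y0 y1 : x0 <= x1 -> y0 <= y1 ->
  (forall z, frame x0 x1 y0 y1 z -> {for z, continuous f}) ->
  (forall z, frame x0 x1 y0 y1 z -> {for z, continuous g}) ->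
  rectint (fun z => f z + g z) x0 x1 y0 y1 =
  rectint f x0 x1 y0 y1 + rectint g x0 x1 y0 y1.
Proof.
move=> x01 y01 cf cg; rewrite /rectint.
have H y h : (y == y0) || (y == y1) -> y0 <= y <= y1 ->
    (forall z, frame x0 x1 y0 y1 z -> {for z, continuous h}) ->
    forall x, x0 <= x <= x1 -> {for x, continuous (fun t : K => h (t +i* y) : C^o)}.
  move=> yb yy ch x xx; apply: continuous_hseg; apply: ch; split => //=.
  by rewrite -orbA yb orbT.
have V x h : (x == x0) || (x == x1) -> x0 <= x <= x1 ->
    (forall z, frame x0 x1 y0 y1 z -> {for z, continuous h}) ->
    forall y, y0 <= y <= y1 -> {for y, continuous (fun t : K => h (x +i* t) : C^o)}.
  by move=> xb xx ch y yy; apply: continuous_vseg; apply: ch; split => //=; rewrite xb.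
have [e0 e1] : (y0 == y0) || (y0 == y1) /\ (y1 == y0) || (y1 == y1) by rewrite !eqxx orbT.
have [c0 c1] : (x0 == x0) || (x0 == x1) /\ (x1 == x0) || (x1 == x1) by rewrite !eqxx orbT.
have [b0 b1] : y0 <= y0 <= y1 /\ y0 <= y1 <= y1 by rewrite !lexx y01.
have [a0 a1] : x0 <= x0 <= x1 /\ x0 <= x1 <= x1 by rewrite !lexx x01.
rewrite (cintD (H _ _ e0 b0 cf) (H _ _ e0 b0 cg)) (cintD (H _ _ e1 b1 cf) (H _ _ e1 b1 cg)).
rewrite (cintD (V _ _ c0 a0 cf) (V _ _ c0 a0 cg)) (cintD (V _ _ c1 a1 cf) (V _ _ c1 a1 cg)).
by ring.
Qed.

Lemma rectint_splitx c f x0 x1 y0 y1 : x0 <= c <= x1 -> y0 <= y1 ->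
  (forall z, rectangle x0 x1 y0 y1 z -> {for z, continuous f}) ->
  rectint f x0 x1 y0 y1 = rectint f x0 c y0 y1 + rectint f c x1 y0 y1.
Proof.
move=> xcx y01 cf; rewrite /rectint.
rewrite (@cint_split _ x0 c x1 (fun x => f (x +i* y0))) //; last first.
  by move=> x xx; apply: continuous_hseg; apply: cf; split; rewrite //= lexx.
rewrite (@cint_split _ x0 c x1 (fun x => f (x +i* y1))) //; last first.
  by move=> x xx; apply: continuous_hseg; apply: cf; split; rewrite //= lexx andbT.
by ring.
Qed.

Lemma rectint_splity c f x0 x1 y0 y1 : x0 <= x1 -> y0 <= c <= y1 ->
  (forall z, rectangle x0 x1 y0 y1 z -> {for z, continuous f}) ->
  rectint f x0 x1 y0 y1 = rectint f x0 x1 y0 c + rectint f x0 x1 c y1.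
Proof.
move=> x01 ycy cf; rewrite /rectint.
rewrite (@cint_split _ y0 c y1 (fun y => f (x1 +i* y))) //; last first.
  by move=> y yy; apply: continuous_vseg; apply: cf; split; rewrite //= lexx andbT.
rewrite (@cint_split _ y0 c y1 (fun y => f (x0 +i* y))) //; last first.
  by move=> y yy; apply: continuous_vseg; apply: cf; split; rewrite //= lexx.
by ring.
Qed.

Lemma rectint_bound f x0 x1 y0 y1 M : x0 <= x1 -> y0 <= y1 ->
  (forall z, frame x0 x1 y0 y1 z -> {for z, continuous f}) ->
  (forall z, frame x0 x1 y0 y1 z -> normc (f z) <= M) ->
  normc (rectint f x0 x1 y0 y1) <= 4 * M * ((x1 - x0) + (y1 - y0)).
Proof.
move=> x01 y01 cf bf.
have hb y : (y == y0) || (y == y1) -> y0 <= y <= y1 ->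
    normc (cint x0 x1 (fun x => f (x +i* y))) <= 2 * (M * (x1 - x0)).
  move=> yb yy; have fr x : x0 <= x <= x1 -> frame x0 x1 y0 y1 (x +i* y).
    by move=> xx; split => //=; rewrite -orbA yb orbT.
  by apply: cint_bound => // x /fr xf; [exact/continuous_hseg/cf|exact: bf].
have vb x : (x == x0) || (x == x1) -> x0 <= x <= x1 ->
    normc (cint y0 y1 (fun y => f (x +i* y))) <= 2 * (M * (y1 - y0)).
  move=> xb xx; have fr y : y0 <= y <= y1 -> frame x0 x1 y0 y1 (x +i* y).
    by move=> yy; split => //=; rewrite xb.
  by apply: cint_bound => // y /fr yf; [exact/continuous_vseg/cf|exact: bf].
have B1 : normc (cint x0 x1 (fun x => f (x +i* y0))) <= 2 * (M * (x1 - x0)).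
  by apply: hb; rewrite ?eqxx ?lexx.
have B2 : normc (cint x0 x1 (fun x => f (x +i* y1))) <= 2 * (M * (x1 - x0)).
  by apply: hb; rewrite ?eqxx ?orbT ?lexx ?andbT.
have B3 : normc (cint y0 y1 (fun y => f (x1 +i* y))) <= 2 * (M * (y1 - y0)).
  by apply: vb; rewrite ?eqxx ?orbT ?lexx ?andbT.
have B4 : normc (cint y0 y1 (fun y => f (x0 +i* y))) <= 2 * (M * (y1 - y0)).
  by apply: vb; rewrite ?eqxx ?lexx.
have ni : normc ('i%C : C) = 1 by rewrite /normc /= expr0n add0r expr1n sqrtr1.
rewrite /rectint; apply: le_trans (le_normcD _ _) _.
rewrite normcM ni mul1r.
have := le_normcB (cint x0 x1 (fun x => f (x +i* y0))) (cint x0 x1 (fun x => f (x +i* y1))).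
have := le_normcB (cint y0 y1 (fun y => f (x1 +i* y))) (cint y0 y1 (fun y => f (x0 +i* y))).
by nra.
Qed.

Lemma rectint_affine (u v : C) x0 x1 y0 y1 : x0 <= x1 -> y0 <= y1 ->
  rectint (fun z => u + v * (z : C)) x0 x1 y0 y1 = 0.
Proof.
move=> x01 y01; rewrite /rectint.
have H y : (fun x : K => u + v * (x +i* y)) = (fun x => (u + v * (0 +i* y)) + x%:C * v).
  apply/funext => x; have -> : x +i* y = x%:C + (0 +i* y) by simpc.
  by ring.
have V x : (fun y : K => u + v * (x +i* y)) = (fun y => (u + v * x%:C) + y%:C * ('i%C * v)).
  apply/funext => y; have -> : x +i* y = x%:C + y%:C * 'i%C by simpc.
  by ring.
rewrite !H !V !cint_affine //.
case: u v {H V} => [u1 u2] [v1 v2]; simpc; apply/eqP; rewrite eq_complex /=.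
by apply/andP; split; apply/eqP; field.
Qed.

End rectangle_integral.

Lemma sum4_lt (R : realFieldType) (k a b c d x y : R) :
  a < k -> b < k -> c < k -> d < k -> x <= a + b -> y <= c + d -> x + y < 4 * k.
Proof. by lra. Qed.

Section goursat.
Context {K : realType}.
Local Notation C := K[i].
Variables (f : C^o -> C^o) (X0 Y0 W H : K).
Hypotheses (W0 : 0 <= W) (H0 : 0 <= H).
Hypothesis df : forall z, rectangle X0 (X0 + W) Y0 (Y0 + H) z -> differentiable f z.

(** Repeated quartering: a rectangle of stage [k] is given by its lower left corner and has sides
    [hw k] and [hh k]. It is [bad] if its integral keeps at least the share [4 ^- k] of the original
    one. *)
Let hw k : K := W / 2 ^+ k.
Let hh k : K := H / 2 ^+ k.
Let J k (p : K * K) : C := rectint f p.1 (p.1 + hw k) p.2 (p.2 + hh k).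
Let inside k (p : K * K) :=
  (X0 <= p.1) && (p.1 + hw k <= X0 + W) && (Y0 <= p.2) && (p.2 + hh k <= Y0 + H).
Let kappa := normc (J 0 (X0, Y0)).
Let bad k p := kappa / 4 ^+ k <= normc (J k p).

(** The last quarter is the default; [nxt_bad] shows that it is bad when the other three are not. *)
Let nxt k (p : K * K) : K * K :=
  if bad k.+1 p then p else
  if bad k.+1 (p.1 + hw k.+1, p.2) then (p.1 + hw k.+1, p.2) else
  if bad k.+1 (p.1, p.2 + hh k.+1) then (p.1, p.2 + hh k.+1) else
  (p.1 + hw k.+1, p.2 + hh k.+1).

Let seqp := fix s k := if k is k'.+1 then nxt k' (s k') else (X0, Y0).

Let hwS k : hw k = hw k.+1 + hw k.+1.
Proof. by rewrite /hw exprS; field; rewrite expf_neq0 // pnatr_eq0. Qed.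
Let hhS k : hh k = hh k.+1 + hh k.+1.
Proof. by rewrite /hh exprS; field; rewrite expf_neq0 // pnatr_eq0. Qed.
Let hw_ge0 k : 0 <= hw k.
Proof. by rewrite divr_ge0 // exprn_ge0. Qed.
Let hh_ge0 k : 0 <= hh k.
Proof. by rewrite divr_ge0 // exprn_ge0. Qed.

Let nxt_bounds k p : [/\ p.1 <= (nxt k p).1, (nxt k p).1 + hw k.+1 <= p.1 + hw k,
  p.2 <= (nxt k p).2 & (nxt k p).2 + hh k.+1 <= p.2 + hh k].
Proof.
have := hw_ge0 k.+1; have := hh_ge0 k.+1; have := hwS k; have := hhS k.
by rewrite /nxt; do 3?[case: ifP => _] => /= *; split; lra.
Qed.

Let nxt_bad k p : inside k p -> bad k p -> bad k.+1 (nxt k p).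
Proof.
move=> inp bp; rewrite /nxt; case: ifPn => // n1; case: ifPn => // n2; case: ifPn => // n3.
rewrite -[bad _ _]negbK; apply/negP => n4.
move: inp; rewrite /inside => /andP[/andP[/andP[i1 i2] i3] i4].
have w0 := hw_ge0 k.+1; have h0 := hh_ge0 k.+1; have wS := hwS k; have hS := hhS k.
have cf x0 x1 y0 y1 : X0 <= x0 -> x1 <= X0 + W -> Y0 <= y0 -> y1 <= Y0 + H ->
    forall z, rectangle x0 x1 y0 y1 z -> {for z, continuous f}.
  move=> a1 a2 a3 a4 z [/andP[z1 z2] /andP[z3 z4]].
  by apply: differentiable_continuous; apply: df; split; apply/andP; split; lra.
have E : J k p = (J k.+1 p + J k.+1 (p.1, p.2 + hh k.+1)) +
     (J k.+1 (p.1 + hw k.+1, p.2) + J k.+1 (p.1 + hw k.+1, p.2 + hh k.+1)).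
  rewrite /J /= (@rectint_splitx _ (p.1 + hw k.+1)) //; last 3 first.
  - by apply/andP; split; lra.
  - by lra.
  - by apply: cf; lra.
  rewrite (@rectint_splity _ (p.2 + hh k.+1)) //; last 3 first.
  - by lra.
  - by apply/andP; split; lra.
  - by apply: cf; lra.
  rewrite (@rectint_splity _ (p.2 + hh k.+1) f (p.1 + hw k.+1)) //; last 3 first.
  - by lra.
  - by apply/andP; split; lra.
  - by apply: cf; lra.
  by rewrite -!addrA -wS -hS.
move: n1 n2 n3 n4 bp; rewrite /bad -!ltNge E => n1 n2 n3 n4.
rewrite leNgt => /negP; apply.
have -> : kappa / 4 ^+ k = 4 * (kappa / 4 ^+ k.+1).
  by rewrite exprS; field; rewrite expf_neq0 // pnatr_eq0.
apply: le_lt_trans (le_normcD _ _) _.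
have a1 := le_normcD (J k.+1 p) (J k.+1 (p.1, p.2 + hh k.+1)).
have a2 := le_normcD (J k.+1 (p.1 + hw k.+1, p.2)) (J k.+1 (p.1 + hw k.+1, p.2 + hh k.+1)).
exact: (sum4_lt n1 n3 n2 n4 a1 a2).
Qed.

Let hw_0 : hw 0 = W.
Proof. by rewrite /hw expr0 divr1. Qed.
Let hh_0 : hh 0 = H.
Proof. by rewrite /hh expr0 divr1. Qed.

Let seq_in k : inside k (seqp k) && bad k (seqp k).
Proof.
elim: k => [|k /andP[IH1 IH2]].
  apply/andP; split; first by rewrite /inside /= hw_0 hh_0 !lexx.
  by rewrite /bad expr0 divr1.
rewrite (nxt_bad IH1 IH2) andbT.
have [n1 n2 n3 n4] := nxt_bounds k (seqp k).
move: IH1; rewrite /inside /= => /andP[/andP[/andP[i1 i2] i3] i4].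
by do 3?[apply/andP; split]; lra.
Qed.

Let seq_mono j k : (j <= k)%N ->
  [/\ (seqp j).1 <= (seqp k).1, (seqp k).1 + hw k <= (seqp j).1 + hw j,
      (seqp j).2 <= (seqp k).2 & (seqp k).2 + hh k <= (seqp j).2 + hh j].
Proof.
move=> /subnK <-; elim: (k - j)%N => [|i [a1 a2 a3 a4]]; first by rewrite add0n; split.
rewrite addSn; have [n1 n2 n3 n4] := nxt_bounds (i + j) (seqp (i + j)%N).
by split; [exact: le_trans n1|exact: le_trans n2 _|exact: le_trans n3|exact: le_trans n4 _].
Qed.

Let seq_le j k : (seqp j).1 <= (seqp k).1 + hw k /\ (seqp j).2 <= (seqp k).2 + hh k.
Proof.
case: (leqP j k) => [|/ltnW] /seq_mono[a1 a2 a3 a4].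
  by have h1 := hw_ge0 k; have h2 := hh_ge0 k; split; lra.
by have h1 := hw_ge0 j; have h2 := hh_ge0 j; split; lra.
Qed.

Lemma goursat : rectint f X0 (X0 + W) Y0 (Y0 + H) = 0.
Proof.
apply: eq0_normc; have -> : rectint f X0 (X0 + W) Y0 (Y0 + H) = J 0 (X0, Y0).
  by rewrite /J /= hw_0 hh_0.
rewrite -/kappa; apply/eqP; rewrite eq_le normc_ge0 andbT leNgt; apply/negP => k0.
(* Left ends never exceed right ends ([seq_le]), so the suprema of the corners give a point common
   to all the nested rectangles. *)
pose xs := sup (range (fun k => (seqp k).1)).
pose ys := sup (range (fun k => (seqp k).2)).
have xin k : (seqp k).1 <= xs <= (seqp k).1 + hw k.
  apply/andP; split.
    apply: sup_upper_bound; last by exists k.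
    by split; [exists (seqp k).1, k|exists ((seqp k).1 + hw k) => _ [j _ <-]; case: (seq_le j k)].
  by apply: ge_sup; [exists (seqp k).1, k|move=> _ [j _ <-]; case: (seq_le j k)].
have yin k : (seqp k).2 <= ys <= (seqp k).2 + hh k.
  apply/andP; split.
    apply: sup_upper_bound; last by exists k.
    by split; [exists (seqp k).2, k|exists ((seqp k).2 + hh k) => _ [j _ <-]; case: (seq_le j k)].
  by apply: ge_sup; [exists (seqp k).2, k|move=> _ [j _ <-]; case: (seq_le j k)].
have zin : rectangle X0 (X0 + W) Y0 (Y0 + H) (xs +i* ys).
  by have := xin 0%N; have := yin 0%N; rewrite /= hw_0 hh_0.
have [d Hd] := differentiableC_expansion (df zin).
have S0 : 0 <= W + H by rewrite addr_ge0.
pose S := W + H + 1.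
have Sp : 0 < S by rewrite /S ltr_wpDl.
(* With this [e] the final bound is [kappa / 4 ^+ k] times [(W + H) / (2 * S)]. The summand 1 in [S]
   keeps this meaningful for a degenerate rectangle. *)
pose e := kappa / (8 * S ^+ 2).
have e0 : 0 < e by rewrite divr_gt0 // mulr_gt0 // exprn_gt0.
have [dl dl0 Hdl] := Hd e e0.
have [k Hk] : exists k, S / 2 ^+ k < dl.
  have [k Hk] : exists k, (2^-1) ^+ k < dl / S.
    have /cvgrPdist_lt/(_ _ (divr_gt0 dl0 Sp)) : (fun k => (2^-1 : K) ^+ k) @ \oo --> 0.
      by apply: cvg_expr; rewrite ger0_norm ?invr_ge0 // invf_lt1 // ltr1n.
    move=> [k _ Hk]; exists k; apply: le_lt_trans (Hk k (leqnn k)).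
    by rewrite sub0r normrN ler_norm.
  by exists k; rewrite mulrC -ltr_pdivlMr // -exprVn.
have /andP[+ bk] := seq_in k.
rewrite /inside => /andP[/andP[/andP[i1 i2] i3] i4].
have rk z : rectangle (seqp k).1 ((seqp k).1 + hw k) (seqp k).2 ((seqp k).2 + hh k) z ->
    rectangle X0 (X0 + W) Y0 (Y0 + H) z /\ normc (z - (xs +i* ys)) <= S / 2 ^+ k.
  move=> [/andP[z1 z2] /andP[z3 z4]]; split.
    by split; apply/andP; split; lra.
  apply: le_trans (normc_le_ReIm _) _; have /andP[x1 x2] := xin k; have /andP[y1 y2] := yin k.
  case: z z1 z2 z3 z4 => [a b] /= z1 z2 z3 z4.
  have -> : S / 2 ^+ k = hw k + hh k + 1 / 2 ^+ k by rewrite /hw /hh /S; ring.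
  have p0 : 0 <= 1 / 2 ^+ k :> K by rewrite divr_ge0 // exprn_ge0.
  have A1 : `|a - xs| <= hw k by rewrite ler_norml; apply/andP; split; lra.
  have A2 : `|b - ys| <= hh k by rewrite ler_norml; apply/andP; split; lra.
  by lra.
pose zs : C := xs +i* ys.
(* The affine part of [f] at the common point integrates to zero, so only the remainder counts, and
   it is small compared with the diameter. *)
pose g : C^o -> C^o := fun w => (f w : C) - f zs - d * ((w : C) - zs).
have Efg : f = (fun w => ((f zs - d * zs) + d * (w : C)) + g w).
  by apply/funext => w; rewrite /g; ring.
have cf z : rectangle (seqp k).1 ((seqp k).1 + hw k) (seqp k).2 ((seqp k).2 + hh k) z -> {for z, continuous f}.
  by move=> /rk[zi _]; apply: differentiable_continuous; exact: df.
have ca z : {for z, continuous (fun w : C^o => ((f zs - d * zs) + d * (w : C) : C^o))}.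
  apply: differentiable_continuous; apply: differentiableD; first exact: differentiable_cst.
  by apply: differentiableM; first exact: differentiable_cst.
have cg z : rectangle (seqp k).1 ((seqp k).1 + hw k) (seqp k).2 ((seqp k).2 + hh k) z -> {for z, continuous g}.
  move=> zi; rewrite (_ : g = fun w => f w - ((f zs - d * zs) + d * (w : C))).
    by apply: continuousB; [exact: cf|exact: ca].
  by apply/funext => w; rewrite /g; ring.
have Wk : (seqp k).1 <= (seqp k).1 + hw k by rewrite lerDl.
have Hk' : (seqp k).2 <= (seqp k).2 + hh k by rewrite lerDl.
have EJ : J k (seqp k) = rectint g (seqp k).1 ((seqp k).1 + hw k) (seqp k).2 ((seqp k).2 + hh k).
  rewrite /J [in LHS]Efg (rectintD Wk Hk' (fun z _ => ca z) (fun z zi => cg z zi.1)).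
  by rewrite (rectint_affine _ _ Wk Hk') add0r.
have Hb : kappa / 4 ^+ k <= normc (rectint g (seqp k).1 ((seqp k).1 + hw k) (seqp k).2 ((seqp k).2 + hh k)).
  by rewrite -EJ; exact: bk.
have /(le_trans Hb) : normc (rectint g (seqp k).1 ((seqp k).1 + hw k) (seqp k).2 ((seqp k).2 + hh k)) <=
   4 * (e * (S / 2 ^+ k)) * ((seqp k).1 + hw k - (seqp k).1 + ((seqp k).2 + hh k - (seqp k).2)).
  apply: (rectint_bound Wk Hk' (fun z zi => cg z zi.1)) => z [zi _].
  have [_ zs_le] := rk _ zi.
  apply: le_trans (Hdl z _) _; first exact: le_lt_trans Hk.
  by rewrite ler_pM2l.
apply/negP; rewrite -ltNge.
have -> : (seqp k).1 + hw k - (seqp k).1 + ((seqp k).2 + hh k - (seqp k).2) = (W + H) / 2 ^+ k.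
  by rewrite /hw /hh; ring.
have p2 : 0 < 2 ^+ k :> K by rewrite exprn_gt0.
have -> : 4 ^+ k = 2 ^+ k * 2 ^+ k :> K by rewrite -exprMn -natrM.
have -> : 4 * (e * (S / 2 ^+ k)) * ((W + H) / 2 ^+ k) =
   (kappa / (2 ^+ k * 2 ^+ k)) * ((W + H) / (2 * S)).
  by rewrite /e; field; rewrite !gt_eqF.
rewrite -[ltRHS]mulr1 ltr_pM2l ?divr_gt0 ?mulr_gt0 //.
by rewrite ltr_pdivrMr ?mulr_gt0 // mul1r /S; move: (W + H) S0 => t t0; lra.
Qed.

End goursat.

(** * The maximum principle *)

Section square_maximum.
Context {K : realType}.
Local Notation C := K[i].
Implicit Types (f g : C^o -> C^o).

Lemma differentiable_expr (V : normedModType C) (f : V -> C^o) n x :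
  differentiable f x -> differentiable (fun z => (f z : C) ^+ n : C^o) x.
Proof.
move=> df; elim: n => [|n IH]; first exact: differentiable_cst.
rewrite (_ : (fun z => _) = (fun z => f z * (f z : C) ^+ n)).
  exact: differentiableM.
by apply/funext => z; rewrite exprS.
Qed.

Lemma near_eq_differentiable f g (z : C^o) :
  (\near z, f z = g z) -> differentiable f z -> differentiable g z.
Proof.
move=> fg /derivable1_diffP df; apply/derivable1_diffP.
by apply: (@near_eq_derivable _ _ _ f) => //; rewrite oner_neq0.
Qed.

Lemma continuous_difference_quotient f (a : C^o) : differentiable f a ->
  exists d : C, {for a, continuous (fun z : C^o =>
    (if z == a then d else (f z - f a) / ((z : C) - a)) : C^o)}.
Proof.
move=> /differentiableC_expansion[d Hd]; exists d; apply/continuous_CP => e e0.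
have e20 : 0 < e / 2 by rewrite divr_gt0.
have [dl dl0 H] := Hd _ e20; apply/nbhsCP; exists dl => // z zdl.
rewrite eqxx; case: eqVneq => [_|za]; first by rewrite subrr normc0.
have za0 : (z : C) - a != 0 by rewrite subr_eq0.
have nz : 0 < normc ((z : C) - a) by rewrite normc_gt0.
have -> : ((f z : C) - f a) / ((z : C) - a) - d = ((f z : C) - f a - d * ((z : C) - a)) / ((z : C) - a).
  by field.
rewrite normcf ltr_pdivrMr //; apply: le_lt_trans (H _ zdl) _.
by rewrite ltr_pM2r //; lra.
Qed.

(** Four rectangles that avoid the origin are cut off, and [goursat] applies to each. What remains
    is a square whose perimeter can be made arbitrarily small. *)
Lemma rectint_punctured f (x0 x1 y0 y1 t : K) : x0 <= - t -> t <= x1 -> y0 <= - t -> t <= y1 -> 0 < t ->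
  (forall z, rectangle x0 x1 y0 y1 z -> {for z, continuous f}) ->
  (forall z, rectangle x0 x1 y0 y1 z -> z != 0 -> differentiable f z) ->
  rectint f x0 x1 y0 y1 = rectint f (- t) t (- t) t.
Proof.
move=> h1 h2 h3 h4 t0 cf df.
have G (a b c d : K) : a <= b -> c <= d -> x0 <= a -> b <= x1 -> y0 <= c -> d <= y1 ->
    (forall z, rectangle a b c d z -> z != 0) -> rectint f a b c d = 0.
  move=> ab cd xa bx yc dy nz.
  have := @goursat _ f a c (b - a) (d - c); rewrite ![_ + (_ - _)]addrC !subrK.
  apply; rewrite ?subr_ge0 // => z zr; apply: df; last exact: nz.
  by case: zr => /andP[? ?] /andP[? ?]; split; apply/andP; split; lra.
have cf' (a b c d : K) : x0 <= a -> b <= x1 -> y0 <= c -> d <= y1 ->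
    forall z, rectangle a b c d z -> {for z, continuous f}.
  move=> xa bx yc dy z [/andP[? ?] /andP[? ?]].
  by apply: cf; split; apply/andP; split; lra.
rewrite (@rectint_splitx _ (- t)) //; [|by apply/andP; split; lra|by lra].
rewrite (@rectint_splitx _ t f (- t)) //; [|by apply/andP; split; lra|by lra|by apply: cf'; lra].
rewrite (@rectint_splity _ (- t) f (- t)) //; [|by lra|by apply/andP; split; lra|by apply: cf'; lra].
rewrite (@rectint_splity _ t f (- t) t (- t)) //; [|by lra|by apply/andP; split; lra|by apply: cf'; lra].
have nz (a b c d : K) : [|| 0 < a, b < 0, 0 < c | d < 0] ->
    forall z, rectangle a b c d z -> z != 0.
  by move=> Hor z [/andP[? ?] /andP[? ?]]; apply/eqP => z0; subst z; case/or4P: Hor => /= ?; lra.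
have tn : - t < 0 by rewrite oppr_lt0.
rewrite (G x0 (- t) y0 y1) ?(G t x1 y0 y1) ?(G (- t) t y0 (- t)) ?(G (- t) t t y1) ?add0r ?addr0 //;
  by [lra|apply: nz; rewrite ?t0 ?tn ?orbT].
Qed.

(** If [b < a], then [c * (b / a) ^+ N] tends to zero and cannot stay above 1. This removes
    constants from any estimate that is inherited by powers. *)
Lemma expr_le_le (a b c : K) : 0 <= a -> 0 <= b ->
  (forall N, a ^+ N <= c * b ^+ N) -> a <= b.
Proof.
move=> a0 b0 H; rewrite leNgt; apply/negP => ba.
have ap : 0 < a by apply: le_lt_trans ba.
have c0 : 0 < c by have := H 0%N; rewrite !expr0 mulr1; apply: lt_le_trans.
have /cvgrPdist_lt/(_ c^-1) : (fun k => (b / a) ^+ k) @ \oo --> (0 : K).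
  by apply: cvg_expr; rewrite ger0_norm ?divr_ge0 // ltr_pdivrMr // mul1r.
rewrite invr_gt0 => /(_ c0)[N _ /(_ N (leqnn N))]; rewrite sub0r normrN ger0_norm; last first.
  by rewrite exprn_ge0 // divr_ge0.
rewrite expr_div_n ltr_pdivrMr ?exprn_gt0 // ltr_pdivlMl //.
by rewrite ltNge H.
Qed.

(** On a side at distance 1 from the origin, one component of [1 / z] is, up to sign,
    [1 / (1 + t^2)], which is at least 1/2. Each of the four sides has length 2 and so contributes
    at least 1. *)
Lemma rectint_inv_Im : 4 <= Im (rectint (fun z : C^o => (z : C)^-1) (-1) 1 (-1) (1 : K)).
Proof.
have ci z : (z : C^o) != 0 -> {for z, continuous (fun z : C^o => (z : C)^-1 : C^o)}.
  by move=> z0; apply: differentiable_continuous; apply: differentiable_Rinv.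
have hb (s : K) : `|s| = 1 -> forall x : K, -1 <= x <= 1 ->
   {for x, continuous (fun x : K => (x +i* s)^-1 : C^o)} /\ 1 / 2 <= - (s * Im ((x +i* s)^-1)).
  move=> s1 x xx; split.
    apply: (@continuous_hseg _ (fun z : C^o => (z : C)^-1)); apply: ci.
    by rewrite eq_complex /= negb_and -[s == 0]normr_eq0 s1 oner_eq0 orbT.
  have s2 : s ^+ 2 = 1 by rewrite -real_normK ?num_real // s1 expr1n.
  have -> : Im ((x +i* s)^-1) = - (s / (x ^+ 2 + s ^+ 2)) by [].
  rewrite mulrN opprK mulrA -expr2 s2 ler_pdivlMr; last by nra.
  by nra.
have vb (s : K) : `|s| = 1 -> forall y : K, -1 <= y <= 1 ->
   {for y, continuous (fun y : K => (s +i* y)^-1 : C^o)} /\ 1 / 2 <= s * Re ((s +i* y)^-1).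
  move=> s1 y yy; split.
    apply: (@continuous_vseg _ (fun z : C^o => (z : C)^-1)); apply: ci.
    by rewrite eq_complex /= negb_and -[s == 0]normr_eq0 s1 oner_eq0.
  have s2 : s ^+ 2 = 1 by rewrite -real_normK ?num_real // s1 expr1n.
  have -> : Re ((s +i* y)^-1) = s / (s ^+ 2 + y ^+ 2) by [].
  rewrite mulrA -expr2 s2 ler_pdivlMr; last by nra.
  by nra.
have n1 : `|1 : K| = 1 by rewrite normr1.
have m1 : `|-1 : K| = 1 by rewrite normrN1.
have R (g : K -> K) : (forall x, -1 <= x <= 1 -> {for x, continuous g}) ->
    (forall x, -1 <= x <= 1 -> 1 / 2 <= g x) -> 1 <= rint (-1) 1 g.
  move=> cg bg; apply: (@le_trans _ _ (rint (-1) 1 (fun=> 1 / 2))).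
    by rewrite rint_cst; lra.
  by apply: le_rint => // x _; exact: cvg_cst.
rewrite /rectint /=.
have A1 : 1 <= rint (-1) 1 (fun x : K => Im ((x -i* 1)^-1)).
  apply: R => x /(hb _ m1)[]; first by move=> c _; exact: continuous_Im.
  by rewrite mulN1r opprK.
have A2 : 1 <= - rint (-1) 1 (fun x : K => Im ((x +i* 1)^-1)).
  rewrite -[- rint _ _ _]mulN1r -rintZ.
    apply: R => x /(hb _ n1)[]; last by rewrite !mul1r mulN1r.
    by move=> c _; apply: cvgM; [exact: cvg_cst|exact: continuous_Im].
  by move=> x /(hb _ n1)[c _]; exact: continuous_Im.
have A3 : 1 <= rint (-1) 1 (fun x : K => Re ((1 +i* x)^-1)).
  apply: R => x /(vb _ n1)[]; first by move=> c _; exact: continuous_Re.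
  by rewrite !mul1r.
have A4 : 1 <= - rint (-1) 1 (fun x : K => Re (((-1) +i* x)^-1)).
  rewrite -[- rint _ _ _]mulN1r -rintZ.
    apply: R => x /(vb _ m1)[]; last by [].
    by move=> c _; apply: cvgM; [exact: cvg_cst|exact: continuous_Re].
  by move=> x /(vb _ m1)[c _]; exact: continuous_Re.
by rewrite /= in A1 A2 A3 A4 *; lra.
Qed.

Lemma frame_normc_ge1 (z : C^o) : frame (-1) 1 (-1) 1 z -> 1 <= normc (z : C).
Proof.
move=> [_]; rewrite -!orbA => /or4P[] /eqP h.
- by apply: le_trans (Re_le_normc _); rewrite h normrN1.
- by apply: le_trans (Re_le_normc _); rewrite h normr1.
- by apply: le_trans (Im_le_normc _); rewrite h normrN1.
- by apply: le_trans (Im_le_normc _); rewrite h normr1.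
Qed.

Lemma frame_1 : frame (-1) 1 (-1) 1 (1 : C^o).
Proof. by split; [split; apply/andP; split => /=; lra|rewrite /= eqxx ?orbT]. Qed.

(* Integrate [f z / z] over the frame: [(f z - f 0) / z] contributes nothing by
   [goursat], and the integral of [1 / z] is at least [4] in modulus. *)
Lemma square_lower f (M : K) : (forall z, rectangle (-1) 1 (-1) 1 z -> differentiable f z) ->
  f 0 = 1 -> (forall z, frame (-1) 1 (-1) 1 z -> normc (f z) <= M) -> 1 <= 4 * M.
Proof.
move=> df f01 bf.
have r0 : rectangle (-1) 1 (-1) 1 (0 : C^o) by split; rewrite /= oppr_le0 !ler01.
have [d cq] := continuous_difference_quotient (df _ r0).
pose q : C^o -> C^o := fun z => if z == 0 then d else (f z - f 0) / ((z : C) - 0).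
have dq z : rectangle (-1) 1 (-1) 1 z -> z != 0 -> differentiable q z.
  move=> zr z0; apply: (@near_eq_differentiable (fun z => (f z - f 0) * ((z : C) - 0)^-1)).
    have : \near z, (z : C^o) != 0.
      apply/nbhsCP; exists (normc (z : C)); rewrite ?normc_gt0 // => w wz.
      by apply: contraTneq wz => ->; rewrite sub0r normcN ltxx.
    by apply: filterS => w /negbTE; rewrite /q => ->.
  apply: differentiableM.
    by apply: differentiableB; [exact: df|exact: differentiable_cst].
  apply: differentiableV; last by rewrite subr0.
  by apply: differentiableB; [|exact: differentiable_cst].
have cqr z : rectangle (-1) 1 (-1) 1 z -> {for z, continuous q}.
  move=> zr; case: (eqVneq z 0) => [->|z0]; first exact: cq.
  by apply: differentiable_continuous; exact: dq.
have q0 : rectint q (-1) 1 (-1) 1 = 0.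
  apply: eq0_normc; apply/eqP; rewrite eq_le normc_ge0 andbT.
  apply/ler_addgt0Pr => e e0; rewrite add0r.
  have /continuous_CP/(_ 1 ltr01)/nbhsCP[dl dl0 Hdl] := cq.
  pose B := normc (q 0) + 1.
  have B0 : 0 < B by rewrite /B ltr_wpDl ?normc_ge0.
  (* The three bounds keep the small square inside the large one, keep [q] within 1 of [q 0] on it,
     and make the estimate [16 * B * t] at most [e]. *)
  pose t := Num.min (Num.min 1 (dl / 4)) (e / (16 * B)).
  have t0 : 0 < t by rewrite !lt_min ltr01 !divr_gt0 ?mulr_gt0.
  have t1 : t <= 1 by rewrite !ge_min lexx.
  have t2 : t <= dl / 4 by rewrite !ge_min lexx orbT.
  have t3 : t <= e / (16 * B) by rewrite !ge_min lexx orbT.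
  rewrite (@rectint_punctured q _ _ _ _ t) //; try lra.
  have tt : - t <= t by lra.
  have cqt z : frame (- t) t (- t) t z -> {for z, continuous q}.
    move=> [[/andP[? ?] /andP[? ?]] _]; apply: cqr; split; apply/andP; split; lra.
  apply: le_trans (@rectint_bound _ q _ _ _ _ B tt tt cqt _) _.
    move=> z [[/andP[z1 z2] /andP[z3 z4]] _].
    have zd : normc ((z : C) - 0) < dl.
      rewrite subr0; apply: le_lt_trans (normc_le_ReIm _) _.
      have : `|Re z| <= t by rewrite ler_norml z1.
      have : `|Im z| <= t by rewrite ler_norml z3.
      by lra.
    have := Hdl z zd; rewrite /= -/q -/(q z) -/(q 0) => h.
    have := normc_sub_le (q z) (q 0); rewrite /B; lra.
  have -> : 4 * B * (t - - t + (t - - t)) = (16 * B) * t by ring.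
  by rewrite mulrC -ler_pdivlMr ?mulr_gt0.
have i1 : (-1 : K) <= 1 by lra.
have fn0 (z : C^o) : frame (-1) 1 (-1) 1 z -> z != 0.
  by move=> /frame_normc_ge1 zf; rewrite -normc_gt0; exact: lt_le_trans zf.
have cinv (z : C^o) : frame (-1) 1 (-1) 1 z -> {for z, continuous (fun z : C^o => (z : C)^-1 : C^o)}.
  by move=> zf; apply: differentiable_continuous; apply: differentiable_Rinv (fn0 _ zf).
have E : rectint (fun z => q z + (z : C)^-1) (-1) 1 (-1) 1 =
         rectint (fun z : C^o => (z : C)^-1) (-1) 1 (-1) (1 : K).
  by rewrite (rectintD i1 i1 (fun z zf => cqr z zf.1) cinv) q0 add0r.
have cs (z : C^o) : frame (-1) 1 (-1) 1 z -> {for z, continuous (fun z : C^o => q z + (z : C)^-1 : C^o)}.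
  by move=> zf; apply: continuousD; [exact: (cqr _ zf.1)|exact: cinv].
have : normc (rectint (fun z => q z + (z : C)^-1) (-1) 1 (-1) 1) <= 4 * M * (1 - -1 + (1 - -1)).
  apply: (rectint_bound i1 i1 cs) => z zf; have := fn0 _ zf => z0.
  have -> : q z + (z : C)^-1 = (f z : C) / z.
    by rewrite /q (negbTE z0) f01 subr0; field.
  rewrite normcf ler_pdivrMr ?normc_gt0 //; apply: le_trans (bf _ zf) _.
  have M0 : 0 <= M by apply: le_trans (bf _ zf); exact: normc_ge0.
  by rewrite -[leLHS]mulr1 ler_wpM2l // frame_normc_ge1.
rewrite E; have := rectint_inv_Im; have := Im_le_normc (rectint (fun z : C^o => (z : C)^-1) (-1) 1 (-1) (1 : K)).
move: (rectint _ _ _ _ _) => w; have := ler_norm (Im w); lra.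
Qed.

(* [square_lower] for the powers of [f / f 0]: the constant [4] disappears as the
   exponent grows. *)
Lemma square_max f (M : K) : (forall z, rectangle (-1) 1 (-1) 1 z -> differentiable f z) ->
  (forall z, frame (-1) 1 (-1) 1 z -> normc (f z) <= M) -> normc (f 0) <= M.
Proof.
move=> df bf.
have M0 : 0 <= M by apply: le_trans (bf _ frame_1); exact: normc_ge0.
case: (eqVneq (f 0) 0) => [->|f0]; first by rewrite normc0.
apply: (@expr_le_le _ _ 4) => //; first exact: normc_ge0.
move=> N; pose g : C^o -> C^o := fun z => ((f z : C) / f 0) ^+ N.
have n0 : 0 < normc (f 0) by rewrite normc_gt0.
have : 1 <= 4 * (M / normc (f 0)) ^+ N.
  apply: (@square_lower g).
  - move=> z zr; apply: (@differentiable_expr _ (fun z => (f z : C) / f 0)).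
    by apply: differentiableM; [exact: df|exact: differentiable_cst].
  - by rewrite /g divff // expr1n.
  - move=> z zf; rewrite /g normcX normcf lerXn2r ?nnegrE ?divr_ge0 ?normc_ge0 //.
    by rewrite ler_pM2r ?invr_gt0 // bf.
by rewrite expr_div_n mulrA ler_pdivlMr ?exprn_gt0 // mul1r.
Qed.

End square_maximum.

Section complex_compactness.
Context {K : realType}.
Local Notation C := K[i].

Lemma sqr_normcD (x y : C) :
  normc (x + y) ^+ 2 = normc x ^+ 2 + 2 * Re (conjc x * y) + normc y ^+ 2.
Proof. by rewrite !sqr_normcE; case: x y => [a b] [c d] /=; ring. Qed.

Lemma Re_conj_scaled (r s : K) (x y : C) :
  Re (conjc (r%:C * x) * (s%:C * y)) = r * s * Re (conjc x * y).
Proof. by case: x y => [a b] [c d] /=; ring. Qed.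

Lemma Re_real_mul (r : K) (x : C) : Re (r%:C * x) = r * Re x.
Proof. by case: x => a b /=; rewrite mul0r subr0. Qed.

Lemma closed_normc_le (T : topologicalType) (f : T -> C^o) (r : K) :
  continuous f -> closed [set z | normc (f z) <= r].
Proof.
move=> cf; apply: (@preimage_closed _ _ (fun z => normc (f z) : K) [set x | x <= r]).
- by move=> z _; apply: continuous_normc; exact: cf.
- exact: closed_le.
Qed.

Lemma compact_bounded_closed (A : set C^o) (r : K) : closed A ->
  (forall z, A z -> normc (z : C) <= r) -> compact A.
Proof.
move=> cA bA.
pose box : set C^o := (fun p : K * K => (p.1 +i* p.2 : C^o)) @` (`[- r, r] `*` `[- r, r]).
have cbox : compact box.
  apply: continuous_compact; last by apply: compact_setX; exact: segment_compact.
  apply: continuous_subspaceT => p.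
  by apply: continuous_Complex; [exact: cvg_fst|exact: cvg_snd].
apply: subclosed_compact cA cbox _ => z Az; exists (Re z, Im z); last by case: z {Az}.
have zr := bA _ Az; split; rewrite /= in_itv /= -ler_norml.
  exact: le_trans (Re_le_normc _) zr.
exact: le_trans (Im_le_normc _) zr.
Qed.

Lemma compact_disc (r : K) : compact [set z : C^o | normc (z : C) <= r].
Proof.
by apply: (@compact_bounded_closed _ r) => //; apply: closed_normc_le => z; exact: cvg_id.
Qed.

Lemma compact_frame : compact (frame (-1) 1 (-1) 1 : set C^o).
Proof.
pose I := `[(-1 : K), 1]%classic.
have cI : compact I by exact: segment_compact.
pose h (s : K) : K -> C^o := fun x => x +i* s.
pose v (s : K) : K -> C^o := fun y => s +i* y.
have ch s : compact (h s @` I).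
  apply: continuous_compact cI; apply: continuous_subspaceT => x.
  by apply: continuous_Complex; [exact: cvg_id|exact: cvg_cst].
have cv s : compact (v s @` I).
  apply: continuous_compact cI; apply: continuous_subspaceT => x.
  by apply: continuous_Complex; [exact: cvg_cst|exact: cvg_id].
rewrite (_ : frame _ _ _ _ = v (-1) @` I `|` v 1 @` I `|` h (-1) @` I `|` h 1 @` I).
  by do 3?[apply: compactU]; [exact: cv|exact: cv|exact: ch|exact: ch].
apply/seteqP; split=> [[a b] [[/= H1 H2]]|z].
  rewrite -!orbA => /or4P[] /eqP /= E.
  - by left; left; left; exists b; rewrite /I /= ?in_itv // /v E.
  - by left; left; right; exists b; rewrite /I /= ?in_itv // /v E.
  - by left; right; exists a; rewrite /I /= ?in_itv // /h E.
  - by right; exists a; rewrite /I /= ?in_itv // /h E.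
by move=> [[[]|]|] [x]; rewrite /I /= in_itv /= => /andP[x1 x2] <-;
  (split; [split; apply/andP; split => /=; lra|rewrite /= eqxx ?orbT]).
Qed.

End complex_compactness.

(** * The maximum principle on a disc for limits of holomorphic functions *)

Section maximum_modulus.
Context {K : realType}.
Local Notation C := K[i].
Implicit Types (f g L q : C^o -> C^o).

(* A local uniform limit of holomorphic functions; it suffices for the maximum
   principle and spares us the differentiability of such limits. *)
Definition holo_limit g (a : C^o) := exists2 s : K, 0 < s & forall e : K, 0 < e ->
  exists h : C^o -> C^o, forall z : C^o, normc ((z : C) - a) < s ->
    differentiable h z /\ normc ((h z : C) - g z) <= e.

Lemma holo_limit_differentiable g a : (\near a, differentiable g a) -> holo_limit g a.
Proof.
move=> dg; have [s s0 H] := (nbhsCP _ _).1 dg.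
exists s => // e e0; exists g => z /H dz.
by rewrite subrr normc0 ltW.
Qed.

Lemma holo_limitM g p a : holo_limit g a -> (\near a, differentiable p a) ->
  holo_limit (fun z => g z * p z) a.
Proof.
move=> [s s0 H] dp.
have cp : {for a, continuous p}.
  by apply: differentiable_continuous; exact: nbhs_singleton dp.
have /continuous_CP/(_ 1 ltr01) bp := cp.
have [s1 s10 H1] := (nbhsCP _ _).1 (filterI dp bp).
pose B := normc (p a) + 1; have B0 : 0 < B by rewrite ltr_wpDl ?normc_ge0.
exists (Num.min s s1); first by rewrite lt_min s0.
move=> e e0; have [h Hh] := H (e / B) (divr_gt0 e0 B0).
exists (fun z => h z * p z) => z; rewrite lt_min => /andP[z1 z2].
have [dh hg] := Hh z z1; have [dpz bpz] := H1 z z2.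
split; first exact: differentiableM.
rewrite -mulrBl normcM.
have pB : normc (p z) <= B by have := normc_sub_le (p z) (p a); rewrite /B; lra.
apply: le_trans (ler_pM (normc_ge0 _) (normc_ge0 _) hg pB) _.
by rewrite divfK // gt_eqF.
Qed.

Lemma rectangle_normc (w : C^o) : rectangle (-1) 1 (-1) 1 w -> normc (w : C) <= 2.
Proof.
move=> [r1 r2]; apply: le_trans (normc_le_ReIm _) _.
by move: r1 r2; rewrite -!ler_norml; lra.
Qed.

(** The factor [1 + eta * w] equals 1 at the centre, so it leaves [g a] alone while it can lower the
    values on one side of the frame. This tilt is what yields strictness in [maximum_disc]. *)
Lemma holo_limit_square_max g (a : C^o) : holo_limit g a ->
  exists2 s0 : K, 0 < s0 & forall s, 0 < s -> s < s0 -> forall (eta : C) (M : K),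
  (forall w, frame (-1) 1 (-1) 1 w ->
    normc (g ((a : C) + s%:C * (w : C)) * (1 + eta * (w : C))) <= M) -> normc (g a) <= M.
Proof.
move=> [s1 s10 H]; exists (s1 / 2); first by rewrite divr_gt0.
move=> s s0 ss1 eta M bf; apply/ler_addgt0Pr => e e0.
pose c := 2 + 2 * normc eta; have c0 : 0 < c by have := normc_ge0 eta; rewrite /c; lra.
have [h Hh] := H (e / c) (divr_gt0 e0 c0).
pose T (w : C^o) : C^o := (a : C) + s%:C * (w : C).
have dT w : differentiable T w.
  apply: differentiableD; first exact: differentiable_cst.
  by apply: differentiableM; first exact: differentiable_cst.
have inT w : rectangle (-1) 1 (-1) 1 w -> normc ((T w : C) - a) < s1.
  move=> /rectangle_normc w2; rewrite /T addrC addKr normcM normc_real gtr0_norm //.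
  by have := normc_ge0 w; nra.
have : normc (h (T 0) * (1 + eta * 0)) <= M + e / c * (1 + 2 * normc eta).
  apply: (@square_max _ (fun w => h (T w) * (1 + eta * (w : C)))).
    move=> w /inT wT; apply: differentiableM.
      by apply: differentiable_comp; [exact: dT|case: (Hh _ wT)].
    apply: differentiableD; first exact: differentiable_cst.
    by apply: differentiableM; first exact: differentiable_cst.
  move=> w wf; have [_ hg] := Hh _ (inT _ wf.1).
  rewrite -[h (T w)](subrK (g (T w))) mulrDl.
  apply: le_trans (le_normcD _ _) _; rewrite addrC; apply: lerD; first exact: bf.
  rewrite normcM; apply: ler_pM; rewrite ?normc_ge0 //.
  apply: le_trans (le_normcD _ _) _; rewrite normc1 lerD2l normcM mulrC.
  by rewrite ler_wpM2r ?normc_ge0 //; exact: rectangle_normc wf.1.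
rewrite mulr0 addr0 mulr1 /T mulr0 addr0.
have [_] : differentiable h a /\ normc ((h a : C) - g a) <= e / c.
  by apply: Hh; rewrite subrr normc0.
have -> : e / c * (1 + 2 * normc eta) = e - e / c by rewrite /c; field; exact: lt0r_neq0.
have := normc_sub_le (g a) (h a); rewrite normcB; lra.
Qed.

(** For [t = Re (conjc u * w)] and [x = normc w] the left side is the squared modulus of
    [1 + eta * conjc u * w]: on the inner part of the frame the tilt is below 1 by a definite
    amount. On the rest of the frame [tilted_product_le] spends the gap [k] between the function and
    its maximum. *)
Lemma tilted_norm_le (eta k t x : K) : 0 < eta -> eta <= k / 4 -> k <= - t -> 0 <= x -> x <= 2 ->
  1 + 2 * eta * t + eta ^+ 2 * x ^+ 2 <= (1 - eta * k / 2) ^+ 2.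
Proof.
move=> e0 ek kt x0 x2; have xx : x ^+ 2 <= 4 by nra.
have e4 : eta ^+ 2 * 4 <= eta * k by nra.
have := sqr_ge0 (eta * k); have := sqr_ge0 eta; nra.
Qed.

Lemma tilted_product_le (eta k x y M : K) : x <= 1 + 2 * eta -> 0 <= x -> 0 <= y -> 0 < eta ->
  0 <= M -> eta * (4 * (M + 1)) <= k -> k <= M - y -> x * y <= M - k / 2.
Proof. by move=> *; nra. Qed.

Lemma tilted_max_lt (eta k M : K) : 0 < M -> 0 < eta -> 0 < k ->
  Num.max (M * (1 - eta * k / 2)) (M - k / 2) < M.
Proof.
move=> M0 e0 k0; have := mulr_gt0 M0 (mulr_gt0 e0 k0).
by rewrite gt_max => p; apply/andP; split; lra.
Qed.

(** If the maximum [M] exceeded [m], let [a] be a maximum point of largest modulus; it is interior.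
    On a small frame around [a], the outward points have larger modulus than [a], hence values below
    [M], while at the inward points a tilt is below 1. By compactness the tilted function is
    uniformly below [M] on the frame but equals [M] in modulus at the centre. *)
Lemma maximum_disc f (r r' m : K) : 0 < r -> r < r' ->
  (forall z : C^o, normc (z : C) < r' -> {for z, continuous f}) ->
  (forall z : C^o, normc (z : C) < r -> holo_limit f z \/ normc (f z) <= m) ->
  (forall z : C^o, normc (z : C) = r -> normc (f z) <= m) ->
  forall z : C^o, normc (z : C) <= r -> normc (f z) <= m.
Proof.
move=> r0 rr' cf hf bf.
pose A := [set z : C^o | normc (z : C) <= r].
have cA : compact A by exact: compact_disc.
have cfA : {within A, continuous (fun z => normc (f z) : K)}.
  apply: continuous_in_subspaceT => z; rewrite inE => zA.
  by apply: continuous_normc; apply: cf; exact: le_lt_trans rr'.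
have A0 : A !=set0 by exists (0 : C); rewrite /A /mkset normc0 ltW.
have [zm] := compact_EVT_max A0 cA cfA.
set M := normc (f zm); rewrite inE => zmA Hm.
suff Mm : M <= m.
  by move=> z zA; apply: le_trans Mm; apply: Hm; rewrite inE.
rewrite leNgt; apply/negP => mM.
pose S := [set z : C^o | normc (z : C) <= r /\ M <= normc (f z)].
have cS : compact S.
  apply: (@compact_bounded_closed _ _ r); last by move=> z [].
  move=> z clz.
  have zr : normc (z : C) <= r.
    have : closed A by apply: closed_normc_le => w; exact: cvg_id.
    apply; apply: closureS clz; by move=> w [].
  split => //; apply/ler_addgt0Pr => e e0.
  have /continuous_CP/(_ e e0) He : {for z, continuous f} by apply: cf; exact: le_lt_trans rr'.
  have [w [[_ wM] we]] := clz _ He.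
  by have := normc_sub_le (f w) (f z); move: we; rewrite /=; lra.
have cid : {within S, continuous (fun z : C^o => normc (z : C) : K)}.
  by apply: continuous_subspaceT => z; apply: continuous_normc; exact: cvg_id.
have S0 : S !=set0 by exists zm; split.
have [a] := compact_EVT_max S0 cS cid.
rewrite inE => -[ar aM] Ha.
have aM' : normc (f a) = M by apply/eqP; rewrite eq_le aM Hm // inE.
have ar' : normc (a : C) < r.
  rewrite lt_neqAle ar andbT; apply/eqP => /bf; rewrite aM'; lra.
have [hfa|] := hf _ ar'; last by rewrite aM'; lra.
have [s0 s00 Hs] := holo_limit_square_max hfa.
pose s := Num.min (s0 / 2) ((r - normc (a : C)) / 2).
have sp : 0 < s by rewrite lt_min !divr_gt0 ?subr_gt0.
have ss0 : s < s0.
  by apply: le_lt_trans (_ : _ <= s0 / 2) _; rewrite ?ge_min ?lexx //; lra.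
have sr : s * 2 <= r - normc (a : C).
  by rewrite -ler_pdivlMr // ge_min lexx orbT.
(* The outward direction at [a]; at the origin any unit vector will do, since every point of the
   frame is farther out. *)
pose u : C := if a == 0 then 1 else (a : C) / (normc (a : C))%:C.
have na0 : a != 0 -> 0 < normc (a : C) by rewrite normc_gt0.
have u1 : normc u = 1.
  rewrite /u; case: eqVneq => [_|/na0 n0]; first by rewrite normc1.
  by rewrite normcf normc_real ger0_norm ?normc_ge0 // divff // gt_eqF.
have au : a = (normc (a : C))%:C * u.
  rewrite /u; case: eqVneq => [->|/na0 n0]; first by rewrite normc0 mul0r.
  by rewrite mulrC divfK // eq_complex /= negb_and gt_eqF.
pose t (w : C) := Re (conjc u * w).
pose P (w : C^o) : C^o := (a : C) + s%:C * (w : C).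
have Pr w : frame (-1) 1 (-1) 1 w -> normc (P w) <= r.
  move=> [/rectangle_normc w2 _]; apply: le_trans (le_normcD _ _) _.
  rewrite normcM normc_real gtr0_norm //.
  have : s * normc (w : C) <= s * 2 by rewrite ler_pM2l.
  by lra.
have tP w : frame (-1) 1 (-1) 1 w -> 0 <= t w -> normc (f (P w)) < M.
  move=> wf tw; have := Hm (P w); rewrite inE => /(_ (Pr _ wf)).
  rewrite le_eqVlt => /orP[/eqP E|//].
  have := Ha (P w); rewrite inE => /(_ (conj (Pr _ wf) _)); rewrite E => /(_ (lexx _)).
  rewrite -(@ler_pXn2r _ 2) ?nnegrE ?normc_ge0 //.
  have -> : normc (P w) ^+ 2 = normc (a : C) ^+ 2 + 2 * s * normc (a : C) * t w + s ^+ 2 * normc (w : C) ^+ 2.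
    rewrite /P sqr_normcD [normc (s%:C * _)]normcM [normc s%:C]normc_real gtr0_norm // exprMn; congr (_ + _ + _).
    by rewrite {1}au Re_conj_scaled /t; ring.
  have : 0 < normc (w : C) by exact: lt_le_trans (frame_normc_ge1 wf).
  move=> w0 h; have p1 : 0 < s ^+ 2 * normc (w : C) ^+ 2 by rewrite mulr_gt0 // exprn_gt0.
  have p2 : 0 <= 2 * s * normc (a : C) * t w by rewrite !mulr_ge0 ?normc_ge0 // ltW.
  by lra.
(* At each point of the frame one of the two terms is positive, so the minimum [k] of [v] is a gain
   valid on the whole frame. *)
pose v (w : C^o) : K := Num.max (- t w) (M - normc (f (P w))).
have cv : {within frame (-1) 1 (-1) 1, continuous v}.
  apply: continuous_in_subspaceT => w; rewrite inE => wf.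
  apply: (@continuous_max _ _ (fun w : C^o => - t w : K^o) (fun w : C^o => M - normc (f (P w)) : K^o)).
    apply: continuousN; apply: (@continuous_Re _ _ (fun w : C^o => conjc u * (w : C))).
    apply: differentiable_continuous; by apply: differentiableM; first exact: differentiable_cst.
  apply: (@continuousB _ K^o _ (fun=> M) (fun w : C^o => normc (f (P w)))); first exact: cst_continuous.
  apply: (@continuous_normc K C^o (fun w => f (P w))); apply: (@continuous_comp _ _ _ P f).
    apply: differentiable_continuous; apply: differentiableD; first exact: differentiable_cst.
    by apply: differentiableM; first exact: differentiable_cst.
  by apply: cf; apply: le_lt_trans rr'; exact: Pr.
have F0 : (frame (-1) 1 (-1) 1 : set C^o) !=set0 by exists 1; exact: frame_1.
have [w0] := compact_EVT_min F0 compact_frame cv.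
set k := v w0; rewrite inE => w0f Hk.
have k0 : 0 < k.
  rewrite /k /v lt_max; case: (ltP (t w0) 0) => [h|h]; first by rewrite oppr_gt0 h.
  by rewrite subr_gt0 tP ?orbT.
have M0 : 0 <= M by exact: normc_ge0.
(* The first two bounds serve [tilted_norm_le] and [tilted_product_le]; the third, with [k <= 2],
   makes [1 - eta * k / 2] nonnegative. *)
pose eta := Num.min (k / 4) (Num.min (k / (4 * (M + 1))) 1).
have M1 : 0 < M + 1 by lra.
have e0 : 0 < eta by rewrite !lt_min ltr01 !divr_gt0 // mulr_gt0.
have e1 : eta <= k / 4 by rewrite ge_min lexx.
have e2 : eta * (4 * (M + 1)) <= k.
  by rewrite -ler_pdivlMr ?mulr_gt0 // !ge_min lexx orbT.
have e3 : eta <= 1 by rewrite !ge_min lexx !orbT.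
pose M' := Num.max (M * (1 - eta * k / 2)) (M - k / 2).
have Mp : 0 < M.
  rewrite lt_neqAle M0 andbT; apply/eqP => M00.
  by have := bf (r%:C); rewrite normc_real gtr0_norm // => /(_ erefl); have := normc_ge0 (f r%:C); lra.
have : normc (f a) <= M'.
  apply: (Hs s sp ss0 (eta%:C * conjc u)) => w wf.
  have w2 := rectangle_normc wf.1.
  have fM : normc (f (P w)) <= M by apply: Hm; rewrite inE; exact: Pr.
  have := Hk w; rewrite inE => /(_ wf); rewrite {1}/v le_max => /orP[kt|kf]; rewrite normcM /M' le_max.
    apply/orP; left; apply: ler_pM; rewrite ?normc_ge0 //.
    have ek : eta * k <= 2.
      have tw2 : k <= 2.
        apply: le_trans kt _; apply: le_trans w2; apply: le_trans (ler_norm _) _.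
        by rewrite normrN; apply: le_trans (Re_le_normc _) _; rewrite normcM normc_conjc u1 mul1r.
      by rewrite -[2]mul1r; apply: ler_pM => //; exact: ltW.
    rewrite -(@ler_pXn2r _ 2) ?nnegrE ?normc_ge0 //; last by rewrite subr_ge0 ler_pdivrMr // mul1r.
    have -> : normc (1 + eta%:C * conjc u * w) ^+ 2 = 1 + 2 * eta * t w + eta ^+ 2 * normc (w : C) ^+ 2.
      rewrite sqr_normcD normc1 expr1n rmorph1 mul1r -mulrA Re_real_mul /t.
      by rewrite 2!normcM normc_real normc_conjc u1 mul1r exprMn real_normK ?num_real //; ring.
    exact: tilted_norm_le e0 e1 kt (normc_ge0 w) w2.
  apply/orP; right.
  have : normc (1 + eta%:C * conjc u * w) <= 1 + 2 * eta.
    apply: le_trans (le_normcD _ _) _; rewrite normc1 lerD2l !normcM normc_conjc u1 mulr1.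
    by rewrite normc_real gtr0_norm // mulrC ler_pM2r.
  by move=> h; rewrite mulrC; exact: tilted_product_le h (normc_ge0 _) (normc_ge0 _) e0 M0 e2 kf.
by rewrite aM' leNgt /M' tilted_max_lt.
Qed.

End maximum_modulus.

(** * Bounded holomorphic functions off a zero set *)

Section punctured_maximum.
Context {K : realType}.
Local Notation C := K[i].
Implicit Types (f g L q : C^o -> C^o).

Lemma near_neq0 L (z : C^o) : {for z, continuous L} -> L z != 0 -> \near z, L z != 0.
Proof.
move=> /continuous_CP cL Lz; have := cL (normc (L z)); rewrite normc_gt0 => /(_ Lz).
apply: filterS => w; apply: contraTneq => ->.
by rewrite sub0r normcN ltxx.
Qed.

Lemma near_normc_lt (z : C^o) (r : K) : normc (z : C) < r ->
  \forall w \near z, normc (w : C) < r.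
Proof.
move=> zr; apply/nbhsCP; exists (r - normc (z : C)); first by rewrite subr_gt0.
move=> w wz; have := le_normcD (w - z) z; rewrite subrK; lra.
Qed.

(* [L q^N] obeys the maximum principle for every [N]; letting [N] grow removes
   the factor [L], which only has to vanish on the bad points of [q]. *)
Lemma maximum_off_zeros L q (r r' B Q : K) : 0 < r -> r < r' ->
  (forall z : C^o, normc (z : C) < r' -> {for z, continuous L}) ->
  (forall z : C^o, normc (z : C) < r' -> L z != 0 -> holo_limit L z) ->
  (forall z : C^o, normc (z : C) < r' -> L z != 0 -> differentiable q z) ->
  (forall z : C^o, normc (z : C) < r' -> L z != 0 -> normc (q z) <= B) ->
  (forall z : C^o, normc (z : C) = r -> L z != 0 -> normc (q z) <= Q) -> 0 <= Q ->
  forall z : C^o, normc (z : C) <= r -> L z != 0 -> normc (q z) <= Q.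
Proof.
move=> r0 rr' cL hL dq bq bQ Q0 z0 z0r Lz0.
have rr z : normc (z : C) <= r -> normc (z : C) < r' by move=> h; exact: le_lt_trans rr'.
pose A := [set z : C^o | normc (z : C) <= r].
have [zm] : exists2 c, c \in A & forall t, t \in A -> normc (L t) <= normc (L c).
  apply: compact_EVT_max; [by exists z0|exact: compact_disc|].
  apply: continuous_in_subspaceT => z; rewrite inE => zA.
  by apply: (@continuous_normc K C^o L); apply: cL; exact: rr.
rewrite inE; set Lm := normc (L zm) => zmA Hm.
have n0 : 0 < normc (L z0) by rewrite normc_gt0.
apply: (@expr_le_le _ _ _ (Lm / normc (L z0))) => //; first exact: normc_ge0.
move=> N; rewrite mulrAC ler_pdivlMr // mulrC -normcX -normcM.
have B0 : 0 <= B by apply: le_trans (bq _ (rr _ z0r) Lz0); exact: normc_ge0.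
apply: (@maximum_disc _ (fun z => (L z : C) * (q z : C) ^+ N) r r' _ r0 rr' _ _ _ z0 z0r).
- move=> z zr'; case: (eqVneq (L z) 0) => [Lz|Lz].
    have BN0 : 0 < B ^+ N + 1 by rewrite ltr_wpDl ?exprn_ge0.
    apply/continuous_CP => e e0; have /continuous_CP/(_ (e / (B ^+ N + 1))) := cL _ zr'.
    move=> /(_ (divr_gt0 e0 BN0)) Hn.
    apply: filterS2 Hn (near_normc_lt zr') => w; rewrite Lz subr0 => Lw wr.
    rewrite mul0r subr0 normcM normcX.
    case: (eqVneq (L w) 0) => [->|Lw0]; first by rewrite normc0 mul0r.
    move: Lw; rewrite ltr_pdivlMr //; apply: le_lt_trans.
    rewrite ler_wpM2l ?normc_ge0 //.
    apply: (@le_trans _ _ (B ^+ N)); last by rewrite lerDl.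
    by apply: lerXn2r; rewrite ?nnegrE ?normc_ge0 // bq.
  apply: (@continuousM C C^o L (fun z => (q z : C) ^+ N : C^o)); first exact: cL.
  by apply: differentiable_continuous; apply: differentiable_expr; exact: dq.
- move=> z zr; case: (eqVneq (L z) 0) => [Lz|Lz].
    by right; rewrite Lz mul0r normc0 mulr_ge0 ?exprn_ge0 ?normc_ge0.
  have zr' : normc (z : C) < r' by exact: lt_trans rr'.
  left; apply: holo_limitM; first exact: hL.
  apply: filterS2 (near_neq0 (cL _ zr') Lz) (near_normc_lt zr') => w Lw wr'.
  by apply: differentiable_expr; exact: dq.
- move=> z zr; have zA : normc (z : C) <= r by rewrite zr.
  rewrite normcM normcX; case: (eqVneq (L z) 0) => [->|Lz].
    by rewrite normc0 mul0r mulr_ge0 ?exprn_ge0 ?normc_ge0.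
  apply: ler_pM; rewrite ?exprn_ge0 ?normc_ge0 //; first by apply: Hm; rewrite inE.
  by apply: lerXn2r; rewrite ?nnegrE ?normc_ge0 // bQ.
Qed.

(** Near [t] the derivative bounds the quotient, elsewhere the denominator does. Only the existence
    of [B] matters, because the conclusion of [maximum_off_zeros] does not contain it. *)
Lemma difference_quotient_bound g (M r' : K) (t : C^o) L :
  (forall z : C^o, normc (z : C) < r' -> L z != 0 -> normc (g z) <= M) ->
  normc (t : C) < r' -> L t != 0 -> differentiable g t ->
  exists B, forall z : C^o, normc (z : C) < r' -> (L z : C) * ((z : C) - t) != 0 ->
   normc ((g z - g t) / ((z : C) - t)) <= B.
Proof.
move=> bg tr Lt /differentiableC_expansion[d Hd].
have [dl dl0 H] := Hd 1 ltr01.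
have M0 : 0 <= M by apply: le_trans (bg _ tr Lt); exact: normc_ge0.
exists (Num.max (normc d + 1) (2 * M / dl)) => z zr.
rewrite mulf_eq0 negb_or => /andP[Lz zt].
have nz : 0 < normc ((z : C) - t) by rewrite normc_gt0.
rewrite normcf ler_pdivrMr // maxr_pMl ?normc_ge0 // le_max.
case: (ltP (normc ((z : C) - t)) dl) => [zd|zd]; apply/orP.
  left; have := H _ zd; have := normc_sub_le (g z - g t) (d * ((z : C) - t)).
  by rewrite normcM mulrDl; lra.
right; apply: (@le_trans _ _ (2 * M)).
  by apply: le_trans (le_normcB _ _) _; have := bg _ zr Lz; have := bg _ tr Lt; lra.
by rewrite mulrAC ler_pdivlMr // ler_wpM2l // mulr_ge0.
Qed.

Section lipschitz.
Variables (L g : C^o -> C^o) (r r' M : K).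
Hypotheses (r0 : 0 < r) (rr' : r < r').
Hypothesis cL : forall z : C^o, normc (z : C) < r' -> {for z, continuous L}.
Hypothesis hL : forall z : C^o, normc (z : C) < r' -> L z != 0 -> holo_limit L z.
Hypothesis dg : forall z : C^o, normc (z : C) < r' -> L z != 0 -> differentiable g z.
Hypothesis bg : forall z : C^o, normc (z : C) < r' -> L z != 0 -> normc (g z) <= M.

Lemma dq_differentiable (t z : C^o) : differentiable g z -> (z : C) - t != 0 ->
  differentiable (fun z => (g z - g t) / ((z : C) - t) : C^o) z.
Proof.
move=> dgz zt; apply: differentiableM.
  by apply: differentiableB => //; exact: differentiable_cst.
by apply: differentiableV => //; apply: differentiableB => //; exact: differentiable_cst.
Qed.

(** Multiplying [L] by [z - t] turns the point where a difference quotient at [t] is undefined into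
    one more exceptional zero. *)
Lemma shifted_factor (t z : C^o) : normc (z : C) < r' ->
  {for z, continuous (fun z : C^o => (L z : C) * ((z : C) - t) : C^o)} /\
  ((L z : C) * ((z : C) - t) != 0 -> holo_limit (fun z : C^o => (L z : C) * ((z : C) - t) : C^o) z).
Proof.
move=> zr; have ds w : differentiable (fun z : C^o => (z : C) - t : C^o) w.
  by apply: differentiableB => //; exact: differentiable_cst.
split.
  apply: (@continuousM C C^o L (fun z : C^o => (z : C) - t : C^o)); first exact: cL.
  exact: differentiable_continuous.
rewrite mulf_eq0 negb_or => /andP[Lz zt].
apply: holo_limitM; first exact: hL.
by apply: (nbhsCP _ _).2; exists 1 => // w _; exact: ds.
Qed.

(** On the circle of radius [r] the numerator is at most [2 * M] and the denominator at least
    [r / 2]; the maximum principle carries the quotient of these bounds inwards. *)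
Lemma dq_bound (t : C^o) : normc (t : C) <= r / 2 -> L t != 0 ->
  forall z : C^o, normc (z : C) <= r -> (L z : C) * ((z : C) - t) != 0 ->
  normc ((g z - g t) / ((z : C) - t)) <= 4 * M / r.
Proof.
move=> tr Lt.
have tr' : normc (t : C) < r' by have := r0; have := rr'; move: tr; lra.
have M0 : 0 <= M by apply: le_trans (bg tr' Lt); exact: normc_ge0.
have [B HB] := difference_quotient_bound bg tr' Lt (dg tr' Lt).
apply: (@maximum_off_zeros (fun z => (L z : C) * ((z : C) - t)) _ r r' B _ r0 rr').
- by move=> z /(shifted_factor t)[].
- by move=> z /(shifted_factor t)[].
- by move=> z zr; rewrite mulf_eq0 negb_or => /andP[Lz zt]; apply: dq_differentiable => //; exact: dg.
- exact: HB.
- move=> z zr; rewrite mulf_eq0 negb_or => /andP[Lz zt].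
  have zt2 : r / 2 <= normc ((z : C) - t).
    by have := r0; have := normc_sub_le z t; rewrite zr; lra.
  rewrite normcf ler_pdivrMr; last by apply: lt_le_trans zt2; have := r0; lra.
  apply: (@le_trans _ _ (2 * M)).
    have zr' : normc (z : C) < r' by rewrite zr.
    by apply: le_trans (le_normcB _ _) _; have := bg zr' Lz; have := bg tr' Lt; lra.
  have -> : 2 * M = 4 * M / r * (r / 2) by field; exact: lt0r_neq0.
  by rewrite ler_wpM2l // divr_ge0 ?mulr_ge0 // ltW.
- by rewrite divr_ge0 ?mulr_ge0 // ltW.
Qed.

Lemma lipschitz_off_zeros (s t : C^o) : normc (s : C) <= r / 2 -> normc (t : C) <= r / 2 ->
  L s != 0 -> L t != 0 -> normc (g s - g t) <= 4 * M / r * normc ((s : C) - t).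
Proof.
move=> sr tr Ls Lt; case: (eqVneq s t) => [->|st]; first by rewrite !subrr normc0 mulr0.
have st0 : (s : C) - t != 0 by rewrite subr_eq0.
have sr' : normc (s : C) <= r by have := r0; move: sr; lra.
have := dq_bound tr Lt sr'; rewrite mulf_eq0 negb_or Ls st0 => /(_ isT).
by rewrite normcf ler_pdivrMr // normc_gt0.
Qed.

End lipschitz.

(** The difference quotient at 0 is itself bounded off zeros, so the Lipschitz estimate applies to
    it. This replaces a bound on the second derivative: difference quotients converge at a rate that
    depends on [M] and [r] only. *)
Lemma second_difference_bound L g (r r' M : K) : 0 < r -> r < r' ->
  (forall z : C^o, normc (z : C) < r' -> {for z, continuous L}) ->
  (forall z : C^o, normc (z : C) < r' -> L z != 0 -> holo_limit L z) ->
  (forall z : C^o, normc (z : C) < r' -> L z != 0 -> differentiable g z) ->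
  (forall z : C^o, normc (z : C) < r' -> L z != 0 -> normc (g z) <= M) ->
  L 0 != 0 -> forall s t : C^o, normc (s : C) <= r / 4 -> normc (t : C) <= r / 4 ->
  L s != 0 -> L t != 0 -> s != 0 -> t != 0 ->
  normc ((g s - g 0) / (s : C) - (g t - g 0) / (t : C)) <= 8 * (4 * M / r) / r * normc ((s : C) - t).
Proof.
move=> r0 rr' cL hL dg bg L0 s t sr tr Ls Lt s0 t0.
have sub0 (z : C^o) : (z : C) - 0 = z by exact: subr0.
have z0 : normc (0 : C) <= r / 2 by rewrite normc0 divr_ge0 // ltW.
have B := dq_bound r0 rr' cL hL dg bg z0 L0.
pose q (z : C^o) : C^o := (g z - g 0) / ((z : C) - 0).
pose L1 (z : C^o) : C^o := (L z : C) * ((z : C) - 0).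
have -> : 8 * (4 * M / r) / r = 4 * (4 * M / r) / (r / 2) by field; exact: lt0r_neq0.
have -> : (g s - g 0) / (s : C) - (g t - g 0) / (t : C) = q s - q t by rewrite /q !sub0.
apply: (@lipschitz_off_zeros L1 q (r / 2) r (4 * M / r) _ _ _ _ _ _ s t).
- by rewrite divr_gt0.
- by rewrite ltr_pdivrMr //; lra.
- by move=> z zr; have [] := shifted_factor cL hL 0 (lt_trans zr rr').
- by move=> z zr; have [] := shifted_factor cL hL 0 (lt_trans zr rr').
- move=> z zr; rewrite /L1 mulf_eq0 negb_or => /andP[Lz zn].
  by apply: dq_differentiable => //; apply: dg => //; exact: lt_trans rr'.
- by move=> z zr; apply: B; exact: ltW.
- by move: sr; lra.
- by move: tr; lra.
- by rewrite /L1 sub0 mulf_neq0.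
- by rewrite /L1 sub0 mulf_neq0.
Qed.

(* [maximum_off_zeros] applied to [1 / z]. *)
Lemma zero_near_closure_support L (r r' : K) (a : C^o) : 0 < r -> r < r' ->
  (forall z : C^o, normc (z : C) < r' -> {for z, continuous L}) ->
  (forall z : C^o, normc (z : C) < r' -> L z != 0 -> holo_limit L z) ->
  normc (a : C) < r -> L a != 0 ->
  forall e : K, 0 < e -> exists2 z : C^o, normc (z : C) < e & L z != 0.
Proof.
move=> r0 rr' cL hL ar La e e0; apply: contrapT => H.
have Lz (z : C^o) : L z != 0 -> e <= normc (z : C).
  by move=> h; rewrite leNgt; apply/negP => ze; apply: H; exists z.
have zn0 (z : C^o) : L z != 0 -> z != 0.
  by move=> /Lz h; rewrite -normc_gt0; exact: lt_le_trans h.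
have ai : 0 < normc (a : C) by rewrite normc_gt0 zn0.
have : normc ((a : C)^-1) <= r^-1.
  apply: (@maximum_off_zeros L (fun z : C^o => (z : C)^-1 : C^o) r r' e^-1 _ r0 rr' cL hL).
  - by move=> z _ /zn0 z0; apply: differentiable_Rinv.
  - by move=> z _ /Lz h; rewrite normcV lef_pV2 // posrE; exact: lt_le_trans h.
  - by move=> z zr _; rewrite normcV zr.
  - by rewrite invr_ge0 ltW.
  - exact: ltW.
  - exact: La.
by rewrite normcV lef_pV2 ?posrE // leNgt ar.
Qed.

End punctured_maximum.

(** * The Euclidean norm and differentiability in several variables *)

Lemma real_complexV (K : realType) (r : K) : (r^-1)%:C = (r%:C)^-1.
Proof. by rewrite fmorphV. Qed.

Lemma real_complexf (K : realType) (r s : K) : (r / s)%:C = r%:C / s%:C.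
Proof. by rewrite -real_complexV -rmorphM. Qed.

Lemma real_complexN (K : realType) (r : K) : (- r)%:C = - r%:C.
Proof. by rewrite rmorphN. Qed.

Lemma conjcM (K : realType) (x y : K[i]) : conjc (x * y) = conjc x * conjc y.
Proof. by case: x y => [a b] [c d]; simpc; congr (_ +i* _); ring. Qed.

Section euclidean_norm.
Context {K : realType} {n : nat}.
Local Notation C := K[i].
Local Notation V := ('rV[C]_n : normedModType C).
Implicit Types (x y z v : 'rV[C]_n).

Definition hdot x y : C := \sum_(j < n) x ord0 j * conjc (y ord0 j).

Lemma hdotDl x y z : hdot (x + y) z = hdot x z + hdot y z.
Proof. by rewrite -big_split; apply: eq_bigr => j _; rewrite mxE mulrDl. Qed.

Lemma hdotZl (a : C) x z : hdot (a *: x) z = a * hdot x z.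
Proof. by rewrite big_distrr /=; apply: eq_bigr => j _; rewrite mxE mulrA. Qed.

Lemma hdotBl x y z : hdot (x - y) z = hdot x z - hdot y z.
Proof. by rewrite hdotDl -scaleN1r hdotZl mulN1r. Qed.

Lemma hdot0l z : hdot 0 z = 0.
Proof. by rewrite -(scale0r z) hdotZl mul0r. Qed.

Lemma hdotC x y : hdot y x = conjc (hdot x y).
Proof. by rewrite rmorph_sum; apply: eq_bigr => j _ /=; rewrite conjcM conjcK mulrC. Qed.

Lemma hdotZr (a : C) x z : hdot x (a *: z) = conjc a * hdot x z.
Proof. by rewrite hdotC hdotZl conjcM -hdotC. Qed.

Lemma sqr_enorm x : enorm x ^+ 2 = \sum_(j < n) normc (x ord0 j) ^+ 2.
Proof. by rewrite sqr_sqrtr // sumr_ge0 // => j _; rewrite sqr_ge0. Qed.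

Lemma enorm_ge0 x : 0 <= enorm x.
Proof. exact: sqrtr_ge0. Qed.

Lemma hdotxx x : hdot x x = (enorm x ^+ 2)%:C.
Proof. by rewrite sqr_enorm rmorph_sum; apply: eq_bigr => j _; rewrite mulcJ. Qed.

Lemma coord_le_enorm x j : normc (x ord0 j) <= enorm x.
Proof.
rewrite -(@ler_pXn2r _ 2) ?nnegrE ?enorm_ge0 ?normc_ge0 // sqr_enorm (bigD1 j) //=.
by rewrite lerDl sumr_ge0 // => i _; rewrite sqr_ge0.
Qed.

Lemma enorm0 : enorm (0 : 'rV[C]_n) = 0.
Proof.
by rewrite /enorm big1 ?sqrtr0 // => j _; rewrite mxE normc0 expr0n.
Qed.

Lemma enorm_eq0 x : (enorm x == 0) = (x == 0).
Proof.
apply/eqP/eqP => [x0|->]; last exact: enorm0.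
apply/rowP => j; rewrite mxE; apply: eq0_normc; apply/eqP.
by rewrite eq_le normc_ge0 -x0 coord_le_enorm.
Qed.

Lemma enorm_gt0 x : (0 < enorm x) = (x != 0).
Proof. by rewrite lt_def enorm_ge0 andbT enorm_eq0. Qed.

Lemma enormZ (a : C) x : enorm (a *: x) = normc a * enorm x.
Proof.
apply/eqP; rewrite -(@eqrXn2 _ 2) ?enorm_ge0 ?mulr_ge0 ?normc_ge0 ?enorm_ge0 //.
rewrite exprMn !sqr_enorm big_distrr /=; apply/eqP; apply: eq_bigr => j _.
by rewrite mxE normcM exprMn.
Qed.

Lemma enormN x : enorm (- x) = enorm x.
Proof. by rewrite -scaleN1r enormZ normcN normc1 mul1r. Qed.

Lemma enormBC x y : enorm (x - y) = enorm (y - x).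
Proof. by rewrite -enormN opprB. Qed.

Lemma sqr_enormD x y : enorm (x + y) ^+ 2 = enorm x ^+ 2 + 2 * Re (hdot y x) + enorm y ^+ 2.
Proof.
rewrite !sqr_enorm /hdot (raddf_sum (@complex.Re K : {additive Rcomplex K -> K})) big_distrr /= -!big_split /=.
by apply: eq_bigr => j _; rewrite mxE sqr_normcD [conjc _ * _]mulrC.
Qed.

Lemma hdot_le x y : normc (hdot x y) <= enorm x * enorm y.
Proof.
case: (eqVneq y 0) => [->|y0]; first by rewrite hdotC hdot0l conjc0 normc0 enorm0 mulr0.
have ny : 0 < enorm y by rewrite enorm_gt0.
set d := hdot x y; pose c : C := - (d / (enorm y ^+ 2)%:C).
have E : c * hdot y x = (- (normc d ^+ 2 / enorm y ^+ 2))%:C.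
  by rewrite (hdotC x y) /c mulNr mulrAC mulcJ real_complexN real_complexf.
have := sqr_ge0 (enorm (x + c *: y)).
rewrite sqr_enormD hdotZl enormZ E /= /c normcN normcf normc_real (ger0_norm (sqr_ge0 _)).
have -> : (normc d / enorm y ^+ 2 * enorm y) ^+ 2 = normc d ^+ 2 / enorm y ^+ 2.
  by field; exact: lt0r_neq0.
move=> H; have {}H : normc d ^+ 2 / enorm y ^+ 2 <= enorm x ^+ 2 by lra.
have n2 : normc d ^+ 2 <= (enorm x * enorm y) ^+ 2.
  by move: H; rewrite ler_pdivrMr ?exprn_gt0 // exprMn.
by rewrite -(@ler_pXn2r _ 2) ?nnegrE ?mulr_ge0 ?normc_ge0 ?enorm_ge0.
Qed.

Lemma ler_enormD x y : enorm (x + y) <= enorm x + enorm y.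
Proof.
rewrite -(@ler_pXn2r _ 2) ?nnegrE ?addr_ge0 ?enorm_ge0 // sqr_enormD sqrrD.
have := Re_le_normc (hdot y x); have := hdot_le y x.
have := ler_norm (Re (hdot y x)); lra.
Qed.

Lemma enorm_sub_le x y : enorm x - enorm y <= enorm (x - y).
Proof. by rewrite lerBlDr -{1}(subrK y x) ler_enormD. Qed.

Lemma ler_enorm_dist z x y : enorm (x - y) <= enorm (x - z) + enorm (z - y).
Proof. by rewrite -{1}(subrK z x) -addrA ler_enormD. Qed.

Lemma ler_enorm_sum (I : Type) (r : seq I) (P : pred I) (F : I -> 'rV[C]_n) :
  enorm (\sum_(i <- r | P i) F i) <= \sum_(i <- r | P i) enorm (F i).
Proof.
elim/big_rec2 : _ => [|i a b _ ab]; first by rewrite enorm0.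
by apply: le_trans (ler_enormD _ _) _; rewrite lerD2l.
Qed.

Lemma enorm_delta (j : 'I_n) : enorm (delta_mx ord0 j : 'rV[C]_n) = 1.
Proof.
rewrite /enorm (bigD1 j) //= mxE !eqxx mulr1n normc1 expr1n big1 ?addr0 ?sqrtr1 // => i ij.
by rewrite mxE (negbTE ij) andbF mulr0n normc0 expr0n.
Qed.

Lemma enorm_le_sum x : enorm x <= \sum_(j < n) normc (x ord0 j).
Proof.
rewrite {1}(row_sum_delta x); apply: le_trans (ler_enorm_sum _ _ _) _.
by apply: ler_sum => j _; rewrite enormZ enorm_delta mulr1.
Qed.

Lemma mx_norm_le_enorm x : `|x| <= (enorm x)%:C.
Proof.
rewrite [`|x|]/Num.norm /=; case: (eqVneq (mx_norm x) 0) => [->|/mx_norm_neq0[[i j] ->]].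
  by rewrite lecR enorm_ge0.
by rewrite ord1 /= complex_normE lecR coord_le_enorm.
Qed.

Lemma coord_le_mx_norm x j : (normc (x ord0 j))%:C <= `|x|.
Proof.
rewrite -complex_normE [`|x|]/Num.norm /= mx_normE -[leLHS]nngE num_le.
exact: (le_bigmax _ _ (ord0, j)).
Qed.

Lemma enorm_le_mx_norm x : (enorm x)%:C <= n%:R * `|x|.
Proof.
apply: (@le_trans _ _ (\sum_(j < n) normc (x ord0 j))%:C); first by rewrite lecR enorm_le_sum.
have -> : n%:R * `|x| = \sum_(j < n) `|x| by rewrite sumr_const card_ord mulr_natl.
rewrite rmorph_sum /=.
by apply: ler_sum => j _; exact: coord_le_mx_norm.
Qed.

Lemma nbhs_enormP x (P : set 'rV[C]_n) :
  nbhs (x : V) P <-> exists2 e : K, 0 < e & forall y, enorm (y - x) < e -> P y.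
Proof.
split.
  move=> /(@nbhs_normP C V)[e /= /posC_real [-> e0] H]; exists (Re e) => // y Hy.
  by apply: H; rewrite /= distrC; apply: le_lt_trans (mx_norm_le_enorm _) _; rewrite ltcR.
case=> e e0 H; apply/(@nbhs_normP C V).
(* Dividing by [n.+1] instead of [n] covers dimension zero too. *)
have n1 : 0 < (n.+1%:R : K) by rewrite ltr0n.
exists ((e / n.+1%:R)%:C); first by rewrite /= ltcR divr_gt0.
move=> y /=; rewrite distrC => yx; apply: H; rewrite -ltcR.
apply: le_lt_trans (enorm_le_mx_norm _) _.
apply: (@le_lt_trans _ _ (n.+1%:R * `|y - x|)); first by rewrite ler_wpM2r // ler_nat.
have -> : e%:C = n.+1%:R * (e / n.+1%:R)%:C.
  have -> : (n.+1%:R : C) = (n.+1%:R)%:C by rewrite rmorph_nat.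
  by rewrite -rmorphM /= mulrC divfK // gt_eqF.
by rewrite ltr_pM2l // ltr0n.
Qed.

Lemma continuous_enormP (T : topologicalType) (f : T -> V) (x : T) :
  {for x, continuous f} <->
  forall e : K, 0 < e -> \forall t \near x, enorm (f t - f x) < e.
Proof.
split.
  move=> cf e e0; apply: (cf [set w : V | enorm (w - f x) < e]).
  by apply/nbhs_enormP; exists e.
move=> H A /nbhs_enormP[e e0 HA]; have := H _ e0.
by apply: filterS => y /HA.
Qed.

Lemma continuous_enorm (T : topologicalType) (f : T -> V) (x : T) :
  {for x, continuous f} -> {for x, continuous (fun t => enorm (f t) : K)}.
Proof.
move=> /continuous_enormP H; apply/cvgrPdist_lt => e e0.
have := H _ e0; apply: filterS => y; apply: le_lt_trans.
rewrite ler_norml; have := enorm_sub_le (f y) (f x); have := enorm_sub_le (f x) (f y).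
by rewrite [enorm (f x - f y)]enormBC => h1 h2; apply/andP; split; lra.
Qed.

Lemma compact_enorm_bounded (A : set V) (r : K) : closed A ->
  (forall z, A z -> enorm z <= r) -> compact A.
Proof.
move=> cA bA; pose B := [set z : V | forall i, normc (z ord0 i) <= r].
have cB : compact B.
  refine (@rV_compact C^o n (fun=> [set z : C^o | normc (z : C) <= r]) _) => i.
  exact: compact_disc.
apply: (subclosed_compact cA cB).
by move=> z /bA zr i /=; apply: le_trans zr; exact: coord_le_enorm.
Qed.

Lemma closed_enorm_le (c : 'rV[C]_n) (r : K) : closed [set z : V | enorm (z - c) <= r].
Proof.
move=> z clz /=; apply/ler_addgt0Pr => e e0.
have [w [/= wr we]] : [set z : V | enorm (z - c) <= r] `&` [set w : V | enorm (w - z) < e] !=set0.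
  by apply: clz; apply/nbhs_enormP; exists e.
have := ler_enorm_dist w z c; rewrite [enorm (z - w)]enormBC; lra.
Qed.

Lemma compact_eball (c : 'rV[C]_n) (r : K) : compact [set z : V | enorm (z - c) <= r].
Proof.
refine (@compact_enorm_bounded _ (r + enorm c) (@closed_enorm_le c r) _) => z /= zr.
by have := ler_enormD (z - c) c; rewrite subrK; lra.
Qed.

Lemma eball_center (c : 'rV[C]_n) (r : K) : 0 < r -> eball c r c.
Proof. by rewrite /eball /= subrr enorm0. Qed.

Lemma eball_nbhs (c : 'rV[C]_n) (r : K) x : eball c r x ->
  exists2 e : K, 0 < e & eball x e `<=` eball c r.
Proof.
rewrite /eball /= => xr; exists (r - enorm (x - c)); first by rewrite subr_gt0.
by move=> y /= yx; have := ler_enorm_dist x y c; lra.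
Qed.

End euclidean_norm.

Section several_variables.
Context {K : realType}.
Local Notation C := K[i].
Local Notation CV n := ('rV[C]_n : normedModType C).

Lemma differentiable_line n (x v : CV n) (a : C^o) :
  differentiable (fun l : C^o => x + (l : C) *: v : CV n) a.
Proof.
apply: differentiableD; first exact: differentiable_cst.
exact: (@differentiableZl C C^o (CV n) id v a).
Qed.

Lemma differentiable_on_line n (W : normedModType C) (f : CV n -> W) (x v : CV n) (a : C^o) :
  differentiable f (x + (a : C) *: v) ->
  differentiable (fun l : C^o => f (x + (l : C) *: v)) a.
Proof.
by move=> df; apply: (@differentiable_comp _ _ _ _ (fun l : C^o => x + (l : C) *: v : CV n) f);
  first exact: differentiable_line.
Qed.

Lemma differentiable_rV_coord (V : normedModType C) n (F : V -> CV n) x j :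
  differentiable F x -> differentiable (fun y => F y ord0 j : C^o) x.
Proof.
move=> dF; apply: (@differentiable_comp _ _ _ _ F (fun y : CV n => y ord0 j : C^o)) => //.
exact: differentiable_coord.
Qed.

Lemma differential_enorm_expansion n m (F : CV n -> CV m) x : differentiable F x ->
  forall e : K, 0 < e -> exists2 d : K, 0 < d & forall y : CV n, enorm (y - x) < d ->
    enorm (F y - F x - 'd F x (y - x)) <= e * enorm (y - x).
Proof.
move=> dF e e0; have m1 : 0 < (m.+1%:R : K) by rewrite ltr0n.
have em : 0 < (e / m.+1%:R)%:C by rewrite ltcR divr_gt0.
have /nbhs_enormP[d d0 H] := differentiable_expansion dF em.
exists d => // y yx; have := H (y - x); rewrite subr0 => /(_ yx).
rewrite [x + _]addrC subrK => {}H; rewrite -lecR.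
apply: le_trans (enorm_le_mx_norm _) _.
apply: (@le_trans _ _ (m.+1%:R * `|F y - F x - 'd F x (y - x)|)).
  by rewrite ler_wpM2r // ler_nat.
apply: (@le_trans _ _ (m.+1%:R * ((e / m.+1%:R)%:C * (enorm (y - x))%:C))).
  rewrite ler_wpM2l // ?ler0n //; apply: le_trans H _.
  by rewrite ler_wpM2l ?(ltW em) // mx_norm_le_enorm.
have -> : (m.+1%:R : C) = (m.+1%:R)%:C by rewrite rmorph_nat.
by rewrite -!rmorphM /= lecR mulrA [_ * (e / _)]mulrC divfK // gt_eqF.
Qed.

(** A crude operator bound; the summand 1 makes it positive for the zero matrix as well, so that it
    can be divided by. *)
Definition mx_bound n m (A : 'M[C]_(n, m)) : K :=
  1 + \sum_(j < m) \sum_(i < n) normc (A i j).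

Lemma mx_bound_gt0 n m (A : 'M[C]_(n, m)) : 0 < mx_bound A.
Proof.
by rewrite ltr_wpDr // sumr_ge0 // => j _; rewrite sumr_ge0 // => i _; exact: normc_ge0.
Qed.

Lemma enorm_mulmx n m (A : 'M[C]_(n, m)) (v : 'rV[C]_n) :
  enorm (v *m A) <= mx_bound A * enorm v.
Proof.
apply: le_trans (enorm_le_sum _) _.
rewrite mulrDl mul1r; apply: ler_wpDl; first exact: enorm_ge0.
rewrite big_distrl /=; apply: ler_sum => j _; rewrite mxE big_distrl /=.
elim/big_rec2 : _ => [|i a b _ ab]; first by rewrite normc0.
apply: le_trans (le_normcD _ _) _; apply: lerD => //.
by rewrite normcM mulrC ler_wpM2l ?normc_ge0 // coord_le_enorm.
Qed.

Lemma continuous_mulmxr n m (A : 'M[C]_(n, m)) : continuous (mulmxr A : CV n -> CV m).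
Proof.
move=> x; apply/continuous_enormP => e e0; apply/nbhs_enormP.
exists (e / mx_bound A); first by rewrite divr_gt0 ?mx_bound_gt0.
move=> y; rewrite ltr_pdivlMr ?mx_bound_gt0 // mulrC /= -mulmxBl.
exact: le_lt_trans (enorm_mulmx _ _).
Qed.

Definition dmx n m (F : CV n -> CV m) x : 'M[C]_(n, m) := lin1_mx ('d F x).

Lemma mul_dmx n m (F : CV n -> CV m) x v : v *m dmx F x = 'd F x v.
Proof. by rewrite /dmx mul_rV_lin1. Qed.

Lemma differentiable_of_expansion n m (F : CV n -> CV m) (x : CV n) (A : 'M[C]_(n, m)) :
  (forall e : K, 0 < e -> exists2 d : K, 0 < d & forall y : CV n, enorm (y - x) < d ->
    enorm (F y - F x - (y - x) *m A) <= e * enorm (y - x)) ->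
  differentiable F x /\ dmx F x = A.
Proof.
move=> H; pose df : {linear CV n -> CV m} := mulmxr A.
have cdf : continuous df by exact: continuous_mulmxr.
have E : F \o shift x = cst (F x) + df +o_ 0 id.
  apply/eqaddoP => e /posC_real[-> e0].
  have n1 : 0 < (n.+1%:R : K) by rewrite ltr0n.
  have [d d0 Hd] := H _ (divr_gt0 e0 n1).
  apply/nbhs_enormP; exists d => // h; rewrite subr0 => hd.
  have := Hd (h + x); rewrite addrK => /(_ hd); rewrite !fctE /= opprD addrA => Hh.
  apply: le_trans (mx_norm_le_enorm _) _.
  apply: (@le_trans _ _ (Re e / n.+1%:R * enorm h)%:C); first by rewrite lecR.
  rewrite mulrAC -mulrA rmorphM /=; apply: ler_wpM2l; first by rewrite ler0c ltW.
  rewrite real_complexf; have -> : (n.+1%:R)%:C = n.+1%:R :> C by rewrite rmorph_nat.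
  rewrite ler_pdivrMr ?ltr0n // mulrC; apply: le_trans (enorm_le_mx_norm _) _.
  by rewrite ler_wpM2r // ler_nat.
split; last first.
  by apply/row_matrixP => j; rewrite !rowE mul_dmx (diff_unique cdf E).
apply/diff_locallyP; rewrite (diff_unique cdf E); split; first exact: cdf.
exact: E.
Qed.

Lemma diff_enorm_expansion n m (F : CV n -> CV m) x : differentiable F x ->
  forall e : K, 0 < e -> exists2 d : K, 0 < d & forall y : CV n, enorm (y - x) < d ->
    enorm (F y - F x - (y - x) *m dmx F x) <= e * enorm (y - x).
Proof.
move=> dF e e0; have [d d0 H] := differential_enorm_expansion dF e0.
by exists d => // y /H; rewrite mul_dmx.
Qed.

Section lines.
Variables (n : nat) (L f : CV n -> C^o) (c : CV n) (rho M : K).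
Hypothesis rho0 : 0 < rho.
Hypothesis dL : forall x : CV n, differentiable L x.
Hypothesis df : forall x : CV n, eball c rho x -> L x != 0 -> differentiable f x.
Hypothesis bf : forall x : CV n, eball c rho x -> L x != 0 -> normc (f x) <= M.

Let line (x v : CV n) (l : C^o) : CV n := x + (l : C) *: v.

(** The radii are matched: from a base point within [rho / 8] of [c], the disc of radius [3 rho / 4]
    on a complex line stays in the ball, and two such base points are at distance at most [rho / 4],
    half of the radius [rho / 2] used on lines. *)
Lemma line_in_ball (x v : CV n) (l : C^o) : eball c (rho / 8) x -> enorm v = 1 ->
  normc (l : C) < rho * 3 / 4 -> eball c rho (line x v l).
Proof.
have := rho0; rewrite /eball /line /= => r0 xc v1 lr.
have := ler_enorm_dist x (x + (l : C) *: v) c.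
by rewrite [_ + _ - x]addrAC subrr add0r enormZ v1 mulr1; lra.
Qed.

Let cLl (x v : CV n) (z : C^o) : {for z, continuous (fun l => L (line x v l))}.
Proof. by apply: differentiable_continuous; apply: differentiable_on_line. Qed.

Let hLl (x v : CV n) (z : C^o) : holo_limit (fun l => L (line x v l)) z.
Proof.
apply: holo_limit_differentiable; apply: (nbhsCP _ _).2; exists 1 => // w _.
exact: differentiable_on_line.
Qed.

Let r0 : 0 < rho / 2. Proof. by rewrite divr_gt0. Qed.
Let rr' : rho / 2 < rho * 3 / 4. Proof. by have := rho0; lra. Qed.

Lemma ball_lipschitz (x y : CV n) : eball c (rho / 8) x -> eball c (rho / 8) y ->
  L x != 0 -> L y != 0 -> normc (f y - f x) <= 8 * M / rho * enorm (y - x).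
Proof.
move=> xc yc Lx Ly; case: (eqVneq y x) => [->|yx].
  by rewrite !subrr normc0 enorm0 mulr0.
have d0 : 0 < enorm (y - x) by rewrite enorm_gt0 subr_eq0.
set d := enorm (y - x) in d0 *.
pose v : CV n := (d^-1)%:C *: (y - x).
have v1 : enorm v = 1.
  by rewrite enormZ normc_real ger0_norm ?invr_ge0 ?(ltW d0) // mulVf // gt_eqF.
have Ey : line x v d%:C = y.
  rewrite /line /v scalerA -rmorphM /= mulfV ?gt_eqF // scale1r addrC subrK //.
have Ex : line x v 0 = x by rewrite /line scale0r addr0.
have dr : d <= rho / 2 / 2.
  by have := ler_enorm_dist c y x; move: xc yc; rewrite /eball /= [enorm (c - x)]enormBC /d; lra.
have dgl (z : C^o) : normc (z : C) < rho * 3 / 4 -> L (line x v z) != 0 ->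
    differentiable (fun l => f (line x v l)) z.
  by move=> zr Lz; apply: differentiable_on_line; apply: df => //; exact: line_in_ball.
have bgl (z : C^o) : normc (z : C) < rho * 3 / 4 -> L (line x v z) != 0 ->
    normc (f (line x v z)) <= M.
  by move=> zr Lz; apply: bf => //; exact: line_in_ball.
have nd : normc (d%:C) <= rho / 2 / 2 by rewrite normc_real gtr0_norm.
have n0 : normc (0 : C) <= rho / 2 / 2 by rewrite normc0; have := rho0; lra.
have := @lipschitz_off_zeros _ (fun l => L (line x v l)) (fun l => f (line x v l))
  (rho / 2) (rho * 3 / 4) M r0 rr' (fun z _ => @cLl x v z) (fun z _ _ => @hLl x v z)
  dgl bgl d%:C 0 nd n0; rewrite Ey Ex subr0 normc_real gtr0_norm //.
have -> : 4 * M / (rho / 2) = 8 * M / rho by field; exact: lt0r_neq0.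
exact.
Qed.

Lemma ball_second_difference (x v : CV n) : eball c (rho / 8) x -> enorm v = 1 -> L x != 0 ->
  forall s t : C^o, normc (s : C) <= rho / 8 -> normc (t : C) <= rho / 8 -> s != 0 -> t != 0 ->
  L (x + (s : C) *: v) != 0 -> L (x + (t : C) *: v) != 0 ->
  normc ((f (x + (s : C) *: v) - f x) / (s : C) - (f (x + (t : C) *: v) - f x) / (t : C)) <=
   128 * M / rho ^+ 2 * normc ((s : C) - t).
Proof.
move=> xc v1 Lx s t sr tr s0 t0 Ls Lt.
have Ex : line x v 0 = x by rewrite /line scale0r addr0.
have dgl (z : C^o) : normc (z : C) < rho * 3 / 4 -> L (line x v z) != 0 ->
    differentiable (fun l => f (line x v l)) z.
  by move=> zr Lz; apply: differentiable_on_line; apply: df => //; exact: line_in_ball.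
have bgl (z : C^o) : normc (z : C) < rho * 3 / 4 -> L (line x v z) != 0 ->
    normc (f (line x v z)) <= M.
  by move=> zr Lz; apply: bf => //; exact: line_in_ball.
have sr' : normc (s : C) <= rho / 2 / 4 by move: sr; lra.
have tr' : normc (t : C) <= rho / 2 / 4 by move: tr; lra.
have L0 : L (line x v 0) != 0 by rewrite Ex.
have := @second_difference_bound _ (fun l => L (line x v l)) (fun l => f (line x v l))
  (rho / 2) (rho * 3 / 4) M r0 rr' (fun z _ => @cLl x v z) (fun z _ _ => @hLl x v z)
  dgl bgl L0 s t sr' tr' Ls Lt s0 t0.
rewrite Ex.
have -> : 8 * (4 * M / (rho / 2)) / (rho / 2) = 128 * M / rho ^+ 2 by field; exact: lt0r_neq0.
exact.
Qed.

End lines.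

End several_variables.

(** * Uniform limits of holomorphic functions and the Jacobian determinant *)

Section approximable.
Context {K : realType} {n : nat}.
Local Notation C := K[i].
Local Notation V := ('rV[C]_n : normedModType C).
Implicit Types (S : set V) (phi psi : V -> C^o).

(* The analogue of [holo_limit] in several variables. Boundedness makes it stable
   under products, hence under determinants; the entries of a Jacobian matrix are
   limits of difference quotients. *)
Definition approximable S phi :=
  (exists B : K, forall x, S x -> normc (phi x) <= B) /\
  forall e : K, 0 < e -> exists psi, forall x, S x ->
    differentiable psi x /\ normc ((psi x : C) - phi x) <= e.

Lemma approximable_cst S (a : C) : approximable S (fun=> a).
Proof.
split; first by exists (normc a).
move=> e e0; exists (fun=> a) => x _; split; first exact: differentiable_cst.
by rewrite subrr normc0 ltW.
Qed.

Lemma approximableD S phi psi : approximable S phi -> approximable S psi ->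
  approximable S (fun x => (phi x : C) + psi x).
Proof.
move=> [[B1 H1] A1] [[B2 H2] A2]; split.
  exists (B1 + B2) => x Sx; apply: le_trans (le_normcD _ _) _.
  by apply: lerD; [exact: H1|exact: H2].
move=> e e0; have e2 : 0 < e / 2 by rewrite divr_gt0.
have [p1 Hp1] := A1 _ e2; have [p2 Hp2] := A2 _ e2.
exists (fun x => (p1 x : C) + p2 x) => x Sx.
have [d1 h1] := Hp1 x Sx; have [d2 h2] := Hp2 x Sx.
split; first exact: differentiableD.
rewrite opprD addrACA; apply: le_trans (le_normcD _ _) _; lra.
Qed.

Lemma approximableM S phi psi : approximable S phi -> approximable S psi ->
  approximable S (fun x => (phi x : C) * psi x).
Proof.
move=> [[B1' H1'] A1] [[B2' H2'] A2].
pose B1 := `|B1'|; pose B2 := `|B2'|.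
have [B10 B20] : 0 <= B1 /\ 0 <= B2 by rewrite /B1 /B2 !normr_ge0.
have H1 x : S x -> normc (phi x) <= B1 by move=> /H1' h; apply: le_trans (ler_norm _).
have H2 x : S x -> normc (psi x) <= B2 by move=> /H2' h; apply: le_trans (ler_norm _).
split.
  exists (B1 * B2) => x Sx; rewrite normcM.
  by apply: ler_pM; rewrite ?normc_ge0 ?H1 ?H2.
move=> e e0.
have e1 : 0 < e / (2 * (B2 + 1)) by rewrite divr_gt0 // mulr_gt0 // ltr_wpDl.
have e2 : 0 < Num.min 1 (e / (2 * (B1 + 1))).
  by rewrite lt_min ltr01 divr_gt0 // mulr_gt0 // ltr_wpDl.
have [p1 Hp1] := A1 _ e1; have [p2 Hp2] := A2 _ e2.
exists (fun x => (p1 x : C) * p2 x) => x Sx.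
have [d1 h1] := Hp1 x Sx; have [d2] := Hp2 x Sx; rewrite le_min => /andP[h2 h3].
split; first exact: differentiableM.
have -> : (p1 x : C) * p2 x - (phi x : C) * psi x =
    ((p1 x : C) - phi x) * p2 x + phi x * ((p2 x : C) - psi x) by ring.
apply: le_trans (le_normcD _ _) _; rewrite !normcM.
have P2 : normc (p2 x) <= B2 + 1.
  by have := normc_sub_le (p2 x) (psi x); have := H2 x Sx; lra.
have Q1 : normc ((p1 x : C) - phi x) * normc (p2 x) <= e / 2.
  have -> : e / 2 = e / (2 * (B2 + 1)) * (B2 + 1) by field; rewrite gt_eqF // ltr_wpDl.
  by apply: ler_pM; rewrite ?normc_ge0.
have Q2 : normc (phi x) * normc ((p2 x : C) - psi x) <= e / 2.
  have -> : e / 2 = (B1 + 1) * (e / (2 * (B1 + 1))) by field; rewrite gt_eqF // ltr_wpDl.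
  by apply: ler_pM; rewrite ?normc_ge0 //; apply: le_trans (H1 x Sx) _; rewrite lerDl.
by lra.
Qed.

Lemma approximable_sum S (I : Type) (r : seq I) (F : I -> V -> C^o) :
  (forall i, approximable S (F i)) -> approximable S (fun x => \sum_(i <- r) (F i x : C)).
Proof.
move=> HF; elim: r => [|i r IH].
  rewrite (_ : (fun x => _) = fun=> 0); first exact: approximable_cst.
  by apply/funext => x; rewrite big_nil.
rewrite (_ : (fun x => _) = fun x => (F i x : C) + \sum_(i <- r) (F i x : C)).
  exact: approximableD.
by apply/funext => x; rewrite big_cons.
Qed.

Lemma approximable_prod S (I : Type) (r : seq I) (F : I -> V -> C^o) :
  (forall i, approximable S (F i)) -> approximable S (fun x => \prod_(i <- r) (F i x : C)).
Proof.
move=> HF; elim: r => [|i r IH].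
  rewrite (_ : (fun x => _) = fun=> 1); first exact: approximable_cst.
  by apply/funext => x; rewrite big_nil.
rewrite (_ : (fun x => _) = fun x => (F i x : C) * \prod_(i <- r) (F i x : C)).
  exact: approximableM.
by apply/funext => x; rewrite big_cons.
Qed.

Lemma approximable_det S m (A : V -> 'M[C]_m) :
  (forall i j, approximable S (fun x => A x i j)) -> approximable S (fun x => \det (A x)).
Proof.
move=> HA; rewrite /determinant; apply: approximable_sum => s.
by apply: approximableM; [exact: approximable_cst|exact: approximable_prod].
Qed.

Lemma continuous_approximable (c : V) (r : K) phi : approximable (eball c r) phi ->
  forall x : V, eball c r x -> {for x, continuous phi}.
Proof.
move=> [_ A] x xc; apply/continuous_CP => e e0.
have e4 : 0 < e / 4 by rewrite divr_gt0.
have [psi Hp] := A _ e4; have [dp hp] := Hp x xc.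
have /continuous_CP/(_ _ e4)/nbhs_enormP[d d0 Hd] := differentiable_continuous dp.
have [d' d'0 Hd'] := eball_nbhs xc.
apply/nbhs_enormP; exists (Num.min d d'); first by rewrite lt_min d0.
move=> y; rewrite lt_min => /andP[/Hd y1 /Hd' /Hp[_ hy]].
have -> : (phi y : C) - phi x = ((psi y : C) - psi x) + ((psi x : C) - phi x) - ((psi y : C) - phi y) by ring.
apply: le_lt_trans (le_normcB _ _) _.
have := le_normcD ((psi y : C) - psi x) ((psi x : C) - phi x); lra.
Qed.

Lemma holo_limit_approximable (c : V) (r : K) phi (g : C^o -> V) (a : C^o) :
  approximable (eball c r) phi -> eball c r (g a) ->
  (\near a, differentiable g a) -> holo_limit (fun l => phi (g l)) a.
Proof.
move=> [_ A] ga dg.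
have cg : {for a, continuous g} by apply: differentiable_continuous; exact: nbhs_singleton dg.
have [d d0 Hd] := eball_nbhs ga.
have /continuous_enormP/(_ _ d0) Hg := cg.
have [s s0 Hs] := (nbhsCP _ _).1 (filterI dg Hg).
exists s => // e e0; have [psi Hp] := A _ e0.
exists (fun l => psi (g l)) => l ls; have [dgl gl] := Hs l ls.
have [dp hp] := Hp (g l) (Hd _ gl); split => //.
exact: (differentiable_comp dgl dp).
Qed.

(** An entry of the Jacobian matrix is the limit of the difference quotients [D s] along a basis
    vector. By [ball_second_difference] two of them differ by at most a constant times the
    difference of the steps, uniformly in [x], so pointwise convergence is uniform. *)
Lemma approximable_dmx m (F : V -> ('rV[C]_m : normedModType C)) (c : V) (r : K) : 0 < r ->
  (forall x : V, eball c r x -> differentiable F x) ->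
  exists2 r1 : K, 0 < r1 <= r & forall i j, approximable (eball c r1) (fun x => dmx F x i j).
Proof.
move=> r0 dF; have /continuous_enormP/(_ 1 ltr01)/nbhs_enormP[d d0 Hd] :=
  differentiable_continuous (dF c (eball_center c r0)).
pose rho := Num.min r d; have rho0 : 0 < rho by rewrite lt_min r0.
have rr : rho <= r by rewrite ge_min lexx.
have rd : rho <= d by rewrite ge_min lexx orbT.
pose M := enorm (F c) + 1.
have M0 : 0 < M by rewrite ltr_wpDl ?enorm_ge0.
have dF' (x : V) : eball c rho x -> differentiable F x.
  by move=> xc; apply: dF; exact: lt_le_trans rr.
have bF (x : V) k : eball c rho x -> normc (F x ord0 k) <= M.
  move=> xc; apply: le_trans (coord_le_enorm _ _) _.
  have := Hd x (lt_le_trans xc rd); have := enorm_sub_le (F x) (F c); rewrite /M; lra.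
exists (rho / 8); first by apply/andP; split; lra.
move=> j k; pose v : V := delta_mx ord0 j.
have v1 : enorm v = 1 by exact: enorm_delta.
pose D s (x : V) : C^o := ((F (x + s%:C *: v) ord0 k : C) - F x ord0 k) / s%:C.
have inb (x : V) s : 0 < s -> s <= rho / 8 -> eball c (rho / 8) x -> eball c rho (x + s%:C *: v).
  move=> s0 sr; rewrite /eball /= => xc.
  have := ler_enorm_dist x (x + s%:C *: v) c.
  rewrite [_ + _ - x]addrAC subrr add0r enormZ v1 mulr1 normc_real gtr0_norm //; lra.
have key (e : K) : 0 < e -> exists2 s : K, 0 < s <= rho / 8 &
    forall x, eball c (rho / 8) x -> normc ((D s x : C) - dmx F x j k) <= e.
  move=> e0; pose s := Num.min (rho / 8) (e / 2 / (128 * M / rho ^+ 2)).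
  have c0 : 0 < 128 * M / rho ^+ 2 by rewrite divr_gt0 ?mulr_gt0 ?exprn_gt0.
  have s0 : 0 < s by rewrite lt_min !divr_gt0 ?mulr_gt0 ?exprn_gt0 ?invr_gt0.
  have s1 : s <= rho / 8 by rewrite ge_min lexx.
  have s2 : 128 * M / rho ^+ 2 * s <= e / 2.
    by rewrite mulrC -ler_pdivlMr // ge_min lexx orbT.
  exists s; first by rewrite s0.
  move=> x xc; have xr : eball c rho x by apply: lt_le_trans xc _; lra.
  have e2 : 0 < e / 2 by rewrite divr_gt0.
  have [d' d'0 Hx] := diff_enorm_expansion (dF' x xr) e2.
  (* This second step may depend on [x]: it links [D s] to the derivative at [x] and disappears from
     the estimate. *)
  pose t := Num.min s (d' / 2).
  have t0 : 0 < t by rewrite lt_min s0 divr_gt0.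
  have ts : t <= s by rewrite ge_min lexx.
  have td : t <= d' / 2 by rewrite ge_min lexx orbT.
  have H1 : normc ((D s x : C) - D t x) <= e / 2.
    apply: le_trans s2; pose L1 : V -> C^o := fun=> 1.
    have L1n (w : V) : L1 w != 0 by exact: oner_neq0.
    have sn (q : K) : 0 < q -> q%:C != 0 :> C by move=> q0; rewrite eq_complex /= gt_eqF.
    have nq (q : K) : 0 < q -> q <= rho / 8 -> normc (q%:C) <= rho / 8.
      by move=> q0; rewrite normc_real gtr0_norm.
    have dL1 (w : V) : differentiable L1 w by exact: differentiable_cst.
    have dFk (w : V) : eball c rho w -> L1 w != 0 -> differentiable (fun y => F y ord0 k : C^o) w.
      by move=> /dF' dFx _; exact: differentiable_rV_coord.
    have bFk (w : V) : eball c rho w -> L1 w != 0 -> normc (F w ord0 k) <= M by move=> xx _; exact: bF.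
    apply: le_trans (ball_second_difference rho0 dL1 dFk bFk xc v1 (L1n _)
      (nq _ s0 s1) (nq _ t0 (le_trans ts s1)) (sn _ s0) (sn _ t0) (L1n _) (L1n _)) _.
    have -> : s%:C - t%:C = (s - t)%:C :> C by rewrite rmorphB.
    rewrite ler_pM2l // normc_real ger0_norm ?subr_ge0 //; lra.
  have H2 : normc ((D t x : C) - dmx F x j k) <= e / 2.
    have := Hx (x + t%:C *: v); rewrite addrAC subrr add0r enormZ v1 mulr1 normc_real gtr0_norm //.
    move=> /(_ (ltac:(lra))) => h.
    have {}h : normc (F (x + t%:C *: v) ord0 k - F x ord0 k - t%:C * dmx F x j k) <= e / 2 * t.
      by have := le_trans (coord_le_enorm _ k) h; rewrite -scalemxAl -rowE !mxE.
    have tn : t%:C != 0 :> C by rewrite eq_complex /= gt_eqF.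
    have -> : (D t x : C) - dmx F x j k =
      (F (x + t%:C *: v) ord0 k - F x ord0 k - t%:C * dmx F x j k) / t%:C.
      by rewrite /D; field.
    by rewrite normcf normc_real gtr0_norm // ler_pdivrMr.
  have -> : (D s x : C) - dmx F x j k = ((D s x : C) - D t x) + ((D t x : C) - dmx F x j k) by ring.
  by apply: le_trans (le_normcD _ _) _; lra.
split.
  have [s /andP[s0 sr] Hs] := key 1 ltr01; exists (2 * M / s + 1) => x xc.
  have xr : eball c rho x by apply: lt_le_trans xc _; lra.
  have := normc_sub_le (dmx F x j k) (D s x); rewrite normcB.
  have : normc (D s x) <= 2 * M / s.
    rewrite /D normcf normc_real gtr0_norm // ler_pM2r ?invr_gt0 //.
    apply: le_trans (le_normcB _ _) _.
    by have := bF _ k (inb _ _ s0 sr xc); have := bF _ k xr; lra.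
  by have := Hs x xc; lra.
move=> e e0; have [s /andP[s0 sr] Hs] := key e e0; exists (D s) => x xc.
have xr : eball c rho x by apply: lt_le_trans xc _; lra.
split; last exact: Hs.
apply: differentiableM; last exact: differentiable_cst.
apply: differentiableB; last by apply: differentiable_rV_coord; exact: dF'.
apply: (@differentiable_comp _ _ _ _ (fun x : V => x + s%:C *: v : V) (fun y => F y ord0 k : C^o)).
  by apply: differentiableD => //; exact: differentiable_cst.
by apply: differentiable_rV_coord; apply: dF'; exact: inb.
Qed.

Lemma approximable_jacobian (F : V -> V) (c : V) (r : K) : 0 < r ->
  (forall x : V, eball c r x -> differentiable F x) ->
  exists2 r1 : K, 0 < r1 <= r & approximable (eball c r1) (fun x => \det (dmx F x)).
Proof.
move=> r0 /(approximable_dmx r0)[r1 r10 H]; exists r1 => //; exact: approximable_det.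
Qed.

End approximable.

(** * Injective holomorphic maps *)

Section local_inverse.
Context {K : realType} {n : nat}.
Local Notation C := K[i].
Local Notation V := ('rV[C]_n : normedModType C).
Implicit Types (F : V -> V).

(** Quantitative injectivity. It is what makes the derivative invertible, the image open and the
    inverse Lipschitz. *)
Definition expanding F (a : V) (r c : K) := forall x y : V, eball a r x -> eball a r y ->
  c * enorm (x - y) <= enorm (F x - F y).

Lemma singular_row m (A : 'M[C]_m) : A \notin unitmx -> exists2 v : 'rV[C]_m, v != 0 & v *m A = 0.
Proof.
rewrite -row_free_unit -kermx_eq0 => kA; exists (nz_row (kermx A)); first by rewrite nz_row_eq0.
by apply/sub_kermxP; exact: nz_row_sub.
Qed.

Lemma expanding_dmx_unit F (a x : V) (r c : K) : 0 < c -> expanding F a r c -> eball a r x ->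
  differentiable F x -> dmx F x \in unitmx.
Proof.
move=> c0 eF xa dF; case: (boolP (dmx F x \in unitmx)) => // nu; exfalso.
have [v v0 vA] := singular_row nu.
have v1 : 0 < enorm v by rewrite enorm_gt0.
have [d d0 H] := diff_enorm_expansion dF (divr_gt0 c0 (ltr0n _ 2)).
have [d' d'0 Hd'] := eball_nbhs xa.
pose t := Num.min d d' / (2 * enorm v).
have m0 : 0 < Num.min d d' by rewrite lt_min d0.
have t0 : 0 < t by rewrite divr_gt0 // mulr_gt0.
have Ed : enorm (t%:C *: v) = Num.min d d' / 2.
  by rewrite enormZ normc_real gtr0_norm // /t; field; exact: lt0r_neq0.
have E : x + t%:C *: v - x = t%:C *: v by rewrite addrAC subrr add0r.
have td : enorm (x + t%:C *: v - x) < Num.min d d' by rewrite E Ed; lra.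
move: (td); rewrite lt_min => /andP[/H h /Hd' xt].
move: h; rewrite E -scalemxAl vA scaler0 subr0 => h.
have := eF _ _ xt xa; rewrite E => h'.
have p : 0 < enorm (t%:C *: v) by rewrite Ed divr_gt0.
by have := mulr_gt0 c0 p; lra.
Qed.

(** The map [phi = F B - id] has derivative zero at [a], hence oscillates by at most [e * rho] on a
    small ball. For holomorphic maps such a sup bound is already a Lipschitz bound, by
    [ball_lipschitz], so information at the single point [a] suffices. The choice of [e] makes the
    Lipschitz constant 1/2 after summing over the coordinates. *)
Lemma local_expansion F (a : V) (r : K) : 0 < r ->
  (forall x : V, eball a r x -> differentiable F x) -> dmx F a \in unitmx ->
  exists2 c : K, 0 < c & exists2 e : K, 0 < e <= r & expanding F a e c.
Proof.
move=> r0 dF uA; pose B := invmx (dmx F a).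
have B0 := mx_bound_gt0 B.
pose phi : V -> V := fun x => F x *m B - x.
have dphi (x : V) : eball a r x -> differentiable phi x.
  move=> xa; apply: differentiableB => //.
  apply: (@differentiable_comp _ _ _ _ F (mulmxr B : V -> V)); first exact: dF.
  by apply: linear_differentiable; exact: continuous_mulmxr.
have N0 : 0 < (n.+1%:R : K) by rewrite ltr0n.
pose e := (16 * n.+1%:R)^-1 : K.
have e0 : 0 < e by rewrite invr_gt0 mulr_gt0.
have [d d0 Hd] := diff_enorm_expansion (dF _ (eball_center a r0)) (divr_gt0 e0 B0).
pose rho := Num.min r d.
have rho0 : 0 < rho by rewrite lt_min r0.
have rr : rho <= r by rewrite ge_min lexx.
have rd : rho <= d by rewrite ge_min lexx orbT.
have phiB (x : V) : eball a rho x -> enorm (phi x - phi a) <= e * rho.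
  move=> xa; have -> : phi x - phi a = (F x - F a - (x - a) *m dmx F a) *m B.
    by rewrite !mulmxBl !mulmxK // /phi !opprD !opprK addrACA.
  apply: le_trans (enorm_mulmx _ _) _.
  have := Hd x (lt_le_trans xa rd); rewrite mulrAC ler_pdivlMr // mulrC => h.
  by apply: le_trans h _; rewrite ler_pM2l // ltW.
exists (2 * mx_bound B)^-1; first by rewrite invr_gt0 mulr_gt0.
exists (rho / 8); first by apply/andP; split; lra.
move=> x y xa ya.
have L (k : 'I_n) : normc ((phi x - phi y) ord0 k) <= 8 * e * enorm (x - y).
  pose f : V -> C^o := fun x => (phi x ord0 k : C) - phi a ord0 k.
  pose L1 : V -> C^o := fun=> 1.
  have L1n (w : V) : L1 w != 0 by exact: oner_neq0.
  have dL1 (w : V) : differentiable L1 w by exact: differentiable_cst.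
  have df (w : V) : eball a rho w -> L1 w != 0 -> differentiable f w.
    move=> wa _; apply: differentiableB; last exact: differentiable_cst.
    by apply: differentiable_rV_coord; apply: dphi; exact: lt_le_trans rr.
  have bf (w : V) : eball a rho w -> L1 w != 0 -> normc (f w) <= e * rho.
    move=> /phiB h _; apply: le_trans h.
    have -> : f w = (phi w - phi a) ord0 k by rewrite /f !mxE.
    exact: coord_le_enorm.
  have := ball_lipschitz rho0 dL1 df bf ya xa (L1n _) (L1n _).
  have -> : (f x : C) - f y = (phi x - phi y) ord0 k by rewrite /f !mxE; ring.
  by have -> : 8 * (e * rho) / rho = 8 * e by field; exact: lt0r_neq0.
have half : enorm (phi x - phi y) <= enorm (x - y) / 2.
  apply: le_trans (enorm_le_sum _) _.
  apply: (@le_trans _ _ (\sum_(j < n) 8 * e * enorm (x - y))); first by apply: ler_sum.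
  have -> : \sum_(j < n) 8 * e * enorm (x - y) = n%:R * (8 * e * enorm (x - y)).
    by rewrite sumr_const card_ord [RHS]mulr_natl.
  have -> : n%:R * (8 * e * enorm (x - y)) = enorm (x - y) / 2 * (n%:R / n.+1%:R).
    by rewrite /e; field; rewrite gt_eqF.
  by apply: ler_piMr; [rewrite divr_ge0 ?enorm_ge0|rewrite ler_pdivrMr // mul1r ler_nat].
have E : (F x - F y) *m B = (phi x - phi y) + (x - y).
  by rewrite /phi mulmxBl opprD opprK [_ - x + _]addrACA [- x + y]addrC -(opprB x y) subrK.
have h2 := enorm_mulmx B (F x - F y); rewrite E in h2.
have h1 := enorm_sub_le (x - y) (- (phi x - phi y)).
rewrite opprK enormN [x - y + _]addrC in h1.
have h3 := le_trans h1 h2; rewrite ler_pdivrMl ?mulr_gt0 //.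
by rewrite -mulrA; move: (mx_bound B * _) h3 half => q; lra.
Qed.

(** Minimize the distance from [F x] to [y] over a closed ball. Expansion keeps the minimum off the
    boundary, and at an interior point with [F x != y] a short Newton step decreases the
    distance. *)
Lemma expanding_open F (a : V) (r c : K) : 0 < c -> expanding F a r c ->
  (forall x : V, eball a r x -> differentiable F x) ->
  forall e : K, 0 < e -> e < r -> forall y, enorm (y - F a) < c * e / 2 ->
  exists2 x : V, eball a e x & F x = y.
Proof.
move=> c0 eF dF e e0 er y ya.
have inr (x : V) : enorm (x - a) <= e -> eball a r x by move=> h; exact: le_lt_trans er.
have cf : {within [set x : V | enorm (x - a) <= e], continuous (fun x => enorm (F x - y) : K)}.
  apply: continuous_in_subspaceT => x; rewrite inE /= => /inr/dF dFx.
  apply: (@continuous_enorm _ _ V (fun x => F x - y)).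
  by apply: differentiable_continuous; apply: differentiableB => //; exact: differentiable_cst.
have ne : [set x : V | enorm (x - a) <= e] !=set0 by exists a; rewrite /= subrr enorm0 ltW.
have [x] := compact_EVT_min ne (@compact_eball _ _ a e) cf.
rewrite inE /= => xa Hx.
have aa : eball a r a by apply: inr; rewrite subrr enorm0 ltW.
have xa' : enorm (x - a) < e.
  rewrite lt_neqAle xa andbT; apply/eqP => E.
  have := eF _ _ (inr _ xa) aa; rewrite E.
  have := Hx a; rewrite inE /= subrr enorm0 (ltW e0) => /(_ isT).
  have := ler_enorm_dist y (F x) (F a); rewrite [enorm (F a - y)]enormBC; lra.
exists x => //; apply/eqP; rewrite -subr_eq0 -enorm_eq0 eq_le enorm_ge0 andbT leNgt.
apply/negP => g0; set g := enorm (F x - y) in g0.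
have uA := expanding_dmx_unit c0 eF (inr _ xa) (dF _ (inr _ xa)).
pose v : V := (y - F x) *m invmx (dmx F x).
have vA : v *m dmx F x = y - F x by rewrite mulmxKV.
have N0 : 0 < enorm v + 1 by rewrite ltr_wpDl ?enorm_ge0.
have [d d0 Hd] := diff_enorm_expansion (dF _ (inr _ xa)) (divr_gt0 g0 (mulr_gt0 (ltr0n _ 2) N0)).
have ea0 : 0 < e - enorm (x - a) by rewrite subr_gt0.
(* The step length is at most 1, small enough for the linear expansion at [x], and small enough to
   stay in the ball. The linear part lowers the distance by [t * g], and the error is at most half
   of that. *)
pose t := Num.min 1 (Num.min (d / (2 * (enorm v + 1))) ((e - enorm (x - a)) / (enorm v + 1))).
have t0 : 0 < t by rewrite !lt_min ltr01 !divr_gt0 // mulr_gt0.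
have t1 : t <= 1 by rewrite ge_min lexx.
have t2 : t * (2 * (enorm v + 1)) <= d.
  by rewrite -ler_pdivlMr ?mulr_gt0 // !ge_min lexx orbT.
have t3 : t * (enorm v + 1) <= e - enorm (x - a).
  by rewrite -ler_pdivlMr // !ge_min lexx !orbT.
have v0 := enorm_ge0 v.
have E : x + t%:C *: v - x = t%:C *: v by rewrite addrAC subrr add0r.
have nt : enorm (t%:C *: v) = t * enorm v by rewrite enormZ normc_real gtr0_norm.
have xte : enorm (x + t%:C *: v - a) <= e.
  by have := ler_enorm_dist x (x + t%:C *: v) a; rewrite E nt; nra.
have := Hx (x + t%:C *: v); rewrite inE => /(_ xte); rewrite -/g.
have := Hd (x + t%:C *: v); rewrite E nt => /(_ (ltac:(nra))).
rewrite -scalemxAl vA => h; apply/negP; rewrite -ltNge.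
have -> : F (x + t%:C *: v) - y =
  (F (x + t%:C *: v) - F x - t%:C *: (y - F x)) + (1 - t)%:C *: (F x - y).
  rewrite rmorphB scalerBl scale1r -[y - F x]opprB scalerN opprK.
  by rewrite -addrA [t%:C *: _ + _]addrC subrK addrA subrK.
apply: le_lt_trans (ler_enormD _ _) _.
rewrite enormZ normc_real ger0_norm ?subr_ge0 // -/g.
have : g / (2 * (enorm v + 1)) * (t * enorm v) <= g * t / 2.
  have -> : g / (2 * (enorm v + 1)) * (t * enorm v) = g * t / 2 * (enorm v / (enorm v + 1)).
    by field; exact: lt0r_neq0.
  by apply: ler_piMr; [rewrite !mulr_ge0 ?ltW|rewrite ler_pdivrMr // mul1r lerDl].
have := mulr_gt0 g0 t0; lra.
Qed.

End local_inverse.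

(** * Injective maps have an invertible derivative somewhere *)

Section constant_rank.
Context {K : realType}.
Local Notation C := K[i].

Lemma enorm_dist_dist n (x y z : 'rV[C]_n) :
  `|enorm (x - z) - enorm (y - z)| <= enorm (x - y).
Proof.
have h1 := ler_enorm_dist y x z; have h2 := ler_enorm_dist x y z.
rewrite [enorm (y - x)]enormBC in h2.
by rewrite ler_norml; apply/andP; split; lra.
Qed.

(** Clamping the argument to [[a, b]] turns the one-sided derivatives at the ends into two-sided
    ones, and the mean value theorem applies to the extended function. *)
Lemma zero_derivative_const (phi : K -> K) (a b : K) : a <= b ->
  (forall t, a <= t <= b -> forall e : K, 0 < e -> exists2 d : K, 0 < d &
     forall s, a <= s <= b -> `|s - t| < d -> `|phi s - phi t| <= e * `|s - t|) ->
  phi b = phi a.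
Proof.
move=> ab H; pose psi (t : K) := phi (Num.max a (Num.min b t)).
pose pr (t : K) := Num.max a (Num.min b t).
have prin t : a <= pr t <= b.
  by rewrite /pr le_max lexx /= ge_max ab ge_min lexx.
have prE t : a <= t <= b -> pr t = t.
  by move=> /andP[at_ tb]; rewrite /pr (min_r tb) (max_r at_).
have lmax (c u v : K) : `|Num.max c u - Num.max c v| <= `|u - v|.
  have h1 := ler_norm (u - v); have h2 := ler_norm (v - u); rewrite distrC in h2.
  by case: (leP c u) => cu; case: (leP c v) => cv; rewrite ler_norml; apply/andP; split; lra.
have lmin (c u v : K) : `|Num.min c u - Num.min c v| <= `|u - v|.
  have h1 := ler_norm (u - v); have h2 := ler_norm (v - u); rewrite distrC in h2.
  by case: (leP c u) => cu; case: (leP c v) => cv; rewrite ler_norml; apply/andP; split; lra.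
have prlip s t : `|pr s - pr t| <= `|s - t| by apply: le_trans (lmax _ _ _) (lmin _ _ _).
have dpsi t : a <= t <= b -> is_derive t 1 psi 0.
  move=> tab; have cv : (fun h => h^-1 *: ((psi \o shift t) (h *: (1 : K)) - psi t)) @ 0^' --> (0 : K).
    apply/cvgrPdist_le => e e0; have [d d0 Hd] := H _ tab e e0.
    rewrite near_withinE; apply/nbhs_normP; exists d => // h /=; rewrite sub0r normrN => hd h0.
    rewrite sub0r normrN /GRing.scale /= mulr1 normrM normfV ler_pdivrMl ?normr_gt0 //.
    have E : `|pr (h + t) - t| <= `|h| by have := prlip (h + t) t; rewrite (prE t tab) addrK.
    have := Hd _ (prin (h + t)) (le_lt_trans E hd).
    rewrite /psi -!/(pr _) (prE t tab) => h2; apply: le_trans h2 _.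
    by rewrite mulrC ler_wpM2r // ltW.
  split; first by apply/cvg_ex; exists 0.
  exact/cvg_lim.
have cpsi : {within `[a, b], continuous psi}.
  apply: continuous_in_subspaceT => t; rewrite inE /= in_itv /= => tab.
  apply: differentiable_continuous; apply/derivable1_diffP.
  by have := dpsi t tab => ?; apply: ex_derive.
have [c _] := MVT_segment ab (fun t tab => dpsi t (ltac:(move: tab; rewrite in_itv /= => /andP[t1 t2]; rewrite !ltW //))) cpsi.
by rewrite mul0r /psi -!/(pr _) !prE ?lexx ?ab // => /eqP; rewrite subr_eq0 => /eqP.
Qed.

Context {n : nat}.
Local Notation V := ('rV[C]_n : normedModType C).

(* If the maximal rank of the Jacobian were [k < n], attained at [x1], then
   straightening [F] near [x1] by [Phi] would exhibit a curve on which [F] is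
   constant. *)
Lemma jacobian_neq0_somewhere (F : V -> V) (a : V) (r : K) : 0 < r ->
  (forall x : V, eball a r x -> differentiable F x) -> set_inj (eball a r) F ->
  exists2 x : V, eball a r x & dmx F x \in unitmx.
Proof.
move=> r0 dF iF.
pose P k := `[< exists2 x : V, eball a r x & \rank (dmx F x) = k >].
have exP : exists k, P k by exists (\rank (dmx F a)); apply/asboolP; exists a => //; exact: eball_center.
have bP k : P k -> (k <= n)%N by move=> /asboolP[x _ <-]; exact: rank_leq_row.
case: (ex_maxnP exP bP) => k /asboolP[x1 x1a rk] kmax.
have rle (x : V) : eball a r x -> (\rank (dmx F x) <= k)%N.
  by move=> xa; apply: kmax; apply/asboolP; exists x.
have := bP k; rewrite leq_eqVlt => /(_ _)/orP[].
- by apply/asboolP; exists x1.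
- move=> /eqP kn; exists x1 => //.
  by rewrite -row_full_unit /row_full rk kn.
move=> kn; exfalso.
pose A := dmx F x1; pose L := col_ebase A; pose U := row_ebase A.
have EA : L *m pid_mx k *m U = A by rewrite -rk; exact: mulmx_ebase.
have uL : L \in unitmx by exact: col_ebase_unit.
have uU : U \in unitmx by exact: row_ebase_unit.
(* [Q] retains [k] coordinates in which [F] has full rank at [x1], and [P'] fills up with the
   complementary coordinates of [x]; the derivative of [Phi] at [x1] is then the invertible matrix
   [L]. *)
pose Q : 'M[C]_n := invmx U *m pid_mx k.
pose P' : 'M[C]_n := L *m copid_mx k.
pose Phi : V -> V := fun x => F x *m Q + x *m P'.
have kn' : (k <= n)%N by exact: ltnW.
have pidpid : (pid_mx k : 'M[C]_n) *m (pid_mx k : 'M[C]_n) = pid_mx k by apply: pid_mx_id.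
have copid0 : (copid_mx k : 'M[C]_n) *m (pid_mx k : 'M[C]_n) = 0 by apply: mul_copid_mx_pid.
have [d0 d00 Hd0] := eball_nbhs x1a.
have dPhi (x : V) : eball a r x -> differentiable Phi x /\ dmx Phi x = dmx F x *m Q + P'.
  move=> xa; apply: differentiable_of_expansion => e e0.
  have [d d0' Hd] := diff_enorm_expansion (dF x xa) (divr_gt0 e0 (mx_bound_gt0 Q)).
  exists d => // y /Hd h.
  have -> : Phi y - Phi x - (y - x) *m (dmx F x *m Q + P') = (F y - F x - (y - x) *m dmx F x) *m Q.
    have zz (p q s t u : 'rV[C]_n) : p + q - (s + t) - (u + (q - t)) = p - s - u.
      by rewrite [- (s + t)]opprD addrACA opprD [- u - _]addrC [LHS]addrA addrK.
    have e1 : (y - x) *m (dmx F x *m Q + P') = (y - x) *m dmx F x *m Q + (y *m P' - x *m P').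
      by rewrite mulmxDr mulmxA (mulmxBl y x P').
    have e2 : (F y - F x - (y - x) *m dmx F x) *m Q = F y *m Q - F x *m Q - (y - x) *m dmx F x *m Q.
      by rewrite (mulmxBl _ _ Q) (mulmxBl (F y)).
    by rewrite e1 e2; exact: zz.
  apply: le_trans (enorm_mulmx _ _) _; apply: le_trans (ler_wpM2l (ltW (mx_bound_gt0 Q)) h) _.
  by rewrite mulrA [mx_bound Q * _]mulrC divfK // gt_eqF // mx_bound_gt0.
have dPhi1 : dmx Phi x1 = L.
  have [_ ->] := dPhi _ x1a; rewrite -/A -EA /Q /P' -!mulmxA mulKVmx //.
  by rewrite pidpid -mulmxDr /copid_mx addrC subrK mulmx1.
have uPhi : dmx Phi x1 \in unitmx by rewrite dPhi1.
have dPhi0 (x : V) : eball x1 d0 x -> differentiable Phi x by move=> /Hd0/dPhi[].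
have [c c0 [e /andP[e0 ed] eP]] := local_expansion d00 dPhi0 uPhi.
have dPhie (x : V) : eball x1 e x -> differentiable Phi x by move=> xe; apply: dPhi0; exact: lt_le_trans ed.
have inr (x : V) : eball x1 e x -> eball a r x by move=> xe; apply: Hd0; exact: lt_le_trans ed.
have uM (x : V) : eball x1 e x -> dmx F x *m Q + P' \in unitmx.
  move=> xe; have [dP <-] := dPhi _ (inr _ xe).
  exact: expanding_dmx_unit c0 eP xe dP.
pose v : V := delta_mx ord0 (Ordinal kn).
have v0 : v != 0.
  by rewrite -enorm_eq0 enorm_delta oner_eq0.
have vpid : v *m (pid_mx k : 'M[C]_n) = 0.
  by rewrite /v -rowE; apply/rowP => j; rewrite !mxE ltnn andbF.
(* Since [v] is killed by [pid_mx k], the product is zero after a further factor [Q]. By maximality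
   of [k] the rank of [dmx F x] is not lowered by [Q], so [Q] is injective on its row space and can
   be cancelled. *)
have kill (x : V) : eball x1 e x -> v *m invmx (dmx F x *m Q + P') *m dmx F x = 0.
  move=> xe; have uMx := uM _ xe; set M := _ + _ in uMx *; set Ax := dmx F x.
  have MQ : M *m (pid_mx k : 'M[C]_n) = Ax *m Q by rewrite mulmxDl -!mulmxA pidpid copid0 mulmx0 addr0.
  have w0 : v *m invmx M *m Ax *m Q = 0.
    by rewrite -!mulmxA -MQ mulKmx.
  have rQ : (k <= \rank (Ax *m Q))%N.
    have E : invmx M *m (Ax *m Q) = pid_mx k by rewrite -MQ mulKmx.
    by rewrite -[k in (k <= _)%N](@rank_pid_mx C n n k) // -E mxrankM_maxr.
  have := mxrank_mul_ker Ax Q; have := rle _ (inr _ xe); rewrite -/Ax => r1 r2.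
  have /eqP : \rank (Ax :&: kermx Q)%MS = 0%N
    by apply/eqP; rewrite -leqn0 -(leq_add2l (\rank (Ax *m Q))) r2 addn0; exact: leq_trans r1 rQ.
  rewrite mxrank_eq0 => /eqP c0'; apply/eqP; rewrite -submx0 -c0' sub_capmx.
  by rewrite submxMl /=; apply/sub_kermxP.
pose T := e / 2; have T0 : 0 < T by rewrite divr_gt0.
have T1 : T < e by rewrite /T; lra.
pose tau := c * T / 4; have tau0 : 0 < tau by rewrite divr_gt0 // mulr_gt0.
have v1 : enorm v = 1 by exact: enorm_delta.
(* The curve [X] lifts through [Phi] the segment starting at [Phi x1] in the direction [v]; by
   [kill] the map [F] has derivative zero along it. Outside the range of [t] any value serves
   [choice]. *)
have ex t : exists x : V, `|t| <= tau -> eball x1 T x /\ Phi x = Phi x1 + t%:C *: v.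
  case: (leP `|t| tau) => ht; last by exists x1.
  have [|x xT xE] := expanding_open c0 eP dPhie T0 T1 (y := Phi x1 + t%:C *: v).
    rewrite addrAC subrr add0r enormZ normc_real v1 mulr1; apply: le_lt_trans ht _.
    by rewrite /tau; have := mulr_gt0 c0 T0; lra.
  by exists x.
have [X HX] := choice ex.
have FX : enorm (F (X tau) - F (X 0)) = enorm (F (X 0) - F (X 0)).
  apply: (@zero_derivative_const (fun t => enorm (F (X t) - F (X 0))) 0 tau (ltW tau0)).
  move=> t /andP[t0 tt] ep ep0.
  have nt s : 0 <= s -> s <= tau -> `|s| <= tau by move=> s0 st; rewrite ger0_norm.
  have [XtT XtE] := HX t (nt _ t0 tt).
  have Xte : eball x1 e (X t) by exact: lt_trans T1.
  have [dPt dPtE] := dPhi _ (inr _ Xte).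
  set M := dmx F (X t) *m Q + P' in dPtE.
  pose W := invmx M *m dmx F (X t).
  pose g := ep * c / (mx_bound W + 1).
  have W0 := mx_bound_gt0 W.
  have g0 : 0 < g by rewrite divr_gt0 ?mulr_gt0 // addr_gt0.
  have [d1 d10 H1] := diff_enorm_expansion dPt g0.
  have [d2 d20 H2] := diff_enorm_expansion (dF _ (inr _ Xte)) g0.
  exists (c * Num.min d1 d2); first by rewrite mulr_gt0 // lt_min d10.
  move=> s /andP[s0 st] sd.
  have [XsT XsE] := HX s (nt _ s0 st).
  have Xse : eball x1 e (X s) by exact: lt_trans T1.
  have PE : Phi (X s) - Phi (X t) = (s - t)%:C *: v.
    by rewrite XsE XtE opprD addrACA subrr add0r rmorphB scalerBl.
  have lip : c * enorm (X s - X t) <= `|s - t|.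
    by apply: le_trans (eP _ _ Xse Xte) _; rewrite PE enormZ normc_real v1 mulr1.
  have : enorm (X s - X t) < Num.min d1 d2.
    by rewrite -(ltr_pM2l c0); exact: le_lt_trans sd.
  rewrite lt_min => /andP[/H1 h1 /H2 h2].
  have uMt : M \in unitmx by exact: uM.
  have E : (X s - X t) *m dmx F (X t) = - ((Phi (X s) - Phi (X t) - (X s - X t) *m dmx Phi (X t)) *m W).
    rewrite PE dPtE; move: (X s - X t : 'rV[C]_n) => D.
    have a1 : ((s - t)%:C *: v : 'rV[C]_n) *m W = 0 by rewrite -scalemxAl /W mulmxA kill // scaler0.
    have a2 : D *m M *m W = D *m dmx F (X t) by rewrite /W mulmxA mulmxK.
    by rewrite (mulmxBl ((s - t)%:C *: v : 'rV[C]_n) (D *m M) W) a1 a2 sub0r opprK.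
  have h3 : enorm ((X s - X t) *m dmx F (X t)) <= mx_bound W * (g * enorm (X s - X t)).
    rewrite E enormN; apply: (le_trans (enorm_mulmx W _)).
    by apply: ler_wpM2l; [exact: ltW|exact: h1].
  have h4 : enorm (F (X s) - F (X t)) <= (mx_bound W + 1) * (g * enorm (X s - X t)).
    rewrite -[F (X s) - F (X t)](subrK ((X s - X t) *m dmx F (X t))).
    by apply: le_trans (ler_enormD _ _) _; rewrite mulrDl mul1r [leRHS]addrC lerD.
  have h5 : (mx_bound W + 1) * (g * enorm (X s - X t)) = ep * (c * enorm (X s - X t)).
    by rewrite /g; field; rewrite gt_eqF // addr_gt0.
  rewrite h5 in h4; have h6 : ep * (c * enorm (X s - X t)) <= ep * `|s - t| by rewrite ler_pM2l.
  apply: le_trans h6; apply: le_trans h4.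
  exact: enorm_dist_dist.
move: FX; rewrite subrr enorm0 => /eqP; rewrite enorm_eq0 subr_eq0 => /eqP FX.
have nt : `|tau| <= tau by rewrite ger0_norm // ltW.
have n0 : `|0 : K| <= tau by rewrite normr0 ltW.
have [Xt1 Xt2] := HX tau nt; have [X01 X02] := HX 0 n0.
(* [F] takes equal values at both ends of the curve, so injectivity closes it, whereas [Phi]
   separates its ends by [tau * v]. *)
have XX : X tau = X 0.
  by apply: iF FX; rewrite inE; apply: inr; exact: lt_trans T1.
move: Xt2; rewrite XX X02 => /eqP; rewrite scale0r addr0 -subr_eq0 opprD addrA subrr add0r oppr_eq0.
rewrite scaler_eq0 (negbTE v0) orbF eq_complex /= eqxx andbT; apply/negP.
by rewrite gt_eqF.
Qed.

End constant_rank.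

Lemma approx_lipschitz (R : realFieldType) (B e w N N' X M : R) : 0 <= B ->
  e = (2 + 2 * B) * w -> N <= w + (N' + w) -> N' <= B * M -> M <= w + (X + w) -> N <= B * X + e.
Proof.
move=> B0 -> NN NM /(ler_wpM2l B0) MX.
by have := le_trans NM MX; lra.
Qed.

(** * Openness of injective holomorphic maps and invertibility of their Jacobians *)

Section open_mapping.
Context {K : realType} {n : nat}.
Local Notation C := K[i].
Local Notation V := ('rV[C]_n : normedModType C).
Implicit Types (F G : V -> V).

Lemma holo_limit_near_eq (f g : C^o -> C^o) (a : C^o) :
  (\near a, f a = g a) -> holo_limit f a -> holo_limit g a.
Proof.
move=> fg [s s0 H]; have [s1 s10 H1] := (nbhsCP _ _).1 fg.
exists (Num.min s s1); first by rewrite lt_min s0.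
move=> e /H[h Hh]; exists h => z; rewrite lt_min => /andP[/Hh[dh zh] /H1 <-].
by split.
Qed.

(** [G] is only a left inverse on the ball. By [expanding_open] every point near [F a] is a value of
    [F] there, which makes [G] a two-sided inverse; expansion then transfers the linear expansion of
    [F] to [G]. *)
Lemma local_inverse_differentiable F G (a : V) (r : K) : 0 < r ->
  (forall x : V, eball a r x -> differentiable F x) ->
  (forall x : V, eball a r x -> G (F x) = x) -> dmx F a \in unitmx ->
  exists2 d : K, 0 < d & forall y : V, enorm (y - F a) < d ->
    [/\ eball a r (G y), F (G y) = y & differentiable G y].
Proof.
move=> r0 dF GF uA; have [c c0 [e /andP[e0 er] eF]] := local_expansion r0 dF uA.
have dFe (x : V) : eball a e x -> differentiable F x by move=> xe; apply: dF; exact: lt_le_trans er.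
have e2 : 0 < e / 2 by rewrite divr_gt0.
have e2e : e / 2 < e by lra.
have op y := expanding_open c0 eF dFe e2 e2e (y := y).
have Gin y : enorm (y - F a) < c * (e / 2) / 2 -> eball a (e / 2) (G y) /\ F (G y) = y.
  move=> /op[x xe <-]; rewrite GF //; apply: lt_le_trans xe _; lra.
exists (c * (e / 2) / 2); first by rewrite divr_gt0 // mulr_gt0.
move=> y ya; have [Gy1 Gy2] := Gin y ya.
have Gye : eball a e (G y) by exact: lt_trans Gy1 e2e.
have uG : dmx F (G y) \in unitmx by exact: expanding_dmx_unit c0 eF Gye (dFe _ Gye).
split => //; first exact: lt_le_trans Gye er.
suff : differentiable G y /\ dmx G y = invmx (dmx F (G y)) by case.
apply: differentiable_of_expansion => q q0.
set B := invmx _; have B0 := mx_bound_gt0 B.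
have [d d0 Hd] := diff_enorm_expansion (dFe _ Gye) (divr_gt0 (mulr_gt0 q0 c0) B0).
have ya' : 0 < c * (e / 2) / 2 - enorm (y - F a) by rewrite subr_gt0.
exists (Num.min (c * d) (c * (e / 2) / 2 - enorm (y - F a))).
  by rewrite lt_min ya' mulr_gt0.
move=> w; rewrite lt_min => /andP[w1 w2].
have wa : enorm (w - F a) < c * (e / 2) / 2 by have := ler_enorm_dist y w (F a); lra.
have [Gw1 Gw2] := Gin w wa; have Gwe : eball a e (G w) by exact: lt_trans Gw1 e2e.
have lip : c * enorm (G w - G y) <= enorm (w - y).
  by have := eF _ _ Gwe Gye; rewrite Gw2 Gy2.
have Gd : enorm (G w - G y) < d by rewrite -(ltr_pM2l c0); exact: le_lt_trans w1.
have := Hd _ Gd; rewrite Gw2 Gy2 => h.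
have E : G w - G y - (w - y) *m B = - ((w - y - (G w - G y) *m dmx F (G y)) *m B).
  move: (w - y : 'rV[C]_n) (G w - G y : 'rV[C]_n) => p s.
  have -> : (p - s *m dmx F (G y)) *m B = p *m B - s by rewrite (mulmxBl p) mulmxK.
  by rewrite opprB.
rewrite E enormN; apply: (le_trans (enorm_mulmx B _)).
apply: (le_trans (ler_wpM2l (ltW B0) h)).
have -> : mx_bound B * (q * c / mx_bound B * enorm (G w - G y)) = q * (c * enorm (G w - G y)).
  by field; exact: lt0r_neq0.
by rewrite ler_pM2l.
Qed.

Lemma holo_limit_jacobian_inverse F G (a : V) (r : K) (y : C^o -> V) (l : C^o) : 0 < r ->
  (forall x : V, eball a r x -> differentiable F x) ->
  (forall x : V, eball a r x -> G (F x) = x) -> dmx F a \in unitmx ->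
  y l = F a -> (\near l, differentiable y l) ->
  [/\ holo_limit (fun t => \det (dmx F (G (y t)))) l,
      \near l, differentiable (fun t => G (y t)) l &
      \near l, F (G (y l)) = y l].
Proof.
move=> r0 dF GF uA yl dy.
have [d d0 Hd] := local_inverse_differentiable r0 dF GF uA.
have cy : {for l, continuous y} by apply: differentiable_continuous; exact: nbhs_singleton dy.
have /continuous_enormP/(_ _ d0) := cy; rewrite yl => ny.
have dGy : \near l, differentiable (fun t => G (y t)) l.
  apply: filterS2 dy ny => t dyt /Hd[_ _ dG].
  exact: (differentiable_comp dyt dG).
split => //.
  have [r1 /andP[r10 r1r] ap] := approximable_jacobian r0 dF.
  apply: (holo_limit_approximable ap _ dGy).
  by rewrite yl (GF _ (eball_center a r0)); exact: eball_center.
by apply: filterS ny => t /Hd[].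
Qed.

Lemma compact_sphere_shell (a x0 : V) (r d : K) :
  compact [set x : V | enorm (x - a) <= r /\ d <= enorm (x - x0)].
Proof.
apply: (subclosed_compact _ (@compact_eball _ _ a r)); last by move=> x [].
move=> z clz; split.
  have cl : closed [set x : V | enorm (x - a) <= r] by exact: closed_enorm_le.
  by apply: cl; apply: closureS clz => w [].
apply/ler_addgt0Pr => e e0.
have [w [[_ wd] we]] : [set x : V | enorm (x - a) <= r /\ d <= enorm (x - x0)] `&`
    [set w : V | enorm (w - z) < e] !=set0.
  by apply: clz; apply/nbhs_enormP; exists e.
by have := ler_enorm_dist z w x0; move: we => /=; lra.
Qed.

Lemma compact_dist_gt0 (A : set V) F (y : V) : compact A ->
  (forall x, A x -> differentiable F x) -> (forall x, A x -> F x != y) ->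
  exists2 m : K, 0 < m & forall x, A x -> m <= enorm (F x - y).
Proof.
move=> cA dF Fy; have [A0|/set0P/negP/negPn/eqP A0] := pselect (A !=set0); last first.
  by exists 1 => // x; rewrite A0.
have cf : {within A, continuous (fun x => enorm (F x - y) : K)}.
  apply: continuous_in_subspaceT => x; rewrite inE => /dF dFx.
  apply: (@continuous_enorm _ _ V (fun x => F x - y)).
  by apply: differentiable_continuous; apply: differentiableB => //; exact: differentiable_cst.
have [x] := compact_EVT_min A0 cA cf; rewrite inE => xA Hx.
exists (enorm (F x - y)); first by rewrite enorm_gt0 subr_eq0 Fy.
by move=> w wA; apply: Hx; rewrite inE.
Qed.

Section push_forward.
Variables (F : V -> V) (a : V) (r rho : K).
Hypotheses (rho0 : 0 < rho) (rhor : rho < r).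
Hypothesis dF : forall x : V, eball a r x -> differentiable F x.
Hypothesis iF : set_inj (eball a r) F.

Let Kb := [set x : V | enorm (x - a) <= rho].
Let Kin (x : V) : Kb x -> eball a r x. Proof. by move=> h; exact: le_lt_trans rhor. Qed.
Let G (y : V) : V := xget a [set x | Kb x /\ F x = y].
Let h (x : V) : C^o := \det (dmx F x).

(* Off [F @` Kb] the function is extended by [0]; the point is that it stays
   continuous, since [F @` Kb] can only have boundary where [h] vanishes. *)
Definition pushed_jacobian (y : V) : C^o :=
  if `[< exists2 x : V, enorm (x - a) <= rho & F x = y >] then h (G y) else 0.

Let GF (x : V) : Kb x -> G (F x) = x.
Proof.
move=> xK; rewrite /G; case: xgetP => [z _ [zK zE]|/(_ x)]; last by case; split.
by apply: (iF _ _ zE); rewrite inE; exact: Kin.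
Qed.

Let ch (x : V) : eball a r x -> {for x, continuous h}.
Proof.
move=> xa; have [d d0 Hd] := eball_nbhs xa.
have [r1 /andP[r10 _] ap] := approximable_jacobian d0 (fun w we => dF (Hd w we)).
by apply: (continuous_approximable ap); exact: eball_center.
Qed.

Lemma pushed_jacobian_image (x : V) : Kb x -> pushed_jacobian (F x) = h x.
Proof.
move=> xK; rewrite /pushed_jacobian asboolT; last by exists x.
by rewrite GF.
Qed.

Variable m : K.
Hypothesis Hm : forall x : V, enorm (x - a) = rho -> m <= enorm (F x - F a).

(** Values within [m] of [F a] are not taken on the bounding sphere, so their preimages have room
    for a local inverse. *)
Let interior_of (x : V) : Kb x -> enorm (F x - F a) < m -> enorm (x - a) < rho.
Proof.
by move=> xK xm; rewrite lt_neqAle xK andbT; apply/eqP => /Hm; rewrite leNgt xm.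
Qed.

Let small_ball (x : V) : enorm (x - a) < rho ->
  exists2 d : K, 0 < d & forall w : V, eball x d w -> Kb w.
Proof.
move=> xr; have [d d0 Hd] := @eball_nbhs _ _ a rho x xr.
by exists d => // w /Hd /ltW.
Qed.

(** Off the compact image the function vanishes locally. At [y0 = F x0], image points near [y0] have
    preimages near [x0], by compactness of the shell around [x0]. Points outside the image carry the
    value 0: harmless if the Jacobian vanishes at [x0], and absent near [y0] otherwise, since then
    the image is a neighbourhood. *)
Lemma pushed_jacobian_continuous (y0 : V) : enorm (y0 - F a) < m ->
  {for y0, continuous pushed_jacobian}.
Proof.
move=> y0m; apply/continuous_CP => e e0; apply/nbhs_enormP.
have [[x0 x0K Fx0]|nK] := pselect (exists2 x : V, Kb x & F x = y0); last first.
  have [d d0 Hd] := @compact_dist_gt0 Kb F y0 (@compact_eball _ _ a rho)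
    (fun x xK => dF (Kin xK)) (fun x xK => introN eqP (fun E => nK (ex_intro2 _ _ x xK E))).
  have N (y : V) : enorm (y - y0) < d -> pushed_jacobian y = 0.
    move=> yd; rewrite /pushed_jacobian asboolF // => -[x xK xE].
    by have := Hd x xK; rewrite xE leNgt yd.
  by exists d => // y /N ->; rewrite N ?subrr ?enorm0 // normc0.
have x0r : enorm (x0 - a) < rho by apply: interior_of => //; rewrite Fx0.
have /continuous_CP/(_ e e0)/nbhs_enormP[d1 d10 H1] := ch (Kin x0K).
have xx0 (x : V) : Kb x -> F x = y0 -> x = x0.
  by move=> xK; rewrite -Fx0; exact: (iF (mem_set (Kin xK)) (mem_set (Kin x0K))).
have shell (x : V) : enorm (x - a) <= rho /\ d1 <= enorm (x - x0) -> F x != y0.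
  by case=> xK xd; apply/eqP => /(xx0 _ xK) E; move: xd; rewrite E subrr enorm0 leNgt d10.
have [d2 d20 H2] := @compact_dist_gt0 _ F y0 (@compact_sphere_shell a x0 rho d1)
  (fun x xK => dF (Kin xK.1)) shell.
have inK (y : V) : enorm (y - y0) < d2 -> (exists2 x : V, Kb x & F x = y) ->
    normc ((pushed_jacobian y : C) - pushed_jacobian y0) < e.
  move=> yd [x xK xE]; rewrite -xE -Fx0 !pushed_jacobian_image //; apply: H1.
  rewrite ltNge; apply/negP => xd; have := H2 x (conj xK xd).
  by rewrite xE leNgt yd.
case: (eqVneq (h x0) 0) => [hx0|hx0].
  exists d2 => // y yd; have [yK|nK] := pselect (exists2 x : V, Kb x & F x = y).
    exact: inK.
  by rewrite -Fx0 pushed_jacobian_image // hx0 subr0 /pushed_jacobian asboolF // normc0.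
have [d3 d30 H3] := small_ball x0r.
have ux : dmx F x0 \in unitmx by rewrite unitmxE unitfE.
have [d4 d40 H4] := local_inverse_differentiable d30 (fun x xd => dF (Kin (H3 x xd)))
   (fun x xd => GF (H3 x xd)) ux.
exists (Num.min d2 d4); first by rewrite lt_min d20.
move=> y; rewrite lt_min => /andP[y1]; rewrite -Fx0 => /H4[Gy FG _].
by rewrite Fx0; apply: inK => //; exists (G y) => //; exact: H3.
Qed.

Lemma pushed_jacobian_holo (y : C^o -> V) (l : C^o) : enorm (y l - F a) < m ->
  (\near l, differentiable y l) -> pushed_jacobian (y l) != 0 ->
  holo_limit (fun t => pushed_jacobian (y t)) l.
Proof.
move=> ym dy; have [[x0 x0K Fx0]|nK] := pselect (exists2 x : V, Kb x & F x = y l); last first.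
  by rewrite {1}/pushed_jacobian asboolF // eqxx.
rewrite -Fx0 pushed_jacobian_image // => hx0.
have x0r : enorm (x0 - a) < rho by apply: interior_of => //; rewrite Fx0.
have [d3 d30 H3] := small_ball x0r.
have ux : dmx F x0 \in unitmx by rewrite unitmxE unitfE.
have [d4 d40 H4] := local_inverse_differentiable d30 (fun x xd => dF (Kin (H3 x xd)))
   (fun x xd => GF (H3 x xd)) ux.
have [hl _ _] := holo_limit_jacobian_inverse d30 (fun x xd => dF (Kin (H3 x xd)))
   (fun x xd => GF (H3 x xd)) ux (esym Fx0) dy.
apply: holo_limit_near_eq hl.
have cy : {for l, continuous y} by apply: differentiable_continuous; exact: nbhs_singleton dy.
have /continuous_enormP/(_ _ d40) := cy.
apply: filterS => t; rewrite -{1}Fx0 => /H4[Gy FG _].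
by rewrite /pushed_jacobian asboolT //; exists (G (y t)) => //; exact: H3.
Qed.

(* On the line through a missed value [b] and a nearby value where it is nonzero,
   [pushed_jacobian] vanishes near [b], against [zero_near_closure_support]. *)
Lemma image_contains_ball : 0 < m -> forall b : V, enorm (b - F a) < m / 3 ->
  exists2 x : V, enorm (x - a) <= rho & F x = b.
Proof.
move=> m0 b bm; apply: contrapT => nK.
have [r1 r10 Hr1] := @compact_dist_gt0 Kb F b (@compact_eball _ _ a rho)
    (fun x xK => dF (Kin xK)) (fun x xK => introN eqP (fun E => nK (ex_intro2 _ _ x xK E))).
have aa : eball a r a by apply: eball_center; exact: lt_trans rhor.
(* With [b] within [m / 3] and [F x1] within [m / 12] of [F a], these two points are less than
   [m / 2] apart, and the disc of radius [2 m / 3] about [b] on their line stays within [m] of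
   [F a]. *)
have m12 : 0 < m / 12 by rewrite divr_gt0.
have /continuous_enormP/(_ _ m12)/nbhs_enormP[d d0 Hd] := differentiable_continuous (dF aa).
have md0 : 0 < Num.min d rho by rewrite lt_min d0.
have inr (x : V) : eball a (Num.min d rho) x -> eball a r x.
  by move=> xa; apply: lt_trans rhor; apply: lt_le_trans xa _; rewrite ge_min lexx orbT.
have [x1 x1d ux1] := @jacobian_neq0_somewhere _ _ F a _ md0 (fun x xd => dF (inr x xd))
  (fun x y xd yd => iF (mem_set (inr x (set_mem xd))) (mem_set (inr y (set_mem yd)))).
have [x1a x1rho] : enorm (x1 - a) < d /\ enorm (x1 - a) < rho.
  by move: x1d; rewrite /eball /= lt_min => /andP[].
have Fx1 := Hd _ x1a.
have x1b : 0 < enorm (F x1 - b) by apply: lt_le_trans r10 (Hr1 _ (ltW x1rho)).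
pose t := enorm (F x1 - b).
have tm : t < m / 2.
  by have := ler_enorm_dist (F a) (F x1) b; rewrite [enorm (F a - b)]enormBC /t; lra.
pose u : V := (t^-1)%:C *: (F x1 - b).
have u1 : enorm u = 1.
  by rewrite enormZ normc_real ger0_norm ?invr_ge0 ?(ltW x1b) // mulVf // gt_eqF.
pose y (l : C^o) : V := b + (l : C) *: u.
have yt : y t%:C = F x1.
  by rewrite /y /u scalerA -rmorphM /= mulfV ?gt_eqF // scale1r addrC subrK.
have yb l : enorm (y l - b) = normc (l : C) by rewrite /y addrAC subrr add0r enormZ u1 mulr1.
have ym (l : C^o) : normc (l : C) < m * 2 / 3 -> enorm (y l - F a) < m.
  by have := ler_enorm_dist b (y l) (F a); rewrite yb; lra.
have dy l : differentiable y l by exact: differentiable_line.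
have cL (l : C^o) : normc (l : C) < m * 2 / 3 -> {for l, continuous (fun l => pushed_jacobian (y l))}.
  move=> /ym lm; apply: (@continuous_comp _ _ _ y pushed_jacobian).
    exact: differentiable_continuous.
  exact: pushed_jacobian_continuous.
have hL (l : C^o) : normc (l : C) < m * 2 / 3 -> pushed_jacobian (y l) != 0 ->
    holo_limit (fun l => pushed_jacobian (y l)) l.
  move=> /ym lm; apply: pushed_jacobian_holo => //.
  by apply: (nbhsCP _ _).2; exists 1 => // w _; exact: dy.
have tt : normc (t%:C) < m / 2 by rewrite normc_real gtr0_norm.
have Lt : pushed_jacobian (y t%:C) != 0.
  rewrite yt pushed_jacobian_image; last exact: ltW.
  by move: ux1; rewrite unitmxE unitfE.
have m2 : 0 < m / 2 by rewrite divr_gt0.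
have m23 : m / 2 < m * 2 / 3 by lra.
have [l lr1] := zero_near_closure_support m2 m23 cL hL tt Lt r10.
rewrite /pushed_jacobian asboolF ?eqxx // => -[x xK xE].
by have := Hr1 x xK; rewrite xE yb leNgt lr1.
Qed.

Let image_ball_inv : 0 < m -> forall b : V, enorm (b - F a) < m / 3 -> Kb (G b) /\ F (G b) = b.
Proof. by move=> m0 b /(image_contains_ball m0)[x xK <-]; rewrite GF. Qed.

Let inverse_lipschitz_generic : 0 < m -> forall x1 x2 : V, Kb x1 -> Kb x2 ->
  enorm (F x1 - F a) < m / 20 -> enorm (F x2 - F a) < m / 20 -> h x1 != 0 -> h x2 != 0 ->
  enorm (x1 - x2) <= n%:R * (20 * rho / m) * enorm (F x1 - F x2).
Proof.
move=> m0 x1 x2 K1 K2 F1 F2 h1 h2.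
case: (eqVneq x1 x2) => [->|x12]; first by rewrite !subrr enorm0 mulr0.
have F12 : F x1 != F x2.
  by apply: contra_neq x12; exact: (iF (mem_set (Kin K1)) (mem_set (Kin K2))).
pose t := enorm (F x1 - F x2); have t0 : 0 < t by rewrite enorm_gt0 subr_eq0.
have tm : t < m / 10.
  by have := ler_enorm_dist (F a) (F x1) (F x2); rewrite [enorm (F a - _)]enormBC /t; lra.
pose u : V := (t^-1)%:C *: (F x1 - F x2).
have u1 : enorm u = 1.
  by rewrite enormZ normc_real ger0_norm ?invr_ge0 ?(ltW t0) // mulVf // gt_eqF.
pose y (l : C^o) : V := F x2 + (l : C) *: u.
have yt : y t%:C = F x1.
  by rewrite /y /u scalerA -rmorphM /= mulfV ?gt_eqF // scale1r addrC subrK.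
have y0 : y 0 = F x2 by rewrite /y scale0r addr0.
(* As [m / 20 + m / 4 < m / 3], the disc lies where [image_contains_ball] provides preimages; and
   [t < m / 10] is half of the radius [m / 5] used below. *)
have ym (l : C^o) : normc (l : C) < m / 4 -> enorm (y l - F a) < m / 3.
  have E : y l - F x2 = (l : C) *: u by rewrite /y addrAC subrr add0r.
  by have := ler_enorm_dist (F x2) (y l) (F a); rewrite E enormZ u1 mulr1; lra.
have ym' (l : C^o) : normc (l : C) < m / 4 -> enorm (y l - F a) < m.
  by move=> /ym; lra.
have dy (l : C^o) : \near l, differentiable y l.
  by apply: (nbhsCP _ _).2; exists 1 => // w _; exact: differentiable_line.
have cL (l : C^o) : normc (l : C) < m / 4 -> {for l, continuous (fun l => pushed_jacobian (y l))}.
  move=> /ym' lm; apply: (@continuous_comp _ _ _ y pushed_jacobian).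
    by apply: differentiable_continuous; exact: nbhs_singleton (dy l).
  exact: pushed_jacobian_continuous.
have hL (l : C^o) : normc (l : C) < m / 4 -> pushed_jacobian (y l) != 0 ->
    holo_limit (fun l => pushed_jacobian (y l)) l.
  by move=> /ym' lm; exact: pushed_jacobian_holo.
have m5 : 0 < m / 5 by rewrite divr_gt0.
have m54 : m / 5 < m / 4 by lra.
have coord (k : 'I_n) : normc ((x1 - x2) ord0 k) <= 20 * rho / m * t.
  pose g (l : C^o) : C^o := (G (y l) ord0 k : C) - a ord0 k.
  have bg (l : C^o) : normc (l : C) < m / 4 -> pushed_jacobian (y l) != 0 -> normc (g l) <= rho.
    move=> /ym /(image_ball_inv m0)[Kl _] _; apply: le_trans Kl.
    have -> : g l = (G (y l) - a) ord0 k by rewrite /g !mxE.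
    exact: coord_le_enorm.
  have dg (l : C^o) : normc (l : C) < m / 4 -> pushed_jacobian (y l) != 0 -> differentiable g l.
    move=> lm; have [Kl Fl] := image_ball_inv m0 (ym l lm).
    have -> : pushed_jacobian (y l) = h (G (y l)) by rewrite -(pushed_jacobian_image Kl) Fl.
    move=> hl.
    have Gr : enorm (G (y l) - a) < rho by apply: interior_of => //; rewrite Fl; exact: ym'.
    have [d3 d30 H3] := small_ball Gr.
    have ux : dmx F (G (y l)) \in unitmx by rewrite unitmxE unitfE.
    have [_ /nbhs_singleton dG _] := holo_limit_jacobian_inverse d30 (fun x xd => dF (Kin (H3 x xd)))
       (fun x xd => GF (H3 x xd)) ux (esym Fl) (dy l).
    apply: differentiableB; last exact: differentiable_cst.
    exact: (differentiable_rV_coord k dG).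
  have nt : normc (t%:C) <= m / 5 / 2 by rewrite normc_real gtr0_norm //; lra.
  have n0 : normc (0 : C) <= m / 5 / 2 by rewrite normc0; lra.
  have Lt : pushed_jacobian (y t%:C) != 0 by rewrite yt pushed_jacobian_image.
  have L0 : pushed_jacobian (y 0) != 0 by rewrite y0 pushed_jacobian_image.
  have := lipschitz_off_zeros m5 m54 cL hL dg bg nt n0 Lt L0.
  have -> : (g t%:C : C) - g 0 = (x1 - x2) ord0 k.
    by rewrite /g yt y0 !GF // !mxE; ring.
  rewrite subr0 normc_real gtr0_norm //.
  by have -> : 4 * rho / (m / 5) = 20 * rho / m by field; exact: lt0r_neq0.
apply: le_trans (enorm_le_sum _) _.
apply: (@le_trans _ _ (\sum_(k < n) 20 * rho / m * t)); first exact: ler_sum.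
by rewrite sumr_const card_ord -[leLHS]mulr_natl mulrA.
Qed.

(* Osgood's theorem: the inverse is Lipschitz on the image, being bounded and
   holomorphic off the zeros of [pushed_jacobian]. *)
Lemma injective_jacobian_unit_aux : 0 < m -> dmx F a \in unitmx.
Proof.
move=> m0; have aa : eball a r a by apply: eball_center; exact: lt_trans rhor.
have m20 : 0 < m / 20 by rewrite divr_gt0.
have /continuous_enormP/(_ _ m20)/nbhs_enormP[d d0 Hd] := differentiable_continuous (dF aa).
pose B := n%:R * (20 * rho / m).
have B0 : 0 <= B by rewrite mulr_ge0 // divr_ge0 ?mulr_ge0 // ltW.
pose s := Num.min d rho; have s0 : 0 < s by rewrite lt_min d0.
have sd (x : V) : eball a s x -> enorm (x - a) < d by move=> xs; apply: lt_le_trans xs _; rewrite ge_min lexx.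
have sK (x : V) : eball a s x -> Kb x.
  by move=> xs; apply: ltW; apply: lt_le_trans xs _; rewrite ge_min lexx orbT.
(* Points with invertible derivative are dense, by [jacobian_neq0_somewhere] on small balls, so the
   Lipschitz bound for them extends to all points by continuity of [F]. *)
have approx (x : V) : eball a s x -> forall e : K, 0 < e -> exists x' : V,
    [/\ eball a s x', h x' != 0, enorm (x' - x) < e & enorm (F x' - F x) < e].
  move=> xs e e0; have [d1 d10 Hd1] := eball_nbhs xs.
  have /continuous_enormP/(_ _ e0)/nbhs_enormP[d2 d20 Hd2] := differentiable_continuous (dF (Kin (sK _ xs))).
  pose d3 := Num.min (Num.min d1 d2) e.
  have d30 : 0 < d3 by rewrite !lt_min d10 d20.
  have in1 (z : V) : eball x d3 z -> eball a s z.
    by move=> zx; apply: Hd1; apply: lt_le_trans zx _; rewrite !ge_min lexx.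
  have [x' x'd ux'] := @jacobian_neq0_somewhere _ _ F x _ d30 (fun z zd => dF (Kin (sK _ (in1 z zd))))
    (fun z z' zd zd' => iF (mem_set (Kin (sK _ (in1 _ (set_mem zd))))) (mem_set (Kin (sK _ (in1 _ (set_mem zd')))))).
  exists x'; split; first exact: in1.
  - by move: ux'; rewrite unitmxE unitfE.
  - by apply: lt_le_trans x'd _; rewrite ge_min lexx orbT.
  - by apply: Hd2; apply: lt_le_trans x'd _; rewrite !ge_min lexx orbT.
have lip (x y : V) : eball a s x -> eball a s y -> enorm (x - y) <= B * enorm (F x - F y).
  move=> xs ys; apply/ler_addgt0Pr => e e0.
  have c0 : 0 < 2 + 2 * B by lra.
  have [x' [x's hx' xx' Fxx']] := approx x xs _ (divr_gt0 e0 c0).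
  have [y' [y's hy' yy' Fyy']] := approx y ys _ (divr_gt0 e0 c0).
  have := inverse_lipschitz_generic m0 (sK _ x's) (sK _ y's) (Hd _ (sd _ x's)) (Hd _ (sd _ y's)) hx' hy'.
  rewrite -/B => H.
  have q1 := ler_enorm_dist x' x y; have q2 := ler_enorm_dist y' x' y.
  have q3 := ler_enorm_dist (F x) (F x') (F y'); have q4 := ler_enorm_dist (F y) (F x) (F y').
  rewrite [enorm (x - x')]enormBC in q1; rewrite [enorm (F y - F y')]enormBC in q4.
  apply: (approx_lipschitz B0 _ _ H (w := e / (2 + 2 * B))).
  - by rewrite mulrC divfK // gt_eqF.
  - exact: le_trans q1 (lerD (ltW xx') (le_trans q2 (lerD (lexx _) (ltW yy')))).
  - exact: le_trans q3 (lerD (ltW Fxx') (le_trans q4 (lerD (lexx _) (ltW Fyy')))).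
have ex : expanding F a s (B + 1)^-1.
  move=> x y xs ys; rewrite ler_pdivrMl ?ltr_wpDl //; apply: le_trans (lip _ _ xs ys) _.
  by rewrite mulrDl mul1r lerDl enorm_ge0.
apply: (expanding_dmx_unit _ ex (eball_center _ s0) (dF aa)).
by rewrite invr_gt0 ltr_wpDl.
Qed.

End push_forward.

Lemma sphere_image_dist F (a : V) (r rho : K) : 0 < rho -> rho < r ->
  (forall x : V, eball a r x -> differentiable F x) -> set_inj (eball a r) F ->
  exists2 m : K, 0 < m & forall x : V, enorm (x - a) = rho -> m <= enorm (F x - F a).
Proof.
move=> rho0 rr dF iF.
have shell (x : V) : enorm (x - a) <= rho /\ rho <= enorm (x - a) -> F x != F a.
  case=> xK xd; apply/eqP => E.
  have xa : x = a.
    by apply: iF E; rewrite inE; [exact: le_lt_trans rr|apply: eball_center; exact: lt_trans rr].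
  by move: xd; rewrite xa subrr enorm0 leNgt rho0.
have [m m0 Hm] := @compact_dist_gt0 _ F (F a) (@compact_sphere_shell a a rho rho)
  (fun x xK => dF x (le_lt_trans xK.1 rr)) shell.
by exists m => // x E; apply: Hm; rewrite /= E.
Qed.

Lemma injective_jacobian_unit F (a : V) (r : K) : 0 < r ->
  (forall x : V, eball a r x -> differentiable F x) -> set_inj (eball a r) F ->
  dmx F a \in unitmx.
Proof.
move=> r0 dF iF; have r2 : 0 < r / 2 by rewrite divr_gt0.
have rr : r / 2 < r by lra.
have [m m0 Hm] := sphere_image_dist r2 rr dF iF.
exact: (injective_jacobian_unit_aux r2 rr dF iF Hm m0).
Qed.

Lemma injective_open F (a : V) (r : K) : 0 < r ->
  (forall x : V, eball a r x -> differentiable F x) -> set_inj (eball a r) F ->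
  forall e : K, 0 < e -> exists2 d : K, 0 < d & forall y : V, enorm (y - F a) < d ->
  exists x : V, [/\ eball a e x, eball a r x & F x = y].
Proof.
move=> r0 dF iF e e0; pose rho := Num.min (e / 2) (r / 2).
have rho0 : 0 < rho by rewrite lt_min !divr_gt0.
have rr : rho < r.
  by apply: (@le_lt_trans _ _ (r / 2)); rewrite ?ge_min ?lexx ?orbT //; lra.
have re : rho < e.
  by apply: (@le_lt_trans _ _ (e / 2)); rewrite ?ge_min ?lexx //; lra.
have [m m0 Hm] := sphere_image_dist rho0 rr dF iF.
exists (m / 3); first by rewrite divr_gt0.
move=> y /(image_contains_ball rho0 rr dF iF Hm m0)[x xa xE].
by exists x; split => //; [exact: le_lt_trans re|exact: le_lt_trans rr].
Qed.

End open_mapping.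

(** * The Schwarz-Pick lemma *)

Section hyperbolic_tangent.
Context {K : realType}.
Implicit Types (x a b : K).

Lemma tanhE x : tanh x = (expR x ^+ 2 - 1) / (expR x ^+ 2 + 1).
Proof.
rewrite /tanh expRN; have e0 := expR_gt0 x.
have p : expR x ^+ 2 + 1 != 0 by rewrite gt_eqF // addr_gt0 // exprn_gt0.
have q : expR x + (expR x)^-1 != 0 by rewrite gt_eqF // addr_gt0 // invr_gt0.
by field; rewrite p gt_eqF.
Qed.

Lemma tanh_le a b : a <= b -> tanh a <= tanh b.
Proof.
move=> ab; rewrite !tanhE; have A0 := expR_gt0 a; have AB : expR a <= expR b by rewrite ler_expR.
have A2 : 0 < expR a ^+ 2 + 1 by rewrite addr_gt0 // exprn_gt0.
have B2 : 0 < expR b ^+ 2 + 1 by rewrite addr_gt0 // exprn_gt0 // expR_gt0.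
by rewrite ler_pdivrMr // mulrAC ler_pdivlMr //; nra.
Qed.

Lemma tanh_lt_inv a b : tanh a < tanh b -> a < b.
Proof. by move=> h; rewrite ltNge; apply/negP => /tanh_le; rewrite leNgt h. Qed.

Lemma tanh_artanh x : -1 < x -> x < 1 -> tanh (artanh x) = x.
Proof.
move=> x1 x2; have y0 : 0 < (1 + x) / (1 - x) by rewrite divr_gt0; lra.
have E : expR (artanh x) ^+ 2 = (1 + x) / (1 - x).
  by rewrite /artanh expr2 -expRD -splitr lnK.
have n1 : 1 - x != 0 by rewrite gt_eqF; lra.
rewrite tanhE E.
have n2 : (1 + x) / (1 - x) + 1 = 2 / (1 - x) by field.
rewrite n2; field; by rewrite n1.
Qed.

Lemma tanh_lt1 x : tanh x < 1.
Proof.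
rewrite tanhE ltr_pdivrMr ?mul1r; first lra.
by rewrite addr_gt0 // exprn_gt0 // expR_gt0.
Qed.

End hyperbolic_tangent.

Section mobius.
Context {K : realType}.
Local Notation C := K[i].
Implicit Types (a z : C).

Definition mobius a z : C := (z - a) / (1 - conjc a * z).

Lemma mobius_identity a z : normc (1 - conjc a * z) ^+ 2 - normc (z - a) ^+ 2 =
  (1 - normc a ^+ 2) * (1 - normc z ^+ 2).
Proof. by rewrite !sqr_normcE; case: a z => [a1 a2] [z1 z2] /=; ring. Qed.

Lemma mobius_den_gt a z : normc a < 1 -> normc z <= 1 -> 1 - normc a <= normc (1 - conjc a * z).
Proof.
move=> a1 z1; have := normc_sub_le 1 (conjc a * z); rewrite normc1 normcM normc_conjc.
have := normc_ge0 a; have := normc_ge0 z; nra.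
Qed.

Lemma mobius_den_neq0 a z : normc a < 1 -> normc z <= 1 -> 1 - conjc a * z != 0.
Proof.
by move=> a1 z1; rewrite -normc_gt0; apply: lt_le_trans (mobius_den_gt a1 z1); rewrite subr_gt0.
Qed.

Lemma mobius_lt1 a z : normc a < 1 -> normc z < 1 -> normc (mobius a z) < 1.
Proof.
move=> a1 z1; rewrite /mobius normcf ltr_pdivrMr ?mul1r; last first.
  by rewrite normc_gt0 mobius_den_neq0 // ltW.
rewrite -(@ltr_pXn2r _ 2) ?nnegrE ?normc_ge0 // -subr_gt0 mobius_identity.
by rewrite mulr_gt0 // subr_gt0 expr_lt1 ?normc_ge0.
Qed.

Lemma mobiusC a z : normc (mobius a z) = normc (mobius z a).
Proof.
rewrite /mobius !normcf normcB; congr (_ / _).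
by case: a z => [a1 a2] [z1 z2]; rewrite /normc /=; congr Num.sqrt; ring.
Qed.

(** The modulus of a Moebius map tends to 1 at the unit circle: by [mobius_identity] the defect
    [1 - normc (mobius a z) ^+ 2] is at most [2 * (1 - normc z ^+ 2) / (1 - normc a)]. *)
Lemma mobius_ge a z (c : K) : normc a < 1 -> normc z < 1 ->
  2 * (1 - normc z ^+ 2) <= c * (1 - normc a) -> 1 - c <= normc (mobius a z).
Proof.
move=> a1 z1 h; have m1 := mobius_lt1 a1 z1.
apply: (@le_trans _ _ (normc (mobius a z) ^+ 2)); last first.
  by rewrite expr2 ler_piMr ?normc_ge0 // ltW.
have d0 := mobius_den_gt a1 (ltW z1).
have p0 : 0 < 1 - normc a by rewrite subr_gt0.
have d1 : 0 < normc (1 - conjc a * z) by exact: lt_le_trans d0.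
rewrite /mobius normcf expr_div_n ler_pdivlMr ?exprn_gt0 //.
have := mobius_identity a z; have a0 := normc_ge0 a.
set n2 := normc (1 - _) in d0 d1 *; move=> id.
have : (1 - normc a ^+ 2) * (1 - normc z ^+ 2) <= c * n2 ^+ 2.
  have q2 : (1 - normc a) ^+ 2 <= n2 ^+ 2 by apply: lerXn2r => //; rewrite nnegrE; exact: ltW.
  have z2 : 0 <= 1 - normc z ^+ 2 by rewrite subr_ge0 expr_le1 ?normc_ge0 // ltW.
  have c0 : 0 <= c.
    by rewrite -(pmulr_lge0 _ p0); apply: le_trans h; rewrite mulr_ge0.
  apply: (@le_trans _ _ (c * (1 - normc a) ^+ 2)); last by rewrite ler_wpM2l.
  have -> : (1 - normc a ^+ 2) * (1 - normc z ^+ 2) =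
     (1 - normc a) * ((1 + normc a) * (1 - normc z ^+ 2)) by ring.
  have -> : c * (1 - normc a) ^+ 2 = (1 - normc a) * (c * (1 - normc a)) by ring.
  rewrite ler_pM2l //; apply: le_trans h; rewrite ler_wpM2r //; lra.
by rewrite -id mulrBl mul1r; lra.
Qed.

Lemma differentiable_mobius (W : normedModType C) (f : W -> C^o) (x : W) a :
  normc a < 1 -> normc (f x) < 1 -> differentiable f x ->
  differentiable (fun y => mobius a (f y) : C^o) x.
Proof.
move=> a1 f1 df; apply: differentiableM.
  by apply: differentiableB => //; exact: differentiable_cst.
apply: differentiableV; last exact: mobius_den_neq0 a1 (ltW f1).
apply: differentiableB; first exact: differentiable_cst.
by apply: differentiableM => //; exact: differentiable_cst.
Qed.

End mobius.

Section schwarz_pick.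
Context {K : realType}.
Local Notation C := K[i].

(** The quotient of [g] by the Moebius factor is the difference quotient at [a] times
    [1 - conjc a * t], hence bounded. On a circle close to the unit circle it is at most
    [(1 - c)^-1], and [maximum_off_zeros] brings this bound to [z]; [c] is arbitrarily small. *)
Lemma schwarz_pick_disc (L g : C^o -> C^o) (a z : C^o) :
  (forall t : C^o, normc (t : C) < 1 -> {for t, continuous L}) ->
  (forall t : C^o, normc (t : C) < 1 -> L t != 0 -> holo_limit L t) ->
  (forall t : C^o, normc (t : C) < 1 -> L t != 0 -> differentiable g t) ->
  (forall t : C^o, normc (t : C) < 1 -> L t != 0 -> normc (g t) <= 1) ->
  normc (a : C) < 1 -> normc (z : C) < 1 -> L a != 0 -> L z != 0 -> g a = 0 ->
  normc (g z) <= normc (mobius a z).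
Proof.
move=> cL hL dg bg a1 z1 La Lz ga.
case: (eqVneq z a) => [->|za]; first by rewrite ga normc0 normc_ge0.
apply/ler_addgt0Pr => e e0.
pose c := Num.min e (1 / 2).
have c0 : 0 < c by rewrite lt_min e0 divr_gt0.
have ce : c <= e by rewrite ge_min lexx.
have c12 : c <= 1 / 2 by rewrite ge_min lexx orbT.
(* The first two bounds put [z] and [a] inside the circle of radius [1 - d]; the third gives
   [4 * d <= c * (1 - normc a)], the condition of [mobius_ge]. *)
pose d := Num.min (Num.min ((1 - normc (z : C)) / 2) ((1 - normc (a : C)) / 2)) (c * (1 - normc (a : C)) / 4).
have az0 : 0 < 1 - normc (a : C) by rewrite subr_gt0.
have zz0 : 0 < 1 - normc (z : C) by rewrite subr_gt0.
have d0 : 0 < d by rewrite !lt_min !divr_gt0 // mulr_gt0.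
have d1 : d <= (1 - normc (z : C)) / 2 by rewrite !ge_min lexx.
have d2 : d <= (1 - normc (a : C)) / 2 by rewrite !ge_min lexx orbT.
have d3 : d <= c * (1 - normc (a : C)) / 4 by rewrite !ge_min lexx orbT.
have na := normc_ge0 a; have nz := normc_ge0 z.
pose r := 1 - d; pose r' := 1 - d / 2.
have r0 : 0 < r by rewrite /r; lra.
have rr' : r < r' by rewrite /r /r'; lra.
have r'1 : r' < 1 by rewrite /r'; lra.
have rlt (t : C^o) : normc (t : C) < r' -> normc (t : C) < 1 by move=> h; exact: lt_trans r'1.
have ar : normc (a : C) < r' by rewrite /r'; lra.
have zr : normc (z : C) <= r by rewrite /r; lra.
pose g1 (t : C^o) : C^o := (g t - g a) / ((t : C) - a).
pose q (t : C^o) : C^o := (g1 t : C) * (1 - conjc a * (t : C)).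
have den2 (t : C^o) : normc (t : C) < r' -> normc (1 - conjc a * (t : C)) <= 2.
  move=> /rlt t1; apply: le_trans (le_normcB _ _) _; rewrite normc1 normcM normc_conjc.
  by have := normc_ge0 t; nra.
have [B HB] := difference_quotient_bound (fun t tr => bg t (rlt t tr)) ar La (dg a a1 La).
have Qc : 0 < 1 - c by lra.
have zan : (z : C) - a != 0 by rewrite subr_eq0.
have : normc (q z) <= (1 - c)^-1.
  apply: (@maximum_off_zeros _ (fun t => (L t : C) * ((t : C) - a)) q r r' (B * 2) _ r0 rr').
  - by move=> t tr; have [] := shifted_factor cL hL a (rlt t tr).
  - by move=> t tr; have [] := shifted_factor cL hL a (rlt t tr).
  - move=> t tr; rewrite mulf_eq0 negb_or => /andP[Lt ta].
    apply: differentiableM.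
      by apply: dq_differentiable => //; apply: dg => //; exact: rlt.
    apply: differentiableB; first exact: differentiable_cst.
    by apply: differentiableM => //; exact: differentiable_cst.
  - move=> t tr Lt; rewrite normcM; apply: ler_pM; rewrite ?normc_ge0 //; first exact: HB.
    exact: den2.
  - move=> t tr; rewrite mulf_eq0 negb_or => /andP[Lt ta].
    have t1 : normc (t : C) < 1 by rewrite tr /r; lra.
    have mg : 1 - c <= normc (mobius a t).
      apply: mobius_ge => //; rewrite tr /r; nra.
    have m0 : 0 < normc (mobius a t) by exact: lt_le_trans mg.
    have dn := mobius_den_neq0 a1 (ltW t1).
    have -> : q t = (g t : C) / mobius a t.
      by rewrite /q /g1 ga subr0 /mobius; field; rewrite ta dn.
    rewrite normcf ler_pdivrMr // ler_pdivlMl //.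
    have := bg t t1 Lt; have := normc_ge0 (g t); nra.
  - by rewrite invr_ge0 ltW.
  - exact: zr.
  - by rewrite mulf_neq0.
have dn := mobius_den_neq0 a1 (ltW z1).
have m0 : 0 < normc (mobius a z) by rewrite normc_gt0 mulf_neq0 // invr_neq0.
have -> : q z = (g z : C) / mobius a z.
  by rewrite /q /g1 ga subr0 /mobius; field; rewrite zan dn.
rewrite normcf ler_pdivrMr // ler_pdivlMl // => h.
have := bg z z1 Lz; have := normc_ge0 (g z); nra.
Qed.

End schwarz_pick.

(** * Complex lines in the ball *)

Section complex_geodesic.
Context {K : realType} {n : nat}.
Local Notation C := K[i].
Local Notation V := ('rV[C]_n : normedModType C).

Lemma differentiable_hdot (v x : V) : differentiable (fun y : V => hdot y v : C^o) x.
Proof.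
rewrite (_ : (fun y : V => hdot y v) =
  \sum_(j < n) (fun y : V => (y ord0 j : C) * conjc (v ord0 j) : C^o)); last first.
  by apply/funext => y; rewrite fct_sumE.
apply: differentiable_sum => j; apply: differentiableM; last exact: differentiable_cst.
exact: differentiable_coord.
Qed.

Variables (x0 v : V).
Hypotheses (v1 : enorm v = 1) (x0v : hdot x0 v = 0) (x01 : enorm x0 < 1).

Let rho := Num.sqrt (1 - enorm x0 ^+ 2).

(* [slice] parametrizes by the unit disc the trace of a complex line on the ball,
   and [slice_coord] is a holomorphic left inverse defined on the whole ball. *)
Definition slice (t : C) : V := x0 + (rho%:C * t) *: v.
Definition slice_coord (y : V) : C^o := rho%:C * hdot y v / (1 - hdot y x0).

Let rho2 : rho ^+ 2 = 1 - enorm x0 ^+ 2.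
Proof. by rewrite sqr_sqrtr // subr_ge0 expr_le1 ?enorm_ge0 // ltW. Qed.

Let rho0 : 0 < rho.
Proof. by rewrite sqrtr_gt0 subr_gt0 expr_lt1 ?enorm_ge0. Qed.

Let hvv : hdot v v = 1.
Proof. by rewrite hdotxx v1 expr1n. Qed.

Lemma slice_enorm t : enorm (slice t) < 1 <-> normc t < 1.
Proof.
have E : enorm (slice t) ^+ 2 = 1 - rho ^+ 2 * (1 - normc t ^+ 2).
  rewrite /slice sqr_enormD hdotZl (hdotC x0 v) x0v conjc0 mulr0 /= mulr0 addr0.
  rewrite enormZ v1 mulr1 normcM normc_real (gtr0_norm rho0) exprMn.
  by rewrite mulrBr mulr1 rho2; ring.
rewrite -[_ < 1](@ltr_pXn2r _ 2) ?nnegrE ?enorm_ge0 ?ler01 // expr1n E.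
rewrite -[normc t < 1](@ltr_pXn2r _ 2) ?nnegrE ?normc_ge0 ?ler01 // expr1n.
rewrite ltrBlDr ltrDl pmulr_rgt0 ?exprn_gt0 // subr_gt0; exact: iff_refl.
Qed.

Lemma slice_coordK t : slice_coord (slice t) = t.
Proof.
rewrite /slice_coord /slice !hdotDl !hdotZl x0v add0r hvv mulr1 (hdotC x0 v) x0v conjc0 mulr0 addr0.
rewrite hdotxx; have -> : 1 - (enorm x0 ^+ 2)%:C = (rho ^+ 2)%:C :> C.
  by rewrite rho2 rmorphB rmorph1.
have r0 : rho%:C != 0 :> C by rewrite eq_complex /= gt_eqF.
by rewrite rmorphXn /=; field.
Qed.

Lemma slice_den (y : V) : enorm y < 1 -> 1 - hdot y x0 != 0.
Proof.
move=> y1; apply/eqP => /eqP; rewrite subr_eq0 => /eqP E.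
have := x01; have := hdot_le y x0; rewrite -E normc1; have := enorm_ge0 y; have := enorm_ge0 x0; nra.
Qed.

(** Split [y] into [y'] orthogonal to [v] and a multiple [al] of [v]. The Cauchy-Schwarz inequality
    in the plane bounds [rho |al| + |y'| |x0|] by [|y| < 1], because [rho^2 + |x0|^2 = 1]. *)
Lemma slice_coord_lt1 (y : V) : enorm y < 1 -> normc (slice_coord y) < 1.
Proof.
move=> y1; pose al := hdot y v; pose y' : V := y - al *: v.
have y'v : hdot y' v = 0 by rewrite /y' hdotBl hdotZl hvv mulr1 subrr.
have Ey : y = y' + al *: v by rewrite /y' subrK.
have E2 : enorm y ^+ 2 = enorm y' ^+ 2 + normc al ^+ 2.
  by rewrite {1}Ey sqr_enormD hdotZl (hdotC y' v) y'v conjc0 mulr0 /= mulr0 addr0 enormZ v1 mulr1.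
have E3 : hdot y x0 = hdot y' x0.
  by rewrite {1}Ey hdotDl hdotZl (hdotC x0 v) x0v conjc0 mulr0 addr0.
have dn := slice_den y1.
rewrite /slice_coord -/al normcf ltr_pdivrMr ?normc_gt0 // mul1r normcM normc_real (gtr0_norm rho0).
have h1 : 1 - enorm y' * enorm x0 <= normc (1 - hdot y x0).
  have := normc_sub_le 1 (hdot y x0); rewrite normc1 E3.
  by have := hdot_le y' x0; lra.
apply: lt_le_trans h1; rewrite ltrBrDr.
have p1 := enorm_ge0 y'; have p2 := enorm_ge0 x0; have p3 := normc_ge0 al.
rewrite -(@ltr_pXn2r _ 2) ?nnegrE ?ler01 ?addr_ge0 ?mulr_ge0 ?(ltW rho0) // expr1n.
have : enorm y ^+ 2 < 1 by rewrite expr_lt1 ?enorm_ge0.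
have := sqr_ge0 (rho * enorm y' - enorm x0 * normc al).
have := rho2; rewrite E2; nra.
Qed.

Lemma differentiable_slice_coord (y : V) : enorm y < 1 -> differentiable slice_coord y.
Proof.
move=> y1; apply: differentiableM.
  apply: differentiableM; first exact: differentiable_cst.
  exact: differentiable_hdot.
apply: differentiableV; last exact: slice_den.
by apply: differentiableB; [exact: differentiable_cst|exact: differentiable_hdot].
Qed.

Lemma differentiable_slice (t : C^o) : differentiable (slice : C^o -> V) t.
Proof.
apply: differentiableD; first exact: differentiable_cst.
apply: (@differentiableZl _ _ _ (fun t : C^o => rho%:C * (t : C) : C^o)).
by apply: differentiableM => //; exact: differentiable_cst.
Qed.

End complex_geodesic.

(** [x0] is the point of the line nearest to the origin, so it lies in the ball because [w] does. *)
Lemma slice_through (K : realType) (n : nat) (w p : 'rV[K[i]]_n) : w != p -> enorm w < 1 ->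
  exists x0 v : 'rV[K[i]]_n, [/\ enorm v = 1, hdot x0 v = 0, enorm x0 < 1 &
    exists tw tp, w = slice x0 v tw /\ p = slice x0 v tp].
Proof.
move=> wp w1; pose d := enorm (p - w).
have d0 : 0 < d by rewrite enorm_gt0 subr_eq0 eq_sym.
pose v := (d^-1)%:C *: (p - w).
have v1 : enorm v = 1.
  by rewrite enormZ normc_real ger0_norm ?invr_ge0 ?(ltW d0) // mulVf // gt_eqF.
pose al := hdot w v; pose x0 := w - al *: v.
have hvv : hdot v v = 1 by rewrite hdotxx v1 expr1n.
have x0v : hdot x0 v = 0 by rewrite /x0 hdotBl hdotZl hvv mulr1 subrr.
have Ew : w = x0 + al *: v by rewrite /x0 subrK.
have E2 : enorm w ^+ 2 = enorm x0 ^+ 2 + normc al ^+ 2.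
  by rewrite {1}Ew sqr_enormD hdotZl (hdotC x0 v) x0v conjc0 mulr0 /= mulr0 addr0 enormZ v1 mulr1.
have x01 : enorm x0 < 1.
  rewrite -(@ltr_pXn2r _ 2) ?nnegrE ?enorm_ge0 ?ler01 // expr1n.
  have : enorm w ^+ 2 < 1 by rewrite expr_lt1 ?enorm_ge0.
  by have := sqr_ge0 (normc al); lra.
clearbody x0 al; exists x0, v; split => //.
set rho := Num.sqrt (1 - enorm x0 ^+ 2).
have rho0 : 0 < rho by rewrite sqrtr_gt0 subr_gt0 expr_lt1 ?enorm_ge0.
have rn : rho%:C != 0 :> K[i] by rewrite eq_complex /= gt_eqF.
exists (al / rho%:C), ((al + d%:C) / rho%:C); rewrite /slice -/rho !(mulrC rho%:C) !divfK //.
split; first exact: Ew.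
have dv : d%:C *: v = p - w.
  by rewrite /v scalerA -rmorphM mulfV ?gt_eqF // rmorph1 scale1r.
by rewrite scalerDl addrA -Ew dv addrC subrK.
Qed.

Section uniform_schwarz.
Context {K : realType} {n : nat}.
Local Notation C := K[i].
Local Notation V := ('rV[C]_n : normedModType C).

Lemma differentiable_translate (f : C^o -> C^o) (a s : C^o) :
  (forall t, differentiable f t) -> differentiable (fun t => f (a + t)) s.
Proof.
move=> df; apply: (@differentiable_comp _ _ _ _ (fun t : C^o => a + t : C^o) f); last exact: df.
by apply: differentiableD; first exact: differentiable_cst.
Qed.

Lemma eball0E (r : K) (x : V) : eball 0 r x = (enorm x < r) :> Prop.
Proof. by rewrite /eball /= subr0. Qed.

(* The Schwarz-Pick bound holds at some [q'] close to [p] on the slice through [w]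
   and [p], off the zeros of [L]; [ball_lipschitz] transports it to [q]. *)
Lemma uniform_schwarz (L : V -> C^o) (w p : V) (T : K) :
  (forall x, differentiable L x) ->
  enorm w < 1 -> L w != 0 -> enorm p < 1 -> w != p ->
  (forall g : V -> C^o, holomorphic_map (eball 0 1) unit_disk g -> g p = 0 -> normc (g w) <= T) ->
  forall T', T < T' -> exists2 eta : K, 0 < eta & forall q : V,
    enorm q < 1 -> L q != 0 -> enorm (q - p) < eta ->
    forall f : V -> C^o,
      (forall x : V, enorm x < 1 -> L x != 0 -> differentiable f x /\ normc (f x) < 1) ->
      f w = 0 -> normc (f q) <= T'.
Proof.
move=> dL w1 Lw p1 wp HT T' TT'.
have [x0 [v [v1 x0v x01 [tw [tp [Ew Ep]]]]]] := slice_through wp w1.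
have tw1 : normc tw < 1 by apply/(slice_enorm v1 x0v x01); rewrite -Ew.
have tp1 : normc tp < 1 by apply/(slice_enorm v1 x0v x01); rewrite -Ep.
have ds t := @differentiable_slice _ _ x0 v t.
pose Ls (t : C^o) : C^o := L (slice x0 v t).
have dLs (t : C^o) : differentiable Ls t.
  exact: (differentiable_comp (ds t) (dL _)).
have cLs (t : C^o) : {for t, continuous Ls} by exact: differentiable_continuous.
have hLs (t : C^o) : holo_limit Ls t.
  by apply: holo_limit_differentiable; apply: (nbhsCP _ _).2; exists 1 => // ? _; exact: dLs.
(* The hypothesis is tested on the Moebius map at [tp] after [slice_coord], a function on the whole
   ball that vanishes at [p]. *)
have Mp : normc (mobius tw tp) <= T.
  rewrite mobiusC.
  have := HT (fun y => mobius tp (slice_coord x0 v y)).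
  rewrite {1}Ew slice_coordK //; apply; last first.
    by rewrite /mobius Ep slice_coordK // subrr mul0r.
  split=> z; rewrite eball0E => z1.
    apply: differentiable_mobius tp1 _ _; first exact: slice_coord_lt1.
    exact: differentiable_slice_coord.
  by apply: mobius_lt1 => //; exact: slice_coord_lt1.
have dlt : 0 < (T' - T) / 2 by rewrite divr_gt0 // subr_gt0.
set dl := (T' - T) / 2 in dlt.
have dm : differentiable (fun t : C^o => mobius tw t : C^o) (tp : C^o).
  by apply: (@differentiable_mobius _ _ (fun t : C^o => t)).
have /continuous_CP/(_ _ dlt)/nbhsCP[d1 d10 Hd1] := differentiable_continuous dm.
pose rho := 1 - enorm p; have rho0 : 0 < rho by rewrite subr_gt0.
have inB (x : V) : eball p rho x -> enorm x < 1.
  by rewrite /eball /= /rho => xp; have := ler_enormD (x - p) p; rewrite subrK; lra.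
(* Two points within [eta] of [p] are at distance at most [2 * eta]; times the Lipschitz constant
   [8 / rho] this is at most [dl]. *)
pose eta := Num.min (rho / 8) (dl * rho / 16).
have eta0 : 0 < eta by rewrite lt_min !divr_gt0 // mulr_gt0.
have e1 : eta <= rho / 8 by rewrite ge_min lexx.
have e2 : eta <= dl * rho / 16 by rewrite ge_min lexx orbT.
have /continuous_enormP/(_ _ eta0)/nbhsCP[d2 d20 Hd2] := differentiable_continuous (ds tp).
pose d3 := Num.min (Num.min d1 d2) (1 - normc tp).
have d30 : 0 < d3 by rewrite !lt_min d10 d20 subr_gt0.
pose L2 (t : C^o) : C^o := Ls (tp + t).
have dL2 (t : C^o) : differentiable L2 t.
  exact: differentiable_translate.
pose rr := normc (tw - tp) + 1.
have rr0 : 0 < rr by rewrite ltr_wpDl ?normc_ge0.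
have rr1 : rr < rr + 1 by rewrite ltrDl.
have Lww : L2 (tw - tp) != 0 by rewrite /L2 /Ls addrC subrK -Ew.
have twr : normc (tw - tp) < rr by rewrite ltrDl.
have [t td L2t] := zero_near_closure_support rr0 rr1 (fun z _ => differentiable_continuous (dL2 z))
  (fun z _ _ => holo_limit_differentiable ((nbhsCP _ _).2 (ex_intro2 _ _ 1 ltr01 (fun y _ => dL2 y)))) twr Lww d30.
pose t' := tp + t; have tt' : normc (t' - tp) < d3 by rewrite /t' addrC addKr.
move: (tt'); rewrite !lt_min => /andP[/andP[tt1 tt2] tt3].
have t'1 : normc t' < 1 by have := le_normcD (t' - tp) tp; rewrite subrK; lra.
pose q' := slice x0 v t'.
have q'1 : enorm q' < 1 by apply/(slice_enorm v1 x0v x01).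
have q'p : enorm (q' - p) < eta by have := Hd2 t' tt2; rewrite Ep.
have mt' : normc (mobius tw t') <= T + dl.
  have := Hd1 t' tt1; have := normc_sub_le (mobius tw t') (mobius tw tp); lra.
(* [eta] is fixed before [f]: in the applications [f] changes with [q]. *)
exists eta => // q q1 Lq qp f Hf fw.
have fq' : normc (f q') <= T + dl.
  apply: le_trans mt'.
  apply: (@schwarz_pick_disc _ Ls (fun t => f (slice x0 v t)) tw t' (fun t _ => @cLs t) (fun t _ _ => @hLs t)).
  - move=> s /(slice_enorm v1 x0v x01) s1 Ls0; have [dfs _] := Hf _ s1 Ls0.
    exact: (differentiable_comp (ds s) dfs).
  - by move=> s /(slice_enorm v1 x0v x01) s1 Ls0; have [_ /ltW] := Hf _ s1 Ls0.
  - exact: tw1.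
  - exact: t'1.
  - by rewrite /Ls -Ew.
  - exact: L2t.
  - by rewrite -Ew.
have q8 : eball p (rho / 8) q by exact: lt_le_trans qp e1.
have q'8 : eball p (rho / 8) q' by exact: lt_le_trans q'p e1.
have := @ball_lipschitz _ _ L f p rho 1 rho0 dL (fun x xp Lx => (Hf x (inB x xp) Lx).1)
  (fun x xp Lx => ltW (Hf x (inB x xp) Lx).2) q' q q'8 q8 L2t Lq.
have qq : enorm (q - q') <= 2 * eta.
  apply: le_trans (ler_enorm_dist p q q') _; rewrite [enorm (p - q')]enormBC mulr2n mulrDl !mul1r.
  by rewrite lerD // ltW.
have rq : 8 * 1 / rho * enorm (q - q') <= dl.
  rewrite mulr1 mulrAC ler_pdivrMr //.
  by apply: le_trans (ler_wpM2l _ qq) _; rewrite // mulrA -natrM -ler_pdivlMl // mulrC.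
rewrite -[T'](subrK T) [T' - T]splitr -/dl -addrA [dl + T]addrC.
move=> h; apply: le_trans (lerD (le_trans h rq) fq'); rewrite -lerBlDr.
exact: normc_sub_le.
Qed.

End uniform_schwarz.

(** * Upper bounds near a hyperplane *)

Section cluster_points.
Context {K : realType} {n : nat}.
Local Notation C := K[i].
Local Notation V := ('rV[C]_n : normedModType C).

(** The images of the traces of [S] on small balls about [p] generate a filter that lives on a
    compact ball, and [y] is one of its cluster points. *)
Lemma cluster_image (f : V -> V) (S : set V) (p : V) (c : K) :
  (forall eta : K, 0 < eta -> exists2 q, S q & enorm (q - p) < eta) ->
  (exists2 eta : K, 0 < eta & forall q, S q -> enorm (q - p) < eta -> enorm (f q) <= c) ->
  exists2 y : V, enorm y <= c & forall e eta : K, 0 < e -> 0 < eta ->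
    exists q, [/\ S q, enorm (q - p) < eta & enorm (f q - y) < e].
Proof.
move=> acc [eta0 eta00 bf].
pose Fl : set_system V := [set A | exists2 eta : K, 0 < eta &
  forall q, S q -> enorm (q - p) < eta -> A (f q)].
have FF : ProperFilter Fl.
  apply: Build_ProperFilter_ex.
    by move=> A [eta e0 H]; have [q Sq qp] := acc _ e0; exists (f q); exact: H.
  apply: Build_Filter; first by exists 1.
    move=> A B [e1 e10 H1] [e2 e20 H2]; exists (Num.min e1 e2); first by rewrite lt_min e10.
    by move=> q Sq; rewrite lt_min => /andP[q1 q2]; split; [exact: H1|exact: H2].
  by move=> A B AB [e e0 H]; exists e => // q Sq /(H q Sq)/AB.
have FA : Fl [set z : V | enorm (z - 0) <= c].
  by exists eta0 => // q Sq qp; rewrite /= subr0; exact: bf.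
have [y [yc cl]] := @compact_eball K n 0 c Fl FF FA.
exists y; first by move: yc; rewrite /= subr0.
move=> e eta e0 eta1.
have Fe : Fl (f @` [set q | S q /\ enorm (q - p) < eta]).
  by exists eta => // q Sq qp; exists q.
have Ne : nbhs y [set z : V | enorm (z - y) < e] by apply/nbhs_enormP; exists e.
by have [_ [[q [Sq qp] <-] qe]] := cl _ _ Fe Ne; exists q.
Qed.

Lemma differentiable_hdot_comp (W : normedModType C) (f : W -> V) (u : V) (x : W) :
  differentiable f x -> differentiable (fun y => hdot (f y) u : C^o) x.
Proof.
move=> df; apply: (@differentiable_comp _ _ _ _ f (fun y : V => hdot y u : C^o)) => //.
exact: differentiable_hdot.
Qed.

Lemma hdot_le_enorm (x u : 'rV[C]_n) : enorm u <= 1 -> normc (hdot x u) <= enorm x.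
Proof. by move=> u1; apply: le_trans (hdot_le x u) _; rewrite ler_piMr ?enorm_ge0. Qed.

(** Reduces bounds on vector values to scalar functions [hdot (f q) u], with [u] chosen after [q].
    Allowing [enorm u <= 1] includes [x = 0], in dimension zero too. *)
Lemma hdot_unit (x : 'rV[C]_n) : exists2 u : 'rV[C]_n, enorm u <= 1 & normc (hdot x u) = enorm x.
Proof.
case: (eqVneq x 0) => [->|x0].
  by exists 0; rewrite ?hdot0l ?normc0 enorm0.
have nx : 0 < enorm x by rewrite enorm_gt0.
exists ((enorm x)^-1%:C *: x).
  by rewrite enormZ normc_real ger0_norm ?invr_ge0 ?(ltW nx) // mulVf // gt_eqF.
rewrite hdotZr hdotxx conjc_real normcM !normc_real ger0_norm ?invr_ge0 ?(ltW nx) //.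
by rewrite ger0_norm ?sqr_ge0 // expr2 mulKf // gt_eqF.
Qed.

(* Near [p] the set [L != 0] is a cone, so a complex line through [p] that meets
   it does so in a punctured disc. *)
Definition cone_at (p : V) (L : V -> C) := exists2 eps : K, 0 < eps & forall v : V,
  L (p + v) != 0 -> enorm v < eps ->
  forall l : C, l != 0 -> enorm (l *: v) < eps -> L (p + l *: v) != 0.

End cluster_points.

Section punctured_domain.
Context {K : realType} {n : nat}.
Local Notation C := K[i].
Local Notation V := ('rV[C]_n : normedModType C).

Variables (L : V -> C^o) (w p : V) (T : K).
Hypothesis dL : forall x, differentiable L x.
Hypotheses (w1 : enorm w < 1) (Lw : L w != 0) (p1 : enorm p < 1) (Lp : L p = 0).
Hypothesis HT : forall g : V -> C^o, holomorphic_map (eball 0 1) unit_disk g ->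
  g p = 0 -> normc (g w) <= T.

Let D : set V := [set x : V | enorm x < 1 /\ L x != 0].

Let wp : w != p. Proof. by apply: contra_neq Lw => ->. Qed.

Let T0 : 0 <= T.
Proof.
have := HT (g := fun=> 0); rewrite normc0; apply => //.
by split => z _; [exact: differentiable_cst|rewrite /unit_disk /= expr0n /= addr0 sqrtr0].
Qed.

Let open_D (x : V) : D x -> exists2 d : K, 0 < d & forall y : V, eball x d y -> D y.
Proof.
move=> [x1 Lx]; have cL : {for x, continuous L} by exact: differentiable_continuous.
have /continuous_CP/(_ (normc (L x))) := cL; rewrite normc_gt0 => /(_ Lx)/nbhs_enormP[d d0 Hd].
exists (Num.min d (1 - enorm x)); first by rewrite lt_min d0 subr_gt0.
move=> y; rewrite /eball /= lt_min => /andP[/Hd yL yx]; split.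
  by have := ler_enormD (y - x) x; rewrite subrK; lra.
by apply: contraTneq yL => ->; rewrite sub0r normcN ltxx.
Qed.

(** On the complex line from [p] to [w] the function [L] is nonzero at parameter 1, so by
    [zero_near_closure_support] its nonzeros accumulate at parameter 0, that is at [p]. *)
Let D_clusters (eta : K) : 0 < eta -> exists2 q, D q & enorm (q - p) < eta.
Proof.
move=> e0; pose l (t : C^o) : V := p + (t : C) *: (w - p).
have dl (t : C^o) : differentiable (fun t => L (l t)) t by exact: differentiable_on_line.
have d0 : 0 < enorm (w - p) by rewrite enorm_gt0 subr_eq0.
pose e := Num.min (eta / enorm (w - p)) ((1 - enorm p) / enorm (w - p)).
have e1 : 0 < e by rewrite lt_min !divr_gt0 // subr_gt0.
have r12 : (2 : K) < 3 by lra.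
have a2 : normc (1 : C) < 2 by rewrite normc1; lra.
have L1 : L (l 1) != 0 by rewrite /l scale1r addrC subrK.
have [t te Lt] := zero_near_closure_support (ltr0n _ 2) r12 (fun z _ => differentiable_continuous (dl z))
  (fun z _ _ => holo_limit_differentiable ((nbhsCP _ _).2 (ex_intro2 _ _ 1 ltr01 (fun y _ => dl y)))) a2 L1 e1.
have E : l t - p = (t : C) *: (w - p) by rewrite /l addrAC subrr add0r.
move: te; rewrite lt_min !ltr_pdivlMr // => /andP[t1 t2].
exists (l t); last by rewrite E enormZ.
by split => //; have := ler_enormD (l t - p) p; rewrite subrK E enormZ; lra.
Qed.

Lemma squeezing_le : (squeezing D w <= T%:E)%E.
Proof.
apply: ge_ereal_sup => _ [r [r0 [f [[df fB] fi fw fr]]] <-].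
rewrite lee_fin leNgt; apply/negP => Tr.
pose T' := (T + r) / 2; have TT' : T < T' by rewrite /T'; lra.
have T'r : T' < r by rewrite /T'; lra.
have [eta eta0 Heta] := uniform_schwarz dL w1 Lw p1 wp HT TT'.
have bf q : D q -> enorm (q - p) < eta -> enorm (f q) <= T'.
  move=> [q1 Lq] qp; have [u u1 <-] := hdot_unit (f q).
  apply: (Heta q q1 Lq qp (fun x => hdot (f x) u)); last by rewrite fw hdot0l.
  move=> x x1 Lx; split.
    exact: differentiable_hdot_comp (df x (conj x1 Lx)).
  apply: le_lt_trans (hdot_le_enorm _ u1) _.
  by have := fB x (conj x1 Lx); rewrite eball0E.
have [y yT' Hy] := cluster_image D_clusters (ex_intro2 _ _ eta eta0 bf).
have [d Dd fd] : (f @` D) y by apply: fr; rewrite eball0E; exact: le_lt_trans yT' T'r.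
have [rd rd0 Hrd] := open_D Dd.
have pd : 0 < enorm (p - d).
  by rewrite enorm_gt0 subr_eq0; apply: contra_neq Dd.2 => <-.
(* A point within this distance of [d] cannot also be within it of [p]; injectivity will force such
   a coincidence. *)
have e0 : 0 < enorm (p - d) / 2 by rewrite divr_gt0.
have ib : set_inj (eball d rd) f.
  by move=> x x' xd xd'; apply: fi; rewrite inE; apply: Hrd; rewrite -[eball _ _ _]inE.
have [s s0 Hs] := injective_open rd0 (fun x xd => df x (Hrd x xd)) ib e0.
have [q [Dq qp qy]] := Hy s (enorm (p - d) / 2) s0 e0.
have [x [xe xrd fx]] := Hs (f q) (eq_ind_r (fun z => enorm (f q - z) < s) qy fd).
have xq : x = q by apply: fi fx; rewrite inE //; exact: Hrd.
have := ler_enorm_dist q p d; rewrite [enorm (p - q)]enormBC; move: xe; rewrite xq /eball /=; lra.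
Qed.

Hypothesis cone : cone_at p L.

Lemma fridman_le : (fridman D w <= T%:E)%E.
Proof.
apply: ge_ereal_sup => _ [rho [rho0 [f [[df fD] fi fr]]] <-].
rewrite lee_fin leNgt; apply/negP => Tr.
(* Two intermediate levels: functions stay below [T'] near [p], and the supremum of the resulting
   distances is at most [artanh T2], still strictly below [rho]. *)
pose T' := (T * 2 + tanh rho) / 3; pose T2 := (T + tanh rho * 2) / 3.
have TT' : T < T' by rewrite /T'; lra.
have T'2 : T' < T2 by rewrite /T' /T2; lra.
have T2r : T2 < tanh rho by rewrite /T2; lra.
have r1 := tanh_lt1 rho.
have T2a : tanh (artanh T2) = T2 by apply: tanh_artanh; have := T0; rewrite /T2; lra.
have [eta eta0 Heta] := uniform_schwarz dL w1 Lw p1 wp HT TT'.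
have cov q : D q -> enorm (q - p) < eta -> (f @` eball 0 1) q.
  move=> [q1 Lq] qp; apply: fr; split; first by split.
  apply: (@le_lt_trans _ _ (artanh T2)%:E); last first.
    by rewrite lte_fin; apply: tanh_lt_inv; rewrite T2a.
  apply: ge_ereal_sup => _ [g [[dg gB] gw] <-]; rewrite lee_fin ltW //.
  have gq : normc (g q) <= T'.
    apply: (Heta q q1 Lq qp g) gw => x x1 Lx.
    by split; [exact: dg (conj x1 Lx)|exact: gB (conj x1 Lx)].
  by apply: tanh_lt_inv; rewrite T2a tanh_artanh; have := normc_ge0 (g q); lra.
pose G (y : V) : V := xget 0 [set x | enorm x < 1 /\ f x = y].
have GF (x : V) : enorm x < 1 -> G (f x) = x.
  move=> x1; rewrite /G; case: xgetP => [z _ [z1 zE]|/(_ x)]; last by case.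
  by apply: fi zE; rewrite inE eball0E.
have inB (x : V) : enorm x < 1 -> exists2 d : K, 0 < d & forall z : V, eball x d z -> enorm z < 1.
  move=> x1; have [d d0 Hd] := @eball_nbhs _ _ 0 1 x (eq_ind_r id x1 (eball0E 1 x)).
  by exists d => // z /Hd; rewrite eball0E.
have dG q : D q -> enorm (q - p) < eta -> [/\ enorm (G q) < 1, f (G q) = q & differentiable G q].
  move=> Dq qp; have [x] := cov q Dq qp; rewrite eball0E => x1 <-.
  rewrite GF //; split => //.
  have [d d0 Hd] := inB x x1.
  have dfx (z : V) : eball x d z -> differentiable f z by move=> /Hd z1; apply: df; rewrite eball0E.
  have ib : set_inj (eball x d) f.
    by move=> z z' zd zd'; apply: fi; rewrite inE eball0E; apply: Hd; rewrite -[eball _ _ _]inE.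
  have ux := injective_jacobian_unit d0 dfx ib.
  have [s s0 Hs] := local_inverse_differentiable d0 dfx (fun z zd => GF z (Hd z zd)) ux.
  by have [] := Hs (f x) (eball_center (f x) s0).
have [eps0 eps00 Hc] := cone.
pose eps := Num.min (Num.min eps0 eta) (1 - enorm p).
have eps1 : 0 < eps by rewrite !lt_min eps00 eta0 subr_gt0.
have [q Dq qp] := D_clusters eps1.
pose v : V := q - p.
have v0 : 0 < enorm v by rewrite enorm_gt0 subr_eq0; apply: contra_neq Dq.2 => ->.
pose y (l : C^o) : V := p + (l : C) *: v.
have yp l : enorm (y l - p) = normc (l : C) * enorm v.
  by rewrite /y addrAC subrr add0r enormZ.
pose r' := eps / enorm v; pose r := r' / 2.
have r'0 : 0 < r' by rewrite divr_gt0.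
have r0 : 0 < r by rewrite divr_gt0.
have rr' : r < r' by rewrite /r; lra.
have yD (l : C^o) : normc (l : C) < r' -> l != 0 -> D (y l) /\ enorm (y l - p) < eta.
  rewrite /r' ltr_pdivlMr // -yp !lt_min => /andP[/andP[l1 l2] l3] l0; split => //; split.
    by have := ler_enormD (y l - p) p; rewrite subrK; lra.
  apply: Hc => //.
  - by rewrite /v addrC subrK; exact: Dq.2.
  - by move: qp; rewrite !lt_min => /andP[/andP[]].
  - by move: l1; rewrite yp enormZ.
have Gl (l : C^o) : normc (l : C) < r' -> l != 0 ->
    [/\ enorm (G (y l)) < 1, f (G (y l)) = y l & differentiable (fun l => G (y l)) l].
  move=> lr l0; have [Dl le] := yD l lr l0; have [G1 G2 G3] := dG _ Dl le.
  split => //; exact: (@differentiable_on_line _ _ _ G p v l).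
pose circle := [set l : C^o | normc (l : C) <= r /\ r <= normc (l : C)].
have ccircle : compact circle.
  apply: (@compact_bounded_closed _ _ r); last by move=> z [].
  have cn : continuous (fun z : C^o => normc (z : C) : K).
    by move=> z; apply: continuous_normc; exact: cvg_id.
  apply: closedI; first by apply: closed_normc_le => z; exact: cvg_id.
  apply: (@preimage_closed _ _ (fun z : C^o => normc (z : C) : K) [set t | r <= t]).
    by move=> z _; exact: cn.
  exact: closed_ge.
have circ0 (l : C^o) : circle l -> normc (l : C) < r' /\ l != 0.
  by move=> [l1 l2]; split; [exact: le_lt_trans rr'|rewrite -normc_gt0; exact: lt_le_trans l2].
have cG : {within circle, continuous (fun l => enorm (G (y l)) : K)}.
  apply: continuous_in_subspaceT => l; rewrite inE => /circ0[l1 l0].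
  have [_ _ dGl] := Gl l l1 l0.
  by apply: (@continuous_enorm _ _ C^o (fun l => G (y l))); exact: differentiable_continuous.
have ne : circle !=set0.
  by exists (r%:C : C^o); rewrite /circle /mkset normc_real gtr0_norm.
have [lc] := compact_EVT_max ne ccircle cG; rewrite inE => lcc Hlc.
(* On the compact circle the values of [G] keep away from the unit sphere; the maximum principle off
   the single zero of [l] extends the bound [c < 1] to the punctured disc. *)
pose c := enorm (G (y lc)).
have c1 : c < 1 by have [l1 l0] := circ0 _ lcc; have [] := Gl _ l1 l0.
have Gc (l : C^o) : normc (l : C) <= r -> l != 0 -> enorm (G (y l)) <= c.
  move=> lr l0; have [u u1 <-] := hdot_unit (G (y l)).
  apply: (@maximum_off_zeros _ (fun l : C^o => l) (fun l : C^o => hdot (G (y l)) u) r r' 1 c r0 rr'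
    _ _ _ _ _ _ l lr l0).
  - by move=> z _; exact: cvg_id.
  - move=> z _ _; apply: holo_limit_differentiable; apply: (nbhsCP _ _).2; exists 1 => //.
  - move=> z zr z0; have [_ _ dGz] := Gl z zr z0.
    exact: differentiable_hdot_comp dGz.
  - move=> z zr z0; have [Gz1 _ _] := Gl z zr z0.
    exact: le_trans (hdot_le_enorm _ u1) (ltW Gz1).
  - move=> z zr z0; apply: le_trans (hdot_le_enorm _ u1) _.
    by apply: Hlc; rewrite inE /circle /mkset zr lexx.
  - exact: enorm_ge0.
pose S : set V := [set q | exists2 l : C^o, normc (l : C) <= r /\ l != 0 & q = y l].
have accS e : 0 < e -> exists2 q, S q & enorm (q - p) < e.
  move=> e0; pose t := Num.min r (e / (2 * enorm v)).
  have t0 : 0 < t by rewrite lt_min r0 divr_gt0 // mulr_gt0.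
  have t2 : t * (2 * enorm v) <= e by rewrite -ler_pdivlMr ?mulr_gt0 // ge_min lexx orbT.
  exists (y t%:C).
    exists (t%:C) => //; rewrite normc_real gtr0_norm // ge_min lexx; split => //.
    by rewrite eq_complex /= gt_eqF.
  rewrite yp normc_real gtr0_norm //; have := mulr_gt0 t0 v0; rewrite mulrCA in t2.
  by move: (t * _) t2 => x; lra.
have bS : exists2 eta : K, 0 < eta & forall q, S q -> enorm (q - p) < eta -> enorm (G q) <= c.
  by exists 1 => // _ [l [lr l0] ->] _; exact: Gc.
have [x xc Hx] := cluster_image accS bS.
have x1 : enorm x < 1 by exact: le_lt_trans c1.
have xB : eball 0 1 x by rewrite eball0E.
suff fxp : f x = p by have [_] := fD x xB; rewrite fxp Lp eqxx.
apply/eqP; rewrite -subr_eq0 -enorm_eq0 eq_le enorm_ge0 andbT; apply/ler_addgt0Pr => e e0.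
have e2 : 0 < e / 2 by rewrite divr_gt0.
have /continuous_enormP/(_ _ e2)/nbhs_enormP[d d0 Hd] := differentiable_continuous (df x xB).
have [_ [[l [lr l0] ->] yl Gx]] := Hx d (e / 2) d0 e2.
have := Hd _ Gx; have [_ -> _] := Gl l (le_lt_trans lr rr') l0.
have := ler_enorm_dist (y l) (f x) p; rewrite [enorm (f x - y l)]enormBC add0r => h le2.
by apply: le_trans h _; rewrite [leRHS]splitr lerD // ltW.
Qed.

End punctured_domain.

(** * Failure of the sub-mean value property *)

Section circle_mean_bound.
Context {K : realType}.
Local Notation C := K[i].

(** As [M >= 0], it bounds the positive part of [v] as well, and dropping the negative part can only
    enlarge the integral. *)
Lemma circle_mean_le (v : C^o -> \bar K) (a : C^o) (rho M : K) : 0 <= M ->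
  (forall t : K, (v ((a : C) + rho%:C * (cos t +i* sin t))%R <= M%:E)%E) ->
  (circle_mean v a rho <= M%:E)%E.
Proof.
move=> M0 vM; have p0 : 0 < 2 * pi :> K by rewrite mulr_gt0 // pi_gt0.
rewrite /circle_mean; set I := integral _ _ _.
suff IM : (I <= (M * (2 * pi))%:E)%E.
  have -> : M%:E = ((2 * pi)^-1%:E * (M * (2 * pi))%:E)%E.
    by rewrite -EFinM mulrCA mulVf ?mulr1 // gt_eqF.
  by rewrite lee_pmul2l // lte_fin invr_gt0.
have -> : (M * (2 * pi))%:E = (\int[lebesgue_measure]_(t in `[0%R, (2 * pi)%R]) M%:E)%E.
  by rewrite integral_cst //= lebesgue_measure_itv /= lte_fin p0 sube0 EFinM.
rewrite /I integralE; set J := (X in (_ - X)%E).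
have J0 : (0 <= J)%E by apply: integral_ge0 => t _; exact: funeneg_ge0.
apply: (@le_trans _ _ (\int[lebesgue_measure]_(t in `[0%R, (2 * pi)%R])
  (fun t => v ((a : C) + rho%:C * (cos t +i* sin t))%R)^\+ t)%E).
  by apply: geeDl; rewrite oppe_le0.
(* [v] need not be measurable, so monotonicity is read off the suprema over
   simple functions that define both integrals. *)
rewrite !ge0_integralE; [|by move=> t _; rewrite lee_fin|by move=> t _; exact: funepos_ge0].
apply: ereal_sup_le => _ [h hv <-]; exists h => // t; apply: le_trans (hv t) _.
by rewrite /patch; case: ifP => // _; rewrite funeposE ge_max vM lee_fin.
Qed.

(** Without a uniform bound, the sets where [v] exceeds [M], for [M < R], generate a filter on [A];
    at a cluster point it contradicts the local bound. *)
Lemma compact_uniform_lt (T : topologicalType) (v : T -> \bar K) (A : set T) (R : K) :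
  0 < R -> compact A ->
  (forall l, A l -> exists2 a : K, a < R & \forall l' \near l, A l' -> (v l' < a%:E)%E) ->
  exists M : K, [/\ 0 <= M, M < R & forall l, A l -> (v l <= M%:E)%E].
Proof.
move=> R0 cA loc; apply: contrapT => none.
have big (M : K) : 0 <= M -> M < R -> exists2 l, A l & (M%:E < v l)%E.
  move=> M0 MR; apply: contrapT => H; apply: none; exists M; split => // l Al.
  by rewrite leNgt; apply/negP => h; apply: H; exists l.
pose Fl : set_system T := [set S | exists M : K, [/\ 0 <= M, M < R &
  forall l, A l -> (M%:E < v l)%E -> S l]].
have FF : ProperFilter Fl.
  apply: Build_ProperFilter_ex.
    by move=> S [M [M0 MR H]]; have [l Al vl] := big M M0 MR; exists l; exact: H.
  apply: Build_Filter; first by exists 0.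
    move=> S S' [M [M0 MR H]] [M' [M0' MR' H']]; exists (Num.max M M').
    split; [by rewrite le_max M0|by rewrite gt_max MR|].
    by move=> l Al; rewrite EFin_max gt_max => /andP[h h']; split; [exact: H|exact: H'].
  by move=> S S' SS' [M [M0 MR H]]; exists M; split => // l Al /(H l Al)/SS'.
have FA : Fl A by exists 0.
have [l [Al cl]] := cA Fl FF FA; have [a aR va] := loc l Al.
have Fa : Fl (A `&` [set x | (a%:E < v x)%E]).
  exists (Num.max 0 a); split; [by rewrite le_max lexx|by rewrite gt_max R0|].
  by move=> x Ax; rewrite EFin_max gt_max => /andP[_ h].
by have [x [[Ax ax] /(_ Ax)/(lt_trans ax)]] := cl _ _ Fa va; rewrite ltxx.
Qed.

Lemma compact_circle (r : K) : compact [set l : C^o | normc (l : C) = r].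
Proof.
apply: (@compact_bounded_closed _ _ r); last by move=> z ->.
have cn (z : C^o) : {for z, continuous (fun z : C^o => normc (z : C) : K)}.
  by apply: continuous_normc; exact: cvg_id.
apply: (@preimage_closed _ _ (fun z : C^o => normc (z : C) : K) [set t | t = r]).
  by move=> z _; exact: cn.
exact: closed_eq.
Qed.

Lemma not_subharmonic (U : set C^o) (v : C^o -> \bar K) (r R : K) : 0 < r -> 0 < R ->
  [set l : C^o | normc (l : C) <= r] `<=` U ->
  (forall l : C^o, normc (l : C) = r -> exists2 T : K, T < R & (v l <= T%:E)%E) ->
  (R%:E <= v 0%R)%E -> ~ subharmonic U v.
Proof.
move=> r0 R0 rU vT Rv [_ usc mean].
have [|M [M0 MR vM]] := @compact_uniform_lt _ v _ R R0 (compact_circle (r := r)).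
  move=> l lr; have [T TR vl] := vT l lr; exists ((T + R) / 2); first lra.
  have vl' : (v l < ((T + R) / 2)%:E)%E by apply: (le_lt_trans vl); rewrite lte_fin; lra.
  have Ul : U l by apply: rU; rewrite /mkset lr.
  have : nbhs l [set x | U x -> (v x < ((T + R) / 2)%:E)%E] := usc l Ul _ vl'.
  by apply: filterS => x H xr; apply: H (rU _ _); rewrite /mkset xr.
have m0 : (v 0%R <= circle_mean v 0%R r)%E.
  by apply: mean => // l; rewrite /mkset subr0; exact: rU.
have mM : (circle_mean v 0%R r <= M%:E)%E.
  apply: circle_mean_le => // t; apply: vM; rewrite /mkset add0r normcM normc_real gtr0_norm //.
  by rewrite /normc cos2Dsin2 sqrtr1 mulr1.
by have := le_trans (le_trans Rv m0) mM; rewrite lee_fin leNgt MR.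
Qed.

End circle_mean_bound.

Section lower_bounds.
Context {K : realType} {n : nat}.
Local Notation C := K[i].
Local Notation V := ('rV[C]_n : normedModType C).

(** Translates the hypothesis on [delta], about the hyperbolic tangent of a distance, into a bound
    for each single function. *)
Lemma etanh_caratheodory_ge (D : set V) (z w : V) (f : V -> C^o) :
  holomorphic_map D unit_disk f -> f z = 0 -> D w ->
  normc (f w) <= etanh (caratheodory D z w).
Proof.
move=> fh fz Dw; have f1 : normc (f w) < 1 by have [_ /(_ w Dw)] := fh.
have : ((artanh (normc (f w)))%:E <= caratheodory D z w)%E.
  by apply: ereal_sup_ubound; exists f.
case: (caratheodory D z w) => [c| |] //=; last by move=> _; exact: ltW.
rewrite lee_fin => /tanh_le; rewrite tanh_artanh //.
by have := normc_ge0 (f w); lra.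
Qed.

Lemma squeezing_ge (D : set V) (R : K) : 0 < R -> D `<=` eball 0 1 -> eball 0 R `<=` D ->
  (R%:E <= squeezing D 0)%E.
Proof.
move=> R0 D1 RD; apply: ereal_sup_ubound; exists R => //; split => //; exists id; split => //.
by rewrite image_id.
Qed.

(** Linear functionals [hdot x u] are admissible on [D], so the Carathéodory distance from 0 to [w]
    is at least [artanh (enorm w)]. The ball of radius [artanh R] therefore lies in the Euclidean
    ball of radius [R], the image of the dilation. *)
Lemma fridman_ge (D : set V) (R : K) : 0 < R -> R < 1 -> D `<=` eball 0 1 -> eball 0 R `<=` D ->
  (R%:E <= fridman D 0)%E.
Proof.
move=> R0 R1 D1 RD; have TR : tanh (artanh R) = R by apply: tanh_artanh => //; lra.
have nR : normc R%:C = R by rewrite normc_real gtr0_norm.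
have RC0 : R%:C != 0 :> C by rewrite -normc_gt0 nR.
apply: ereal_sup_ubound; exists (artanh R); last by rewrite TR.
split.
  apply: tanh_lt_inv; rewrite TR; apply: le_lt_trans R0.
  by rewrite /tanh oppr0 subrr mul0r.
exists (fun x => R%:C *: x); split.
- split=> x; first by move=> _; exact: differentiableZ.
  by rewrite eball0E => x1; apply: RD; rewrite eball0E enormZ nR; nra.
- by move=> x y _ _ /(scalerI RC0).
- move=> w [Dw cw]; have wR : enorm w < R.
    have [u u1 uw] := hdot_unit w; rewrite ltNge; apply/negP => Rw.
    have w1 : enorm w < 1 by have := D1 w Dw; rewrite eball0E.
    have : ((artanh (enorm w))%:E < (artanh R)%:E)%E.
      apply: le_lt_trans cw; apply: ereal_sup_ubound; exists (fun x => hdot x u) => /=; last by rewrite uw.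
      split; last exact: hdot0l.
      split=> x Dx; first exact: differentiable_hdot.
      apply: le_lt_trans (hdot_le_enorm _ u1) _.
      by have := D1 x Dx; rewrite eball0E.
    rewrite lte_fin ltNge => /negP; apply; rewrite leNgt; apply/negP => h.
    have E : tanh (artanh (enorm w)) = enorm w by apply: tanh_artanh => //; lra.
    have := tanh_le (ltW h); rewrite E TR => wR; have wE : enorm w = R by apply/eqP; rewrite eq_le wR.
    by move: h; rewrite wE ltxx.
  exists (R%:C^-1 *: w); last by rewrite scalerA divff // scale1r.
  by rewrite eball0E enormZ -real_complexV normc_real gtr0_norm ?invr_gt0 // mulrC ltr_pdivrMr // mul1r.
Qed.

End lower_bounds.

Section arrangement.
Context {K : realType} {n : nat}.
Local Notation C := K[i].
Local Notation V := ('rV[C]_n : normedModType C).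

Lemma normal_hyperplaneE (z p w : V) : normal_hyperplane z p w <-> hdot (w - p) (z - p) = 0.
Proof.
rewrite /normal_hyperplane /= /hdot; under eq_bigr do rewrite mulrC.
by under [in X in _ <-> X]eq_bigr do rewrite !mxE.
Qed.

(** [z - p] is a nonzero real multiple of [z], so the equation reads [hdot w z = R * r], and the
    Cauchy-Schwarz inequality concludes. *)
Lemma normal_hyperplane_far (z w : V) (r R : K) : 0 < r -> r < R -> enorm z = r ->
  normal_hyperplane z ((R / r)%:C *: z) w -> R <= enorm w.
Proof.
move=> r0 rR zr /normal_hyperplaneE.
have -> : z - (R / r)%:C *: z = (1 - R / r)%:C *: z by rewrite rmorphB rmorph1 scalerBl scale1r.
have nz : 1 - R / r != 0.
  by rewrite subr_eq0 eq_sym; apply/eqP => /(congr1 ( *%R^~ r)); rewrite divfK ?gt_eqF // mul1r => E; lra.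
rewrite hdotZr conjc_real => /eqP; rewrite mulf_eq0 eq_complex /= eqxx andbT (negPf nz) /=.
rewrite hdotBl hdotZl hdotxx subr_eq0 => /eqP E.
have := hdot_le w z; rewrite E normcM !normc_real zr !ger0_norm ?sqr_ge0 ?divr_ge0; try lra.
by rewrite expr2 mulrA divfK ?gt_eqF // ler_pM2r.
Qed.

(** A hyperplane through [p] is a cone with vertex [p]; one that misses [p] also misses a
    neighbourhood of it. *)
Lemma cone_at_hdot (p q u : V) : cone_at p (fun x => hdot (x - q) u).
Proof.
have E v : hdot (p + v - q) u = hdot (p - q) u + hdot v u by rewrite addrAC hdotDl.
case: (eqVneq (hdot (p - q) u) 0) => [h0|h0].
  exists 1 => // v; rewrite !E h0 !add0r => hv _ l l0 _.
  by rewrite E h0 add0r hdotZl mulf_neq0.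
have d0 : 0 < enorm u + 1 by have := enorm_ge0 u; lra.
exists (normc (hdot (p - q) u) / (enorm u + 1)); first by rewrite divr_gt0 ?normc_gt0.
move=> v _ _ l _; rewrite ltr_pdivlMr // E => lv.
rewrite addr_eq0; apply/eqP => h; move: lv; rewrite h normcN.
by have := hdot_le (l *: v) u; have := enorm_ge0 (l *: v); lra.
Qed.

Lemma cone_at_prod (I : Type) (s : seq I) (F : I -> V -> C) (p : V) :
  (forall i, cone_at p (F i)) -> cone_at p (fun x => \prod_(i <- s) F i x).
Proof.
move=> cF; elim: s => [|i s [e e0 H]].
  by exists 1 => // v _ _ l _ _; rewrite big_nil oner_eq0.
have [d d0 Hd] := cF i; exists (Num.min d e); first by rewrite lt_min d0.
move=> v; rewrite !big_cons mulf_eq0 negb_or => /andP[Fv Pv].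
rewrite lt_min => /andP[vd ve] l l0; rewrite lt_min big_cons => /andP[ld le].
by rewrite mulf_neq0 //; [exact: Hd Fv vd _ l0 ld|exact: H Pv ve _ l0 le].
Qed.

Lemma differentiable_prod (I : Type) (s : seq I) (F : I -> V -> C^o) (x : V) :
  (forall i, differentiable (F i) x) ->
  differentiable (fun y => \prod_(i <- s) (F i y : C) : C^o) x.
Proof.
move=> dF; elim: s => [|i s IH].
  rewrite (_ : (fun _ => _) = fun=> 1 : C^o); first exact: differentiable_cst.
  by apply/funext => y; rewrite big_nil.
rewrite (_ : (fun _ => _) = fun y => (F i y : C) * \prod_(j <- s) (F j y : C) : C^o).
  exact: differentiableM.
by apply/funext => y; rewrite big_cons.
Qed.

End arrangement.

Lemma not_plurisubharmonic (K : realType) (n : nat) (D : set 'rV[K[i]]_n)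
    (u : 'rV[K[i]]_n -> \bar K) (r R : K) :
  (0 < n)%N -> 0 < r -> r < R -> eball 0 R `<=` D ->
  (forall w, enorm w = r -> exists2 T : K, T < R & (u w <= T%:E)%E) ->
  (R%:E <= u 0%R)%E -> ~ plurisubharmonic D u.
Proof.
move=> n0 r0 rR RD uT Ru [_ _ sub]; pose b : 'rV[K[i]]_n := delta_mx ord0 (Ordinal n0).
have nb (l : K[i]) : enorm (0 + l *: b) = normc l by rewrite add0r enormZ enorm_delta mulr1.
apply: not_subharmonic r0 (lt_trans r0 rR) _ _ _ (sub 0 b).
- by move=> l lr; apply: RD; rewrite eball0E nb; exact: le_lt_trans rR.
- by move=> l lr; apply: uT; rewrite nb.
- by rewrite scale0r addr0.
Qed.

Theorem theorem4p2 (K : realType) (n : nat) (r R delta : K) (m : nat)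
    (z p : 'I_m -> 'rV[K[i]]_n) (D : set 'rV[K[i]]_n)
    (n_ge1 : (1 <= n)%N) (r_gt0 : 0 < r) (r_lt_R : r < R) (R_lt1 : R < 1)
    (delta_gt0 : 0 < delta)
    (delta_ball : forall x : 'rV[K[i]]_n, esphere r x ->
       eball x delta `<=` eball 0 1 /\
       forall w, eball x delta w ->
         etanh (caratheodory (eball 0 1) ((R / r)%:C *: x) w) < R)
    (z_sphere : forall i, esphere r (z i))
    (z_cover : esphere r `<=` \bigcup_(i in [set: 'I_m]) eball (z i) delta)
    (p_def : forall i, p i = (R / r)%:C *: z i)
    (D_def : D = eball 0 1 `\`
                 \bigcup_(i in [set: 'I_m]) normal_hyperplane (z i) (p i)) :
  ~ plurisubharmonic D (squeezing D) /\ ~ plurisubharmonic D (fridman D).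
Proof.
have R0 : 0 < R by exact: lt_trans r_lt_R.
pose L (x : ('rV[K[i]]_n : normedModType K[i])) : K[i]^o :=
  \prod_(i < m) (hdot (x - p i) (z i - p i) : K[i]).
have LE x : L x != 0 <-> forall i, ~ normal_hyperplane (z i) (p i) x.
  rewrite /L; split=> [/prodf_neq0 H i /normal_hyperplaneE Hi|H].
    by have := H i isT; rewrite Hi eqxx.
  by apply/prodf_neq0 => i _; apply/eqP => /normal_hyperplaneE; exact: H.
have DE : D = [set x | enorm x < 1 /\ L x != 0].
  rewrite D_def; apply/seteqP; split=> x; rewrite /= /setD /= eball0E => -[x1 Hx]; split=> //.
    by apply/LE => i Hi; apply: Hx; exists i.
  by case=> i _; exact: (LE x).1 Hx i.
have D1 : D `<=` eball 0 1 by rewrite DE => x [x1 _]; rewrite eball0E.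
have RD : eball 0 R `<=` D.
  rewrite DE => x; rewrite eball0E => xR; split; first exact: lt_trans R_lt1.
  apply/LE => i; rewrite p_def => /(normal_hyperplane_far r_gt0 r_lt_R (z_sphere i)).
  by rewrite leNgt xR.
have dL x : differentiable L x.
  by apply: differentiable_prod => i; apply: differentiable_hdot_comp; exact: differentiableB.
have below w : enorm w = r -> exists2 T : K, T < R &
    (squeezing D w <= T%:E)%E /\ (fridman D w <= T%:E)%E.
  (* The covering selects the index: [w] lies within [delta] of [z i], so the bound for [p i]
     applies to it. Both the index and [T] depend on [w]. *)
  move=> wr; have [i _ wi] := z_cover w wr; have [_ /(_ w wi)] := delta_ball _ (z_sphere i).
  rewrite -p_def; set T := etanh _ => TR; exists T => //.
  have [w1 Lw] : enorm w < 1 /\ L w != 0 by have : D w; [apply: RD; rewrite eball0E wr|rewrite DE].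
  have p1 : enorm (p i) < 1.
    by rewrite p_def enormZ (z_sphere i) normc_real gtr0_norm ?divr_gt0 // divfK ?gt_eqF.
  have Lp : L (p i) = 0 by rewrite /L (bigD1 i) //= subrr hdot0l mul0r.
  have HT g : holomorphic_map (eball 0 1) unit_disk g -> g (p i) = 0 -> normc (g w) <= T.
    by move=> gh gp; apply: etanh_caratheodory_ge => //; rewrite eball0E.
  rewrite DE; split; first exact: squeezing_le dL w1 Lw p1 Lp HT.
  apply: fridman_le dL w1 Lw p1 Lp HT _.
  by apply: (@cone_at_prod _ _ _ _ (fun i x => hdot (x - p i) (z i - p i))) => j; exact: cone_at_hdot.
split; apply: (not_plurisubharmonic n_ge1 r_gt0 r_lt_R RD).
- by move=> w /below[T TR [h _]]; exists T.
- exact: squeezing_ge R0 D1 RD.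
- by move=> w /below[T TR [_ h]]; exists T.
- exact: fridman_ge R0 R_lt1 D1 RD.
Qed.
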